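(* Let $\alpha^2>0$, $\nu>0$, $\beta\ge0$, $x_0>0$, $p>0$ and $C>0$ be real constants. Consider the inverse problem of determining the source $f\in L^2(\mathbb{R})$ in $$\begin{cases} u_t(x,t)=\alpha^2u_{xx}(x,t)-\beta u_x(x,t)-\nu u(x,t)+f(t), & x\in\mathbb{R},\ t>0,\\ u(0,t)=0, & t>0,\\ u(x_0,t)=y(t), & t>0,\\ \lim_{x\to\infty}|u(x,t)|<M, & t>0,\ \text{for some } M\in\mathbb{R},\end{cases}$$ where $u(x,\cdot),y\in L^2(\mathbb{R})$, the system being understood through its Fourier transform in $t$ as described in the context, so that $\hat f(\xi)=\Lambda(\xi)\hat y(\xi)$ with $$\Lambda(\xi)=\frac{\nu+i\xi}{1-e^{\frac{\beta-\sqrt{\beta^2+4\alpha^2(\nu+i\xi)}}{2\alpha^2}x_0}}.$$ Assume that $$\|f\|_{H^p(\mathbb{R})}:=\left(\int_{-\infty}^{\infty}|\hat f(\xi)|^2(1+\xi^2)^p\,d\xi\right)^{1/2}\le C.$$ Then there exists a constant $K$ independent of $\delta$ such that, for every noise level $\delta\in(0,1)$ and every $y_\delta\in L^2(\mathbb{R})$ with $\|y-y_\delta\|_{L^2(\mathbb{R})}\le\delta$, choosing the regularization parameter $\mu>0$ with $\mu^2=\delta^{\frac{2}{p+2}}$, the regularized solution $$f_{\delta,\mu}(t)=\frac{1}{\sqrt{2\pi}}\int_{-\infty}^{+\infty}e^{i\xi t}\,\frac{\Lambda(\xi)}{1+\mu^2\xi^2}\,\hat y_\delta(\xi)\,d\xi$$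 satisfies $$\|f-f_{\delta,\mu}\|_{L^2(\mathbb{R})}\le K\max\left\{\delta^{\frac{p}{p+2}},\delta^{\frac{2}{p+2}}\right\}.$$
   Context: $\hat g(\xi)$ denotes the (unitary) Fourier transform of $g\in L^2(\mathbb{R})$ in the variable $t$, with inverse $g(t)=\frac{1}{\sqrt{2\pi}}\int_{-\infty}^{+\infty}e^{i\xi t}\hat g(\xi)\,d\xi$ (in the $L^2$ sense). $\sqrt{\cdot}$ is the principal square root of complex numbers. Frequency formulation. With $z(\xi)=\nu+i\xi$, the system is understood as: $-\alpha^2\hat u_{xx}(x,\xi)+\beta\hat u_x(x,\xi)+z(\xi)\hat u(x,\xi)=\hat f(\xi)$ for $x,\xi\in\mathbb{R}$; $\hat u(0,\xi)=0$; $\hat u(x_0,\xi)=\hat y(\xi)$; and $\lim_{x\to\infty}|\hat u(x,\xi)|<M^*$ for some $M^*\in\mathbb{R}$. Solving this ordinary differential equation in $x$ gives $\hat f(\xi)=\Lambda(\xi)\hat y(\xi)$. *)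

(* Defs.v *)
From mathcomp Require Import all_boot all_order all_algebra.
From mathcomp Require Import complex.
From mathcomp Require Import all_classical all_reals all_analysis.

Set Implicit Arguments.
Unset Strict Implicit.
Unset Printing Implicit Defensive.

Import Order.TTheory GRing.Theory Num.Theory numFieldNormedType.Exports.

Local Open Scope classical_set_scope.
Local Open Scope ring_scope.
Local Open Scope complex_scope.

Section FourierL2.
Variable R : realType.
Implicit Types (h g G : R -> R[i]).

Local Notation mu := (@lebesgue_measure R).
Local Notation cRe := (@complex.Re R).
Local Notation cIm := (@complex.Im R).

Definition cabs : R[i] -> R := @ComplexField.Normc.normc R.

Definition cexp (z : R[i]) : R[i] :=
  (expR (cRe z) * cos (cIm z)) +i* (expR (cRe z) * sin (cIm z)).

(* R[i] has no structure of normed R-module or of measurable space in the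
   library: derivatives and integrals of complex-valued functions of a real
   variable are taken componentwise. *)
Definition cderivable h : Prop :=
  forall x : R, derivable (cRe \o h) x 1 /\ derivable (cIm \o h) x 1.

Definition cderive h : R -> R[i] :=
  fun x => derive1 (cRe \o h) x +i* derive1 (cIm \o h) x.

Definition cintegral (D : set R) h : R[i] :=
  (\int[mu]_(x in D) cRe (h x)) +i* (\int[mu]_(x in D) cIm (h x)).

(* Square-integrable functions, not classes modulo equality a.e. *)
Definition in_L2 h : Prop :=
  cRe \o h \in Lfun mu 2%:E /\ cIm \o h \in Lfun mu 2%:E.

Definition L2norm h : \bar R := 'N[mu]_2%:E[EFin \o (cabs \o h)].

(* (2 pi)^(-1/2) \int_{-n}^{n} e^{i s x t} g(t) dt *)
Definition truncated_transform (s : R) (n : nat) g : R -> R[i] := fun x =>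
  ((Num.sqrt (2 * pi))^-1)%:C *
  cintegral `[- n%:R, n%:R] (fun t => cexp (0 +i* (s * x * t)) * g t).

(* G is the unitary L^2 transform of g with kernel e^{i s x t}: the integral
   over the whole line is the L^2 limit of the truncated ones, which determines
   G only up to equality a.e. *)
Definition is_L2_transform (s : R) g G : Prop :=
  in_L2 G /\
  (fun n => L2norm (fun x => truncated_transform s n g x - G x))
    @ \oo --> 0%E.

Definition is_fourier g G : Prop := is_L2_transform (- 1) g G.
Definition is_inverse_fourier G g : Prop := is_L2_transform 1 G g.

(* A chosen representative of the transform (0 if there is none). *)
Definition fourier g : R -> R[i] :=
  xget (fun=> 0) [set G | is_fourier g G].
Definition inverse_fourier G : R -> R[i] :=
  xget (fun=> 0) [set g | is_inverse_fourier G g].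

Definition sobolev_norm (p : R) g : \bar R :=
  ((\int[mu]_xi (cabs (fourier g xi) ^+ 2 * (1 + xi ^+ 2) `^ p)%:E)
     `^ 2^-1)%E.

(* The transformed problem. Representatives being only defined up to null sets,
   it is imposed for almost every frequency xi, and then at every x; the bound
   M on the limit may depend on xi. *)
Definition frequency_system (alpha beta nu x0 : R) (f y : R -> R[i])
    (uhat : R -> R -> R[i]) : Prop :=
  {ae mu, forall xi : R,
    let w := fun x => uhat x xi in
    [/\ cderivable w /\ cderivable (cderive w),
        forall x : R,
          - (alpha ^+ 2)%:C * cderive (cderive w) x + beta%:C * cderive w x
          + (nu +i* xi) * w x = fourier f xi,
        w 0 = 0,
        w x0 = fourier y xi &
        exists M l : R, cabs (w x) @[x --> +oo] --> l /\ l < M]}.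

(* sqrtc is the principal square root of R[i]; the generic sqrtC of
   numClosedFieldType is not (it returns the root of nonnegative imaginary
   part). *)
Definition Lambda (alpha beta nu x0 xi : R) : R[i] :=
  let z := nu +i* xi in
  z / (1 - cexp ((beta%:C - sqrtc ((beta ^+ 2)%:C + (4 * alpha ^+ 2)%:C * z))
                   / (2 * alpha ^+ 2)%:C * x0%:C)).

Definition regularized_solution (alpha beta nu x0 mu : R)
    (ydelta : R -> R[i]) : R -> R[i] :=
  inverse_fourier (fun xi =>
    Lambda alpha beta nu x0 xi / (1 + mu ^+ 2 * xi ^+ 2)%:C
    * fourier ydelta xi).

End FourierL2.

(* Main.v *)
Require Import Defs.
From mathcomp Require Import all_boot all_order all_algebra.
From mathcomp Require Import complex ring lra.
From mathcomp Require Import all_classical all_reals all_analysis measurable_realfun.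

(** For almost every frequency the boundary value problem is a linear ODE in
    [x]; boundedness at infinity kills its growing mode, whence
    [fourier f = Lambda * fourier y].  Since [Re (sqrtc _) > beta], the
    denominator of [Lambda] is bounded away from [0], so [Lambda] grows like
    [|xi|] and the filter [1 / (1 + mu^2 xi^2)] makes it bounded by a multiple
    of [1 / mu^2]: this controls the noise.  The Sobolev bound controls the
    bias.

    Both estimates are transported to the time side by the [L^2] theory of the
    Fourier transform, up to multiplicative constants.  For real functions and
    the kernels [cos] and [sin], inserting the weight
    [exp (- |x| / m) 1_{|x| <= m^2}] turns
    [\int ((C a)^2 + (S a)^2)] into a double integral of [a] against an
    approximate Poisson kernel; Young's inequality and Fatou's lemma give
    Bessel's inequality, hence [L^2] limits of the truncated transforms.
    Against an indicator function [1_[c, d]] the Poisson integral is a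
    difference of arctangents, so that passing to the limit gives the Parseval
    identity [\int (C a C 1 + S a S 1) = 2 pi \int_c^d a].  By duality
    [C C + S S = 2 pi] and [S C = C S], which is the inversion theorem. *)

Set Implicit Arguments.
Unset Strict Implicit.
Unset Printing Implicit Defensive.

Import Order.TTheory GRing.Theory Num.Theory numFieldNormedType.Exports.

Local Open Scope classical_set_scope.
Local Open Scope ring_scope.
Local Open Scope complex_scope.

(** * Square-integrable functions *)

Section SquareIntegrable.
Context {R : realType}.
Implicit Types a b h : R -> R.
Local Notation mu := (@lebesgue_measure R).

(** The weight is cut off so that all its integrals live on segments, where the fundamental theorem
    of calculus evaluates them; the loss is uniform in the frequency variable. Functions of bounded
    support come first because the exchange of integrals and this uniform error both cost an [L^1]
    norm. Plancherel's equality is avoided: Bessel's inequality gives boundedness, and Parseval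
    against indicators serves only to identify the inverse. Working with squared norms,
    [(a + b)^2 <= 2 a^2 + 2 b^2] replaces Minkowski, and real and imaginary parts are bounded
    separately; the non-sharp factors 4, 16 and 64 come from there. The Fourier transform is a
    chosen representative, known only almost everywhere, so the estimates are proved for every
    function that satisfies the defining limit. Balance of errors: the filter turns noise [delta]
    into [delta / mu^2], up to constants, while the bias is of order [mu^p] for [p <= 2] and
    saturates at [mu^2] beyond. The choice of [mu] makes [delta / mu^2 = mu^p = delta^(p/(p+2))],
    and [mu^2 = delta^(2/(p+2))] is the other term of the maximum. *)

Lemma ae_imply (P Q : R -> Prop) : (forall x, P x -> Q x) ->
  {ae mu, forall x, P x} -> {ae mu, forall x, Q x}.
Proof. by move=> PQ; apply: filterS => //; exact: (ae_filter_ringOfSetsType mu). Qed.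

Lemma ae_imply2 (P Q S : R -> Prop) : (forall x, P x -> Q x -> S x) ->
  {ae mu, forall x, P x} -> {ae mu, forall x, Q x} -> {ae mu, forall x, S x}.
Proof. by move=> PQ; apply: filterS2 => //; exact: (ae_filter_ringOfSetsType mu). Qed.

(** Values in [\bar R] allow bounds to be stated before finiteness is known. *)
Definition sqnorm h : \bar R := (\int[mu]_x (h x ^+ 2)%:E)%E.

Definition sqintg h : Prop := measurable_fun setT h /\ (sqnorm h < +oo)%E.

Lemma sqnorm_ge0 h : (0 <= sqnorm h)%E.
Proof. by apply: integral_ge0 => x _; rewrite lee_fin sqr_ge0. Qed.

Lemma measurable_sqr h : measurable_fun setT h ->
  measurable_fun setT (EFin \o (fun x => h x ^+ 2)).
Proof. by move=> mh; apply/measurable_EFinP; exact: measurable_funX. Qed.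

Lemma Lnorm2E h : ('N[mu]_2%:E[EFin \o h] = sqnorm h `^ 2^-1)%E.
Proof.
rewrite unlock /Lnorm; congr (_ `^ _)%E; apply: eq_integral => x _.
by rewrite /= powR_mulrn// real_normK// num_real.
Qed.

Lemma sqintgP h : h \in Lfun mu 2%:E <-> sqintg h.
Proof.
split=> [|[mh qh]].
  rewrite inE => /andP[]; rewrite !inE/= => mh.
  rewrite /finite_norm Lnorm2E => H; split=> //.
  by apply: lty_poweRy H; rewrite invr_eq0.
rewrite inE; apply/andP; split; rewrite inE//=.
by rewrite /finite_norm Lnorm2E; exact: poweR_lty.
Qed.

Lemma le_sqnorm a b : measurable_fun setT a -> measurable_fun setT b ->
  (forall x, a x ^+ 2 <= b x ^+ 2) -> (sqnorm a <= sqnorm b)%E.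
Proof.
move=> ma mb ab; apply: ge0_le_integral => //.
- by move=> x _; rewrite lee_fin sqr_ge0.
- exact: measurable_sqr.
- exact: measurable_sqr.
- by move=> x _; rewrite lee_fin.
Qed.

(** The square of [a - b] is nonnegative. This substitute for Minkowski's inequality involves no
    root. *)
Lemma sqnormD a b : measurable_fun setT a -> measurable_fun setT b ->
  (sqnorm (fun x => a x + b x)%R <= 2%:E * sqnorm a + 2%:E * sqnorm b)%E.
Proof.
move=> ma mb; rewrite /sqnorm.
have pos h x : (0 <= (h x ^+ 2)%:E)%E by rewrite lee_fin sqr_ge0.
rewrite -!ge0_integralZl//; [|exact: measurable_sqr..].
rewrite -ge0_integralD//; [|by move=> x _; rewrite mule_ge0//|
  by apply: emeasurable_funM => //; exact: measurable_sqr|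
  by move=> x _; rewrite mule_ge0//|
  by apply: emeasurable_funM => //; exact: measurable_sqr].
apply: ge0_le_integral => //.
- by apply: measurable_sqr; exact: measurable_funD.
- by apply: emeasurable_funD; apply: emeasurable_funM => //; exact: measurable_sqr.
- move=> x _; rewrite -!EFinM -EFinD lee_fin.
  by have := sqr_ge0 (a x - b x); lra.
Qed.

Lemma sqnormZ (c : R) h : measurable_fun setT h ->
  sqnorm (fun x => c * h x) = ((c ^+ 2)%:E * sqnorm h)%E.
Proof.
move=> mh; rewrite /sqnorm -ge0_integralZl//.
- by apply: eq_integral => x _; rewrite exprMn EFinM.
- exact: measurable_sqr.
- by move=> x _; rewrite lee_fin sqr_ge0.
- by rewrite lee_fin sqr_ge0.
Qed.

Lemma sqnormN h : sqnorm (fun x => - h x) = sqnorm h.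
Proof. by apply: eq_integral => x _; rewrite sqrrN. Qed.

Lemma sqnormBC a b : sqnorm (fun x => a x - b x) = sqnorm (fun x => b x - a x).
Proof. by rewrite -sqnormN; apply: eq_integral => x _; rewrite opprB. Qed.

Lemma sqnorm_triangle a b (c : R -> R) : measurable_fun setT a -> measurable_fun setT b ->
  measurable_fun setT c ->
  (sqnorm (fun x => a x - c x)%R <= 2%:E * sqnorm (fun x => a x - b x)%R
     + 2%:E * sqnorm (fun x => b x - c x)%R)%E.
Proof.
move=> ma mb mc.
rewrite [leLHS](_ : _ = sqnorm (fun x => (a x - b x) + (b x - c x))).
  by apply: sqnormD; exact: measurable_funB.
by congr sqnorm; apply/funext => x; ring.
Qed.

Lemma sqintgD a b : sqintg a -> sqintg b -> sqintg (fun x => a x + b x).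
Proof.
move=> [ma qa] [mb qb]; split; first exact: measurable_funD.
apply: le_lt_trans (sqnormD ma mb) _.
by rewrite lte_add_pinfty// lte_mul_pinfty.
Qed.

Lemma sqintgZ (c : R) h : sqintg h -> sqintg (fun x => c * h x).
Proof.
move=> [mh qh]; split; first exact: measurable_funM.
by rewrite sqnormZ// lte_mul_pinfty// lee_fin sqr_ge0.
Qed.

Lemma sqintgN h : sqintg h -> sqintg (fun x => - h x).
Proof.
by move=> [mh qh]; split; [exact: measurableT_comp|rewrite sqnormN].
Qed.

Lemma sqintgB a b : sqintg a -> sqintg b -> sqintg (fun x => a x - b x).
Proof. by move=> sa sb; apply: sqintgD => //; exact: sqintgN. Qed.

Lemma le_sqintg a b : measurable_fun setT a -> sqintg b ->
  (forall x, a x ^+ 2 <= b x ^+ 2) -> sqintg a.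
Proof.
move=> ma [mb qb] ab; split => //; exact: le_lt_trans (le_sqnorm ma mb ab) qb.
Qed.

Lemma sqintg_mul a b : sqintg a -> sqintg b ->
  mu.-integrable setT (EFin \o (fun x => a x * b x)).
Proof.
move=> /sqintgP la /sqintgP lb.
by have /Lfun1_integrable := Lfun2_mul_Lfun1 la lb.
Qed.

Lemma sqnorm_fin_num h : sqintg h -> sqnorm h \is a fin_num.
Proof. by move=> [_ qh]; rewrite ge0_fin_numE// sqnorm_ge0. Qed.

Lemma cauchy_schwarz a b : sqintg a -> sqintg b ->
  `|\int[mu]_x (a x * b x)| <=
    Num.sqrt (fine (sqnorm a)) * Num.sqrt (fine (sqnorm b)).
Proof.
move=> sa sb.
have iab := sqintg_mul sa sb.
have [ma _] := sa; have [mb _] := sb.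
rewrite -lee_fin EFin_normr_Rintegral//.
apply: le_trans (le_abse_integral _ _ _) _ => //; first exact: measurable_int iab.
rewrite -[leLHS]Lnorm1.
have := @hoelder _ _ _ mu a b 2 2 ma mb.
rewrite (_ : 2^-1 + 2^-1 = 1); last by rewrite [RHS]splitr !div1r.
move=> /(_ _ _ erefl); rewrite !ltr0n => /(_ isT isT) /le_trans; apply.
rewrite !Lnorm2E EFinM.
have H h : sqintg h -> (sqnorm h `^ 2^-1)%E = (Num.sqrt (fine (sqnorm h)))%:E.
  move=> sh; rewrite -{1}(fineK (sqnorm_fin_num sh)) poweR_EFin powR12_sqrt//.
  by rewrite fine_ge0// sqnorm_ge0.
by rewrite !H.
Qed.

Lemma sqnorm_cvg0_fine (u : nat -> R -> R) : (forall n, sqintg (u n)) ->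
  (fun n => sqnorm (u n)) @ \oo --> 0%E ->
  (fun n => Num.sqrt (fine (sqnorm (u n)))) @ \oo --> 0.
Proof.
move=> su u0.
rewrite -(sqrtr0 R).
apply: (@continuous_cvg _ _ _ _ _ (fun n => fine (sqnorm (u n))) Num.sqrt 0).
  exact: sqrt_continuous.
by apply: fine_cvg u0.
Qed.

(** Cauchy-Schwarz bounds the difference of the two sides. This is how identities known for
    truncated functions pass to their [L^2] limits. *)
Lemma cvg_inner (u : nat -> R -> R) a b : (forall n, sqintg (u n)) -> sqintg a ->
  sqintg b -> (fun n => sqnorm (fun x => u n x - a x)) @ \oo --> 0%E ->
  (fun n => \int[mu]_x (u n x * b x)) @ \oo --> \int[mu]_x (a x * b x).
Proof.
move=> su sa sb ua.
apply/subr_cvg0/norm_cvg0P.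
pose w n := Num.sqrt (fine (sqnorm (fun x => u n x - a x))) *
  Num.sqrt (fine (sqnorm b)).
apply: (@squeeze_cvgr _ _ _ _ (fun=> 0) w); last 2 first.
- exact: cvg_cst.
- rewrite /w -(mul0r (Num.sqrt (fine (sqnorm b)))); apply: cvgMr_tmp.
  by apply: sqnorm_cvg0_fine => // n; exact: sqintgB.
apply: nearW => n; rewrite normr_ge0/=.
rewrite -RintegralB//; [|exact: sqintg_mul..].
rewrite [leLHS](_ : _ = `|\int[mu]_x ((u n x - a x) * b x)|).
  by apply: cauchy_schwarz => //; exact: sqintgB.
by congr `| _ |; apply: eq_Rintegral => x _; rewrite mulrBl.
Qed.

Lemma le_sqnorm_cvg (u : nat -> R -> R) a (M : \bar R) :
  (forall n, measurable_fun setT (u n)) -> measurable_fun setT a ->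
  {ae mu, forall x, u n x @[n --> \oo] --> a x} ->
  (\forall n \near \oo, sqnorm (u n) <= M)%E -> (sqnorm a <= M)%E.
Proof.
move=> mun ma ua uM.
(* Fatou's lemma speaks of the pointwise lower limit, which exists everywhere and agrees with
   [a ^+ 2] almost everywhere. *)
have -> : sqnorm a = (\int[mu]_x limn_einf (fun n => (u n x ^+ 2)%:E))%E.
  apply: ge0_ae_eq_integral => //.
  - exact: measurable_sqr.
  - apply: (emeasurable_fun_cvg
      (fun n x => einfs (fun k => (u k x ^+ 2)%:E) n)) => [m|x _].
      by apply: measurable_fun_einfs => n; exact: measurable_sqr.
    by rewrite limn_einf_lim; exact: is_cvg_einfs.
  - by move=> x _; rewrite lee_fin sqr_ge0.
  - move=> x _; rewrite limn_einf_lim; apply: lime_ge; first exact: is_cvg_einfs.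
    apply: nearW => n; apply: le_ereal_inf_tmp => _ [k _ <-].
    by rewrite lee_fin sqr_ge0.
  - apply: ae_imply ua => x ux _.
    have /cvg_limn_einf_sup[-> //] :
        (u n x ^+ 2)%:E @[n --> \oo] --> (a x ^+ 2)%:E.
    apply: cvg_EFin; first exact: nearW.
    rewrite expr2; under eq_fun do rewrite expr2.
    exact: cvgM.
apply: le_trans (fatou _ _ _ _) _ => //.
- by move=> n; exact: measurable_sqr.
- by move=> n x _; rewrite lee_fin sqr_ge0.
- rewrite limn_einf_lim; apply: lime_le; first exact: is_cvg_einfs.
  apply: filterS uM => n; apply: le_trans; apply: ge_ereal_inf; exists (sqnorm (u n)) => //.
  by exists n => /=.
Qed.


Lemma cvge0_leP (u : nat -> \bar R) : (forall n, (0 <= u n)%E) ->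
  u @ \oo --> 0%E <->
  forall e : R, 0 < e -> exists N, forall n, (N <= n)%N -> (u n <= e%:E)%E.
Proof.
move=> u0; split=> [/fine_cvgP[[N1 _ N1P] /cvgrPdist_le uc] e e0|H].
  have [N2 _ N2P] := uc e e0.
  exists (maxn N1 N2) => n; rewrite geq_max => /andP[n1 n2].
  have := N2P n n2; rewrite /= sub0r normrN ger0_norm ?fine_ge0//.
  by rewrite -lee_fin fineK// N1P.
apply/fine_cvgP; split.
  (* The bound for [e = 1] makes the terms eventually finite. *)
  have [N NP] := H 1 ltr01; exists N => // n /= Nn.
  by rewrite ge0_fin_numE// (le_lt_trans (NP n Nn))// ltry.
apply/cvgrPdist_le => e e0; have [N NP] := H e e0; exists N => // n /= Nn.
rewrite sub0r normrN ger0_norm ?fine_ge0// -lee_fin fineK ?NP//.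
by rewrite ge0_fin_numE// (le_lt_trans (NP n Nn))// ltry.
Qed.

End SquareIntegrable.

(** * Completeness of L^2 (Riesz-Fischer) *)

Section Completeness.
Context {R : realType}.
Local Notation mu := (@lebesgue_measure R).

Lemma geometric2 (n : nat) : \sum_(0 <= k < n) (2^-1 : R) ^+ k <= 2.
Proof.
have h1 : `|2^-1| < 1 :> R by rewrite ger0_norm; lra.
have h0 : 0 < 2^-1 :> R by lra.
have := geometric_le_lim n ler01 h0 h1.
rewrite /series /geometric/=; under eq_bigr do rewrite mul1r.
by move=> /le_trans; apply; rewrite le_eqVlt; apply/orP; left; apply/eqP; field.
Qed.

(** The series of [2^k d_k^2], with [d_k] the increments, has integral at most the sum of [2^-k],
    hence is finite almost everywhere; where it is finite, the increments are absolutely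
    summable. *)
Lemma sqnorm_cauchy_ae (G : nat -> R -> R) :
  (forall k, measurable_fun setT (G k)) ->
  (forall k, (sqnorm (fun x => G k.+1 x - G k x)%R <= ((4^-1) ^+ k)%:E)%E) ->
  exists g : R -> R, measurable_fun setT g /\
    {ae mu, forall x, G k x @[k --> \oo] --> g x}.
Proof.
move=> mG qG.
pose d k x := G k.+1 x - G k x.
have md k : measurable_fun setT (d k) by exact: measurable_funB.
pose s k x := ((2 ^+ k * d k x ^+ 2)%:E : \bar R).
have s0 k x : (0 <= s k x)%E.
  by rewrite lee_fin mulr_ge0 ?sqr_ge0// exprn_ge0.
have ms k : measurable_fun setT (s k).
  by apply/measurable_EFinP; apply: measurable_funM => //; exact: measurable_funX.
pose S x := (\sum_(k <oo) s k x)%E.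
have S0 x : (0 <= S x)%E by exact: nneseries_ge0.
have mS : measurable_fun setT S by exact: ge0_emeasurable_sum.
have iS : (\int[mu]_x S x < +oo)%E.
  rewrite integral_nneseries//.
  apply: (@le_lt_trans _ _ (\sum_(k <oo) ((2^-1 : R) ^+ k)%:E)%E).
    apply: lee_nneseries => [k _ _|k _]; first exact: integral_ge0.
    rewrite (_ : (\int[mu]_x s k x)%E = ((2 ^+ k)%:E * sqnorm (d k))%E); last first.
      rewrite /sqnorm -ge0_integralZl//; first exact: measurable_sqr.
      by move=> x _; rewrite lee_fin sqr_ge0.
    apply: (@le_trans _ _ ((2 ^+ k)%:E * ((4^-1) ^+ k)%:E)%E).
      apply: lee_wpmul2l; last exact: qG.
      by rewrite lee_fin exprn_ge0.
    rewrite -EFinM -exprMn lee_fin.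
    by rewrite (_ : 2 * 4^-1 = 2^-1 :> R)//; lra.
  apply: (@le_lt_trans _ _ 2%:E); last exact: ltry.
  apply: lime_le.
    by apply: is_cvg_nneseries => k _ _; rewrite lee_fin exprn_ge0// invr_ge0.
  apply: nearW => n; rewrite sumEFin lee_fin.
  exact: geometric2.
pose D := [set x | (S x < +oo)%E].
have mD : measurable D.
  by rewrite -[D]setTI; exact: emeasurable_fun_infty_o.
have aeD : {ae mu, forall x, D x}.
  have iS' : mu.-integrable setT S.
    apply/integrableP; split=> //.
    by under eq_integral do rewrite gee0_abs//.
  apply: ae_imply (integrable_ae measurableT iS') => x /(_ I).
  by rewrite ge0_fin_numE.
have cD x : D x -> cvgn (fun k => G k x).
  move=> Dx.
  have : cvgn (series (fun k => d k x)).
    apply: normed_cvg.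
    change (cvgn (fun n => \sum_(0 <= k < n) `|d k x|)).
    apply: nondecreasing_is_cvgn.
      by apply/nondecreasing_seqP => n; rewrite big_nat_recr//= lerDl normr_ge0.
    exists (1 + fine (S x)) => _ [n _ <-].
    have le1 : \sum_(0 <= k < n) (2 ^+ k * d k x ^+ 2) <= fine (S x).
      rewrite -lee_fin fineK ?ge0_fin_numE// -sumEFin.
      by apply: nneseries_lim_ge => k _ _; exact: s0.
    apply: (@le_trans _ _ (2^-1 * (\sum_(0 <= k < n) 2^-1 ^+ k +
        \sum_(0 <= k < n) (2 ^+ k * d k x ^+ 2)))); last first.
      have := geometric2 n.
      have : 0 <= fine (S x) by rewrite fine_ge0.
      lra.
    rewrite -big_split/= mulr_sumr; apply: ler_sum => k _.
    have p0 : 0 < (2 : R) ^+ k by rewrite exprn_gt0.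
    (* AM-GM: [2 |d| <= 2^-k + 2^k d^2] *)
    rewrite exprVn -(ler_pM2l p0) -[d k x ^+ 2]real_normK ?num_real//.
    set v := `|d k x|; set w := (2 : R) ^+ k.
    have -> : w * (2^-1 * (w^-1 + w * v ^+ 2)) = 2^-1 * (1 + (w * v) ^+ 2).
      by field; rewrite gt_eqF.
    have := sqr_ge0 (1 - w * v); lra.
  rewrite (_ : (fun k => G k x) =
    (fun k => G 0%N x + series (fun k => d k x) k)); last first.
    apply/funext => k; rewrite /series/= telescope_sumr//.
    by rewrite addrC subrK.
  by move=> cs; apply: is_cvgD => //; exact: is_cvg_cst.
(* Killing the sequence outside [D] makes it converge everywhere, so that its limit is
   measurable. *)
pose h k x := G k x * \1_D x.
have ch x : cvgn (fun k => h k x).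
  have [xD|xD] := pselect (D x).
    rewrite /h indicE mem_set//; under eq_fun do rewrite mulr1; exact: cD.
  rewrite /h indicE memNset//; under eq_fun do rewrite mulr0; exact: is_cvg_cst.
exists (fun x => limn (fun k => h k x)); split.
  apply: (measurable_fun_cvg (h := h)) => [k|x _]; last exact: ch.
  by apply: measurable_funM => //; exact: measurable_indic.
apply: ae_imply aeD => x Dx.
rewrite (_ : (fun k => h k x) = (fun k => G k x)); first exact: cD.
by apply/funext => k; rewrite /h indicE mem_set// mulr1.
Qed.

Lemma L2_complete (G : nat -> R -> R) : (forall n, sqintg (G n)) ->
  (forall e : R, 0 < e -> exists N, forall n m, (N <= n)%N -> (N <= m)%N ->
     (sqnorm (fun x => G n x - G m x)%R <= e%:E)%E) ->
  exists g, sqintg g /\ (fun n => sqnorm (fun x => G n x - g x)) @ \oo --> 0%E.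
Proof.
move=> sG cG.
have mG n : measurable_fun setT (G n) by case: (sG n).
have p4 k : 0 < (4^-1 : R) ^+ k by rewrite exprn_gt0// invr_gt0.
have [N NP] := choice (fun k => cG _ (p4 k)).
(* Partial sums make [phi] increasing and at least [N k] and [k], whatever the order of the
   [N k]. *)
pose phi k := (\sum_(j < k.+1) (N j).+1)%N.
have phiS k : phi k.+1 = (phi k + (N k.+1).+1)%N by rewrite /phi big_ord_recr.
have Nphi k : (N k <= phi k)%N.
  by rewrite /phi big_ord_recr/= (leq_trans (leqnSn _))// leq_addl.
have phi_ge k : (k <= phi k)%N.
  by elim: k => // k ih; rewrite phiS addnS ltnS (leq_trans ih)// leq_addr.
have [g [mg aeg]] : exists g : R -> R, measurable_fun setT g /\
    {ae mu, forall x, G (phi k) x @[k --> \oo] --> g x}.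
  apply: (@sqnorm_cauchy_ae (fun k => G (phi k))) => // k.
  apply: NP; last exact: Nphi.
  by rewrite phiS (leq_trans (Nphi k))// leq_addr.
(* Fatou along the subsequence [phi] turns the Cauchy bound into a bound on the distance to [g] for
   the whole sequence. *)
have near_g (e : R) : 0 < e -> exists M, forall n, (M <= n)%N ->
    (sqnorm (fun x => G n x - g x)%R <= e%:E)%E.
  move=> e0; have [M HM] := cG e e0; exists M => n Mn.
  apply: (@le_sqnorm_cvg _ (fun k x => G n x - G (phi k) x)) => [k|||].
  - exact: measurable_funB.
  - exact: measurable_funB.
  - by apply: ae_imply aeg => x gx; apply: cvgB => //; exact: cvg_cst.
  - by exists M => // k /= Mk; apply: HM => //; rewrite (leq_trans Mk).
exists g; split.
  have [M HM] := near_g 1 ltr01.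
  have -> : g = (fun x => G M x - (G M x - g x)).
    by apply/funext => x; rewrite opprB addrCA subrr addr0.
  apply: sqintgB => //; split; first exact: measurable_funB.
  by apply: le_lt_trans (HM M (leqnn _)) _; exact: ltry.
by apply/cvge0_leP => // n; exact: sqnorm_ge0.
Qed.

End Completeness.

(** * Integral transforms with a bounded kernel *)

Section BoundedKernel.
Context {R : realType}.
Local Notation mu := (@lebesgue_measure R).
Implicit Types (K : R * R -> R) (w h a b k : R -> R).

Lemma integrable_bounded_mul (b a : R -> R) (M : R) :
  mu.-integrable setT (EFin \o a) -> measurable_fun setT b ->
  (forall x, `|b x| <= M) -> mu.-integrable setT (EFin \o (fun x => b x * a x)).
Proof.
move=> ia mb bM.
apply: (le_integrable measurableT _ _ (integrableZl measurableT M ia)) => /=.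
  apply/measurable_EFinP; apply: measurable_funM => //.
  by apply/measurable_EFinP; exact: measurable_int ia.
move=> x _; rewrite lee_fin !normrM ler_wpM2r//.
by rewrite (le_trans (bM x))// ler_norm.
Qed.

(** No integrability is required: Tonelli handles the positive and negative parts separately, and
    [fine] of their difference is measurable in any case. *)
Lemma measurable_Rintegral2 (F : R * R -> R) : measurable_fun setT F ->
  measurable_fun setT (fun x => \int[mu]_t F (x, t)).
Proof.
move=> mF; apply: measurableT_comp; first exact: fine_measurable.
have mG : measurable_fun setT (EFin \o F) by exact/measurable_EFinP.
rewrite (_ : (fun x => _) = (fun x =>
    \int[mu]_t ((EFin \o F)^\+ (x, t)) - \int[mu]_t ((EFin \o F)^\- (x, t)))%E).
  apply: emeasurable_funB.
    by apply: measurable_fun_fubini_tonelli_F => //; exact: measurable_funepos.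
  by apply: measurable_fun_fubini_tonelli_F => //; exact: measurable_funeneg.
apply/funext => x; rewrite [LHS]integralE.
by congr (_ - _)%E; apply: eq_integral => t _; rewrite (funeposE, funenegE) (funeposE, funenegE).
Qed.

(** The integrand is dominated by [|w x| |h t|], whose double integral is a product of two finite
    ones. The exchanges of signed integrals below rest on this. *)
Lemma Fubini_kernel K w h : mu.-integrable setT (EFin \o w) ->
  mu.-integrable setT (EFin \o h) -> measurable_fun setT K ->
  (forall z, `|K z| <= 1) ->
  \int[mu]_x (w x * \int[mu]_t (K (x, t) * h t)) =
  \int[mu]_t (h t * \int[mu]_x (K (x, t) * w x)).
Proof.
move=> iw ih mK K1.
have mw : measurable_fun setT w by apply/measurable_EFinP; exact: measurable_int iw.
have mh : measurable_fun setT h by apply/measurable_EFinP; exact: measurable_int ih.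
pose F (z : R * R) := w z.1 * (K z * h z.2).
have mF : measurable_fun setT F.
  apply: measurable_funM; first exact: (measurableT_comp mw measurable_fst).
  by apply: measurable_funM => //; exact: (measurableT_comp mh measurable_snd).
have mF' : measurable_fun setT (EFin \o F) by exact/measurable_EFinP.
have mKx x : measurable_fun setT (fun t => K (x, t)).
  by apply: (measurableT_comp mK); exact: measurable_pair1.
have mKt t : measurable_fun setT (fun x => K (x, t)).
  by apply: (measurableT_comp mK); exact: measurable_pair2.
have iF : (mu \x mu)%E.-integrable setT (EFin \o F).
  apply/integrable12ltyP => //.
  apply: (@le_lt_trans _ _ (\int[mu]_x (`|w x|%:E * \int[mu]_t `|h t|%:E)))%E.
    apply: ge0_le_integral => //.
    - by move=> x _; apply: integral_ge0.
    - apply: (@measurable_fun_fubini_tonelli_F _ _ _ _ _ mu (abse \o (EFin \o F))) => //=.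
      exact: measurableT_comp.
    - apply: emeasurable_funM => //.
      by apply/measurable_EFinP; exact: measurableT_comp.
    - move=> x _ /=.
      rewrite -ge0_integralZl//; last by apply/measurable_EFinP; exact: measurableT_comp.
      apply: ge0_le_integral => //.
      + apply/measurable_EFinP; apply: measurableT_comp => //.
        exact: (measurableT_comp mF (measurable_pair1 x)).
      + apply: emeasurable_funM => //.
        by apply/measurable_EFinP; exact: measurableT_comp.
      + move=> t _; rewrite -EFinM lee_fin /F/= !normrM ler_wpM2l// ler_piMl//.
  have := integrable_norm iw; have := integrable_norm ih.
  move=> ih' iw'; rewrite ge0_integralZr//; last 2 first.
  - exact: measurable_int iw'.
  - by apply: integral_ge0.
  have fh : (\int[mu]_t `|h t|%:E)%E \is a fin_num.
    exact: (integrable_fin_num measurableT ih').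
  rewrite -(fineK fh); apply: lte_mul_pinfty => //.
  - by apply: integral_ge0.
  - exact: (integrable_fin_num measurableT iw').
  - exact: ltry.
have := Fubini iF; rewrite /Rintegral /= => H; congr fine.
transitivity (\int[mu]_x \int[mu]_y (F (x, y))%:E)%E.
  apply: eq_integral => x _; rewrite /F/=.
  under [RHS]eq_integral do rewrite EFinM.
  have iKh : mu.-integrable setT (EFin \o (fun t => K (x, t) * h t)).
    by apply: integrable_bounded_mul => // t; exact: K1.
  rewrite integralZl// EFinM fineK//.
  exact: (integrable_fin_num measurableT iKh).
rewrite H; apply: eq_integral => t _; rewrite /F/=.
have iKw : mu.-integrable setT (EFin \o (fun x => K (x, t) * w x)).
  by apply: integrable_bounded_mul => // x; exact: K1.
rewrite EFinM fineK; last exact: (integrable_fin_num measurableT iKw).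
rewrite -integralZl//; apply: eq_integral => x _.
by rewrite -EFinM; congr EFin; ring.
Qed.

(** With [k] equal to [cos] or [sin], these are the real building blocks of the Fourier transform,
    without the factor [(2 pi)^(-1/2)]. *)
Definition ktransform k h (x : R) : R := \int[mu]_t (k (x * t) * h t).

Section ktransform.
Variable k : R -> R.
Hypotheses (mk : measurable_fun setT k) (k1 : forall x, `|k x| <= 1).

Lemma measurable_kmul (x : R) : measurable_fun setT (fun t => k (x * t)).
Proof. by apply: measurableT_comp => //; exact: measurable_funM. Qed.

Lemma integrable_ktransform h (x : R) : mu.-integrable setT (EFin \o h) ->
  mu.-integrable setT (EFin \o (fun t => k (x * t) * h t)).
Proof.
by move=> ih; apply: integrable_bounded_mul => //; exact: measurable_kmul.
Qed.

Lemma measurable_mulkernel : measurable_fun setT (fun z : R * R => k (z.1 * z.2)).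
Proof. by apply: measurableT_comp => //; apply: measurable_funM. Qed.

Lemma measurable_ktransform h : measurable_fun setT h -> measurable_fun setT (ktransform k h).
Proof.
move=> mh; apply: (measurable_Rintegral2 (F := fun z => k (z.1 * z.2) * h z.2)).
apply: measurable_funM; first exact: measurable_mulkernel.
exact: (measurableT_comp mh measurable_snd).
Qed.

Lemma ktransform_bounded h (x : R) : mu.-integrable setT (EFin \o h) ->
  `|ktransform k h x| <= \int[mu]_t `|h t|.
Proof.
move=> ih; apply: le_trans.
  by apply: le_normr_Rintegral => //; exact: integrable_ktransform.
apply: le_Rintegral => //.
- exact/integrable_norm/integrable_ktransform.
- exact/integrable_norm.
- by move=> t _; rewrite normrM ler_piMl.
Qed.

Lemma ktransformD h a (x : R) : mu.-integrable setT (EFin \o h) ->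
  mu.-integrable setT (EFin \o a) ->
  ktransform k (fun t => h t + a t) x = ktransform k h x + ktransform k a x.
Proof.
move=> ih ia; rewrite /ktransform -RintegralD//; try exact: integrable_ktransform.
by apply: eq_Rintegral => t _; rewrite mulrDr.
Qed.

Lemma ktransformZ (c : R) h (x : R) : mu.-integrable setT (EFin \o h) ->
  ktransform k (fun t => c * h t) x = c * ktransform k h x.
Proof.
move=> ih; rewrite /ktransform -RintegralZl//; try exact: integrable_ktransform.
by apply: eq_Rintegral => t _; ring.
Qed.

Lemma ktransformB h a (x : R) : mu.-integrable setT (EFin \o h) ->
  mu.-integrable setT (EFin \o a) ->
  ktransform k (fun t => h t - a t) x = ktransform k h x - ktransform k a x.
Proof.
move=> ih ia; rewrite /ktransform -RintegralB//; try exact: integrable_ktransform.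
by apply: eq_Rintegral => t _; rewrite mulrBr.
Qed.

End ktransform.

Lemma ktransform_mul_weight k1 k2 w a b :
  measurable_fun setT k1 -> (forall x, `|k1 x| <= 1) ->
  measurable_fun setT k2 -> (forall x, `|k2 x| <= 1) ->
  mu.-integrable setT (EFin \o w) -> mu.-integrable setT (EFin \o a) ->
  mu.-integrable setT (EFin \o b) ->
  \int[mu]_x (w x * (ktransform k1 a x * ktransform k2 b x)) =
  \int[mu]_s (b s * ktransform k2 (fun x => ktransform k1 a x * w x) s).
Proof.
move=> mk1 k11 mk2 k21 iw ia ib.
have ma : measurable_fun setT a by apply/measurable_EFinP; exact: measurable_int ia.
have iwa : mu.-integrable setT (EFin \o (fun x => ktransform k1 a x * w x)).
  apply: integrable_bounded_mul => //; first exact: measurable_ktransform.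
  by move=> x; apply: ktransform_bounded.
transitivity (\int[mu]_x ((ktransform k1 a x * w x) * ktransform k2 b x)).
  by apply: eq_Rintegral => x _; ring.
rewrite (Fubini_kernel iwa ib (measurable_mulkernel mk2) (fun z => k21 _)).
apply: eq_Rintegral => s _; congr (_ * _).
by apply: eq_Rintegral => x _; rewrite [x * s]mulrC.
Qed.

Lemma ktransform_weight_ktransform k1 k2 w a s :
  measurable_fun setT k1 -> (forall x, `|k1 x| <= 1) ->
  measurable_fun setT k2 -> (forall x, `|k2 x| <= 1) ->
  mu.-integrable setT (EFin \o w) -> mu.-integrable setT (EFin \o a) ->
  ktransform k2 (fun x => ktransform k1 a x * w x) s =
  \int[mu]_t (a t * ktransform k1 (fun x => k2 (s * x) * w x) t).
Proof.
move=> mk1 k11 mk2 k21 iw ia.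
transitivity (\int[mu]_x ((k2 (s * x) * w x) * ktransform k1 a x)).
  by apply: eq_Rintegral => x _; ring.
rewrite (Fubini_kernel (integrable_ktransform mk2 k21 s iw) ia (measurable_mulkernel mk1)
  (fun z => k11 _)).
apply: eq_Rintegral => t _; congr (_ * _).
by apply: eq_Rintegral => x _; rewrite [x * t]mulrC.
Qed.

(** The constant [c] will be [1] or [-1]: the inner kernel then collapses, by an addition formula,
    to the cosine or the sine of [(t - s) * x]. *)
Lemma ktransform_mul_weightD k1 k2 (l1 l2 : R -> R) (c : R) w a b :
  measurable_fun setT k1 -> (forall x, `|k1 x| <= 1) ->
  measurable_fun setT k2 -> (forall x, `|k2 x| <= 1) ->
  measurable_fun setT l1 -> (forall x, `|l1 x| <= 1) ->
  measurable_fun setT l2 -> (forall x, `|l2 x| <= 1) ->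
  mu.-integrable setT (EFin \o w) -> mu.-integrable setT (EFin \o a) ->
  mu.-integrable setT (EFin \o b) ->
  \int[mu]_x (w x * (ktransform k1 a x * ktransform k2 b x + c * (ktransform l1 a x * ktransform l2 b x))) =
  \int[mu]_s (b s * \int[mu]_t (a t *
    \int[mu]_x ((k1 (t * x) * k2 (s * x) + c * (l1 (t * x) * l2 (s * x))) * w x))).
Proof.
move=> mk1 k11 mk2 k21 ml1 l11 ml2 l21 iw ia ib.
have ma : measurable_fun setT a by apply/measurable_EFinP; exact: measurable_int ia.
have mb : measurable_fun setT b by apply/measurable_EFinP; exact: measurable_int ib.
have mw : measurable_fun setT w by apply/measurable_EFinP; exact: measurable_int iw.
have bdd k (h : R -> R) : measurable_fun setT k -> (forall x, `|k x| <= 1) ->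
    mu.-integrable setT (EFin \o h) ->
    forall v : R -> R, mu.-integrable setT (EFin \o v) ->
    mu.-integrable setT (EFin \o (fun x => ktransform k h x * v x)).
  move=> mk k1' ih v iv.
  have mh : measurable_fun setT h by apply/measurable_EFinP; exact: measurable_int ih.
  apply: integrable_bounded_mul => //; first exact: measurable_ktransform.
  by move=> x; apply: ktransform_bounded.
have bddC k (h : R -> R) : measurable_fun setT k -> (forall x, `|k x| <= 1) ->
    mu.-integrable setT (EFin \o h) ->
    forall v : R -> R, mu.-integrable setT (EFin \o v) ->
    mu.-integrable setT (EFin \o (fun x => v x * ktransform k h x)).
  move=> mk k1' ih v iv.
  by have := bdd k h mk k1' ih v iv; under eq_fun do rewrite mulrC.
have cI (v : R -> R) : mu.-integrable setT (EFin \o v) ->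
    mu.-integrable setT (EFin \o (fun x => c * v x)).
  by move=> iv; exact: (integrableZl measurableT c iv).
have iTT k (l : R -> R) : measurable_fun setT k -> (forall x, `|k x| <= 1) ->
    measurable_fun setT l -> (forall x, `|l x| <= 1) ->
    mu.-integrable setT (EFin \o (fun x => w x * (ktransform k a x * ktransform l b x))).
  move=> mk k1' ml l1'.
  have := bddC _ _ ml l1' ib _ (bddC _ _ mk k1' ia _ iw).
  by under eq_fun do rewrite -mulrA.
transitivity (\int[mu]_x (w x * (ktransform k1 a x * ktransform k2 b x)) +
    c * \int[mu]_x (w x * (ktransform l1 a x * ktransform l2 b x))).
  rewrite -RintegralZl//; last exact: iTT.
  rewrite -RintegralD//; [|exact: iTT|by apply: cI; exact: iTT].
  by apply: eq_Rintegral => x _; ring.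
rewrite !ktransform_mul_weight// -RintegralZl//; last by apply: bddC => //; exact: bdd.
rewrite -RintegralD//; [|by apply: bddC => //; exact: bdd|
  by apply: cI; apply: bddC => //; exact: bdd].
apply: eq_Rintegral => s _.
rewrite (_ : _ + c * (_ * _) = b s * (ktransform k2 (fun x => ktransform k1 a x * w x) s +
  c * ktransform l2 (fun x => ktransform l1 a x * w x) s)); last by ring.
congr (_ * _); rewrite !ktransform_weight_ktransform//.
rewrite -RintegralZl//; last by apply: bddC => //; exact: integrable_ktransform.
rewrite -RintegralD//; [|by apply: bddC => //; exact: integrable_ktransform|
  by apply: cI; apply: bddC => //; exact: integrable_ktransform].
apply: eq_Rintegral => t _.
rewrite (_ : _ + c * (_ * _) = a t * (ktransform k1 (fun x => k2 (s * x) * w x) t +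
  c * ktransform l1 (fun x => l2 (s * x) * w x) t)); last by ring.
congr (_ * _); rewrite /ktransform.
have iK k (l : R -> R) : measurable_fun setT k -> (forall x, `|k x| <= 1) ->
    measurable_fun setT l -> (forall x, `|l x| <= 1) ->
    mu.-integrable setT (EFin \o (fun x => k (t * x) * (l (s * x) * w x))).
  by move=> mk k1' ml l1'; apply: integrable_ktransform => //; exact: integrable_ktransform.
rewrite -RintegralZl//; last exact: iK.
rewrite -RintegralD//; [|exact: iK|by apply: cI; exact: iK].
by apply: eq_Rintegral => x _; ring.
Qed.

End BoundedKernel.

(** * Cutoff and Poisson kernel *)

Section PoissonKernel.
Context {R : realType}.
Local Notation mu := (@lebesgue_measure R).

Lemma is_derive_continuous (f f' : R -> R) :
  (forall x : R, is_derive x 1 f (f' x)) -> continuous f.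
Proof.
by move=> df x; apply: differentiable_continuous; apply/derivable1_diffP; case: (df x).
Qed.

Lemma Rintegral_is_derive (f F : R -> R) (a b : R) : a < b -> continuous f ->
  (forall x : R, is_derive x 1 F (f x)) ->
  \int[mu]_(x in `[a, b]) f x = F b - F a.
Proof.
move=> ab cf dF; have cF := is_derive_continuous dF.
rewrite /Rintegral (@continuous_FTC2 _ f F)//.
- exact: continuous_subspaceT.
- split.
  + by move=> x _; case: (dF x).
  + exact/cvg_at_right_filter/cF.
  + exact/cvg_at_left_filter/cF.
- by move=> x _; rewrite derive1E; case: (dF x).
Qed.

Lemma continuous_integrable_segment (f : R -> R) (a b : R) : continuous f ->
  mu.-integrable `[a, b] (EFin \o f).
Proof.
move=> cf; apply: continuous_compact_integrable; first exact: segment_compact.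
exact: continuous_subspaceT.
Qed.

(** Folding onto the half line removes the absolute value in [expcut], and exhibits the cancellation
    of odd integrands. *)
Lemma Rintegral_symm (f : R -> R) (N : R) : 0 < N -> continuous f ->
  \int[mu]_(x in `[- N, N]) f x = \int[mu]_(x in `[0, N]) (f x + f (- x)).
Proof.
move=> N0 cf.
have cfo : continuous (f \o -%R).
  by move=> x; apply: continuous_comp; [exact: oppr_continuous|exact: cf].
rewrite RintegralD//; [|exact: continuous_integrable_segment..].
have iN : mu.-integrable `[- N, N] (EFin \o f) by exact: continuous_integrable_segment.
have := @Rintegral_itvB _ _ _ _ 0 iN.
rewrite !bnd_simp => /(_ _ _)/eqP; rewrite subr_eq => H.
rewrite (eqP (H _ _)) ?(ltW N0) ?oppr_le0 ?(ltW N0)//.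
rewrite Rintegral_itv_obnd_cbnd; last first.
  apply: integrableS iN => //; apply: subset_itvr.
  by rewrite bnd_simp oppr_le0 ltW.
congr (_ + _); rewrite /Rintegral; congr fine.
have := @integration_by_substitution_oppr _ f 0 N (ltW N0).
rewrite oppr0 => -> //; exact: continuous_subspaceT.
Qed.

Definition expcut (e N : R) (x : R) : R := expR (- (e * `|x|)) * \1_(`[- N, N]) x.

Lemma measurable_expcut e N : measurable_fun setT (expcut e N).
Proof.
apply: measurable_funM; last exact: measurable_indic.
apply: measurableT_comp => //; apply: measurableT_comp => //.
by apply: measurable_funM => //; exact: measurableT_comp.
Qed.

Lemma expcut_ge0 e N x : 0 <= expcut e N x.
Proof. by rewrite mulr_ge0 ?expR_ge0. Qed.

Lemma expcut_le1 e N x : 0 <= e -> expcut e N x <= 1.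
Proof.
move=> e0; rewrite mulr_ile1 ?expR_ge0//.
by rewrite -expR0 ler_expR oppr_le0 mulr_ge0.
Qed.

Lemma Rintegral_indic (D : set R) (f : R -> R) : measurable D ->
  \int[mu]_x (f x * \1_D x) = \int[mu]_(x in D) f x.
Proof.
move=> mD; rewrite [RHS]Rintegral_mkcond; apply: eq_Rintegral => x _.
by rewrite patchE indicE; case: ifPn => _; rewrite ?mulr1 ?mulr0.
Qed.

Lemma integrable_mul_indic (D : set R) (f : R -> R) : measurable D ->
  mu.-integrable D (EFin \o f) <->
  mu.-integrable setT (EFin \o (fun x => f x * \1_D x)).
Proof.
move=> mD; have <- : (EFin \o f) \_ D = EFin \o (fun x => f x * \1_D x).
  apply/funext => x.
  by rewrite patchE/= indicE; case: ifPn => _; rewrite ?mulr1 ?mulr0.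
exact: integrable_mkcond.
Qed.

Lemma integrable_expcut e N : 0 <= e -> mu.-integrable setT (EFin \o expcut e N).
Proof.
move=> e0; apply: (integrable_mul_indic (fun x => expR (- (e * `|x|)))
  (measurable_itv `[- N, N])).1.
apply: continuous_integrable_segment => x.
apply: continuous_comp; last exact: continuous_expR.
apply: cvgN; apply: cvgM; first exact: cvg_cst.
exact: norm_continuous.
Qed.

Lemma is_derive_mull (u x : R) : is_derive x 1 (fun x : R => u * x) u.
Proof.
have := @is_deriveZ _ _ _ (@idfun R) u x 1 1 (is_derive_id _ _).
by rewrite scaler1.
Qed.

Lemma continuous_expRM (u : R) : continuous (fun x : R => expR (u * x)).
Proof.
by move=> x; apply: continuous_comp; [exact: mulrl_continuous|exact: continuous_expR].
Qed.

Lemma continuous_cosM (u : R) : continuous (fun x : R => cos (u * x)).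
Proof.
by move=> x; apply: continuous_comp; [exact: mulrl_continuous|exact: continuous_cos].
Qed.

(** The primitive is the real part of [exp ((- e + i u) x) / (- e + i u)]. *)
Lemma is_derive_expcos (e u x : R) : e ^+ 2 + u ^+ 2 != 0 ->
  is_derive x 1 (fun x : R => expR (- e * x) *
     ((e ^+ 2 + u ^+ 2)^-1 * (u * sin (u * x) - e * cos (u * x))))
  (expR (- e * x) * cos (u * x)).
Proof.
move=> n0.
have dE : is_derive x 1 (fun x : R => expR (- e * x)) (expR (- e * x) * (- e)).
  by apply: is_derive1_comp; exact: is_derive_mull.
have dS : is_derive x 1 (fun x : R => sin (u * x)) (cos (u * x) * u).
  by apply: is_derive1_comp; exact: is_derive_mull.
have dC : is_derive x 1 (fun x : R => cos (u * x)) (- sin (u * x) * u).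
  by apply: is_derive1_comp; exact: is_derive_mull.
have dA : is_derive x 1
    (fun x : R => (e ^+ 2 + u ^+ 2)^-1 * (u * sin (u * x) - e * cos (u * x)))
    ((e ^+ 2 + u ^+ 2)^-1 * (u * (cos (u * x) * u) - e * (- sin (u * x) * u))).
  exact: (is_deriveZ _ (is_deriveB (is_deriveZ u dS) (is_deriveZ e dC))).
apply: (is_derive_eq (is_deriveM dE dA)).
rewrite /= /GRing.scale/=; field; exact: n0.
Qed.

(** The term [e] in the last factor yields the Poisson kernel; the term with [expR (- e * N)] is the
    price of the truncation. *)
Lemma cos_expcut (e N u : R) : 0 < e -> 0 < N ->
  \int[mu]_x (cos (u * x) * expcut e N x) =
  2 * (e ^+ 2 + u ^+ 2)^-1 *
    (e + expR (- e * N) * (u * sin (u * N) - e * cos (u * N))).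
Proof.
move=> e0 N0.
have n0 : e ^+ 2 + u ^+ 2 != 0.
  by rewrite gt_eqF// ltr_wpDr ?sqr_ge0// exprn_gt0.
under eq_Rintegral do rewrite mulrA.
rewrite Rintegral_indic// Rintegral_symm//; last first.
  move=> x; apply: cvgM; first exact: continuous_cosM.
  apply: continuous_comp; last exact: continuous_expR.
  apply: cvgN; apply: cvgM; first exact: cvg_cst.
  exact: norm_continuous.
transitivity (\int[mu]_(x in `[0, N]) (2 * (expR (- e * x) * cos (u * x)))).
  apply: eq_Rintegral => x; rewrite inE/= in_itv/= => /andP[x0 _].
  by rewrite normrN mulrN cosN ger0_norm// -mulNr; ring.
have cf : continuous (fun x => expR (- e * x) * cos (u * x)).
  by move=> x; apply: cvgM; [exact: continuous_expRM|exact: continuous_cosM].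
rewrite RintegralZl//; last exact: continuous_integrable_segment.
rewrite (Rintegral_is_derive N0 cf (fun x => is_derive_expcos x n0)).
rewrite !mulr0 expR0 sin0 cos0; field; exact: n0.
Qed.

Lemma sin_expcut (e N u : R) : 0 < N ->
  \int[mu]_x (sin (u * x) * expcut e N x) = 0.
Proof.
move=> N0; under eq_Rintegral do rewrite mulrA.
rewrite Rintegral_indic// Rintegral_symm//; last first.
  move=> x; apply: cvgM.
    by apply: continuous_comp; [exact: mulrl_continuous|exact: continuous_sin].
  apply: continuous_comp; last exact: continuous_expR.
  apply: cvgN; apply: cvgM; first exact: cvg_cst.
  exact: norm_continuous.
under eq_Rintegral do rewrite normrN mulrN sinN mulNr subrr.
by rewrite Rintegral_cst// mul0r.
Qed.

(** The Fourier integral of [exp (- e |x|)]: the Poisson kernel of the half-plane, with total mass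
    [2 pi] instead of [1]. *)
Definition poisson (e u : R) : R := 2 * e / (e ^+ 2 + u ^+ 2).

Lemma poisson_ge0 e u : 0 <= e -> 0 <= poisson e u.
Proof. by move=> e0; rewrite divr_ge0 ?mulr_ge0 ?addr_ge0 ?sqr_ge0. Qed.

Lemma continuous_poisson e t : 0 < e -> continuous (fun s => poisson e (s - t)).
Proof.
move=> e0 x; apply: cvgM; first exact: cvg_cst.
apply: cvgV; first by rewrite gt_eqF// ltr_wpDr ?sqr_ge0// exprn_gt0.
apply: cvgD; first exact: cvg_cst.
by apply: cvgM; (apply: cvgB; [exact: cvg_id|exact: cvg_cst]).
Qed.

Lemma Rintegral_poisson (e t a b : R) : 0 < e -> a < b ->
  \int[mu]_(s in `[a, b]) poisson e (s - t) =
  2 * (atan ((b - t) / e) - atan ((a - t) / e)).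
Proof.
move=> e0 ab.
(* The whole-line mass [2 pi] is the total variation of this primitive. *)
have dF (x : R) : is_derive x 1 (fun s => 2 * atan ((s - t) / e)) (poisson e (x - t)).
  have dl : is_derive x 1 (fun s : R => (s - t) / e) e^-1.
    rewrite (_ : (fun s => _) = e^-1 \*: (fun s => s - t)); last first.
      by apply/funext => s /=; rewrite mulrC.
    have dst : is_derive x 1 (fun s : R => s - t) (1 - 0) by exact: is_deriveB.
    by apply: (is_derive_eq (is_deriveZ e^-1 dst)); rewrite subr0 scaler1.
  have da := @is_derive1_comp _ atan (fun s => (s - t) / e) x _ _ (is_derive1_atan _) dl.
  apply: (is_derive_eq (is_deriveZ 2 da)); rewrite /poisson /GRing.scale/=.
  have q0 : 0 < e ^+ 2 + (x - t) ^+ 2 by rewrite ltr_wpDr ?sqr_ge0// exprn_gt0.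
  by field; rewrite !gt_eqF//.
by rewrite (Rintegral_is_derive ab (@continuous_poisson e t e0) dF) mulrBr.
Qed.

Lemma Rintegral_poisson_le (e t a b : R) : 0 < e -> a < b ->
  \int[mu]_(s in `[a, b]) poisson e (s - t) <= 2 * pi.
Proof.
move=> e0 ab; rewrite Rintegral_poisson//.
have := atan_ltpi2 ((b - t) / e); have := atan_gtNpi2 ((a - t) / e); lra.
Qed.

(* [m * exp (-m) -> 0] makes the truncation error uniform in [u]. *)
Lemma cos_expcut_poisson (m : nat) (u : R) :
  `|\int[mu]_x (cos (u * x) * expcut m.+1%:R^-1 (m.+1%:R ^+ 2) x)
    - poisson m.+1%:R^-1 u| <= 16 / m.+1%:R.
Proof.
set M : R := m.+1%:R; set e := M^-1.
have M0 : 0 < M by rewrite ltr0n.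
have e0 : 0 < e by rewrite invr_gt0.
have q0 : 0 < e ^+ 2 + u ^+ 2 by rewrite ltr_wpDr ?sqr_ge0// exprn_gt0.
rewrite cos_expcut ?exprn_gt0//.
rewrite (_ : - e * M ^+ 2 = - M); last by rewrite /e; field; rewrite gt_eqF.
set A := u * sin _ - _.
have -> : 2 * (e ^+ 2 + u ^+ 2)^-1 * (e + expR (- M) * A) - poisson e u
    = 2 * expR (- M) * (A / (e ^+ 2 + u ^+ 2)).
  by rewrite /poisson; field; rewrite gt_eqF.
(* From [|A| <= |u| + e]; one factor [e] is spent here so that the bound on [A / (e^2 + u^2)] no
   longer depends on [u]. *)
have AB : `|A| * e <= 2 * (e ^+ 2 + u ^+ 2).
  have : `|A| <= `|u| + e.
    apply: le_trans (ler_normB _ _) _; rewrite !normrM (ger0_norm (ltW e0)).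
    by apply: lerD; apply: ler_piMr => //; rewrite ?sin_max ?cos_max// ltW.
  rewrite -[u ^+ 2]real_normK ?num_real//; set U := `|u|.
  move=> /(ler_wpM2r (ltW e0))/le_trans; apply.
  by have := sqr_ge0 (U - e); have := sqr_ge0 U; have := sqr_ge0 e; nra.
(* Square [1 + M / 2 <= expR (M / 2)]. Two powers of [M] are needed, since one is lost to
   [1 / e]. *)
have eM : expR (- M) <= 4 / M ^+ 2.
  rewrite expRN -[4]invrK -invfM lef_pV2 ?posrE ?expR_gt0 ?mulr_gt0 ?invr_gt0 ?exprn_gt0//.
  have -> : expR M = expR (M / 2) ^+ 2.
    by rewrite expr2 -expRD; congr expR; field.
  have -> : 4^-1 * M ^+ 2 = (M / 2) ^+ 2 by field.
  rewrite ler_pXn2r ?nnegrE ?expR_ge0 ?divr_ge0 ?(ltW M0)//.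
  by have := expR_ge1Dx (M / 2); lra.
rewrite normrM (normrM 2) (ger0_norm (ltW (expR_gt0 _))) ger0_norm// normrM.
rewrite (ger0_norm (ltW (_ : 0 < (e ^+ 2 + u ^+ 2)^-1))) ?invr_gt0//.
have h : `|A| / (e ^+ 2 + u ^+ 2) <= 2 * M.
  rewrite ler_pdivrMr// -(ler_pM2r e0) (le_trans AB)//.
  have Me : M * e = 1 by rewrite divff ?gt_eqF.
  by rewrite [leRHS]mulrAC -(mulrA 2 M e) Me mulr1.
apply: (@le_trans _ _ (2 * (4 / M ^+ 2) * (2 * M))).
  apply: ler_pM => //.
  - by apply: mulr_ge0 => //; rewrite invr_ge0 ltW.
  - by rewrite ler_wpM2l.
have G (x : R) : 0 < x -> 2 * (4 / x ^+ 2) * (2 * x) = 16 / x.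
  by move=> x0; field; rewrite gt_eqF.
by rewrite G.
Qed.

End PoissonKernel.

(** * Parseval identities with an integrable weight *)

Section WeightedParseval.
Context {R : realType}.
Local Notation mu := (@lebesgue_measure R).
Implicit Types (a b h : R -> R) (N : R).

Lemma measurable_sin : measurable_fun setT (@sin R).
Proof. exact: continuous_measurable_fun (@continuous_sin R). Qed.

Lemma measurable_cos : measurable_fun setT (@cos R).
Proof. exact: continuous_measurable_fun (@continuous_cos R). Qed.

(** By the formula for the cosine of a difference, the kernel depends on [t - s] only: it is the
    cosine transform of the weight, close to [poisson] when [w] is a [cutoff]. *)
Lemma parseval_weight (w : R -> R) a b : mu.-integrable setT (EFin \o w) ->
  mu.-integrable setT (EFin \o a) -> mu.-integrable setT (EFin \o b) ->
  \int[mu]_x (w x * (ktransform cos a x * ktransform cos b x + ktransform sin a x * ktransform sin b x)) =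
  \int[mu]_s (b s * \int[mu]_t (a t * \int[mu]_x (cos ((t - s) * x) * w x))).
Proof.
move=> iw ia ib.
transitivity (\int[mu]_x (w x * (ktransform cos a x * ktransform cos b x + 1 * (ktransform sin a x * ktransform sin b x)))).
  by apply: eq_Rintegral => x _; rewrite mul1r.
rewrite (ktransform_mul_weightD 1 measurable_cos (@cos_max R) measurable_cos (@cos_max R)
  measurable_sin (@sin_max R) measurable_sin (@sin_max R) iw ia ib).
apply: eq_Rintegral => s _; congr (_ * _).
apply: eq_Rintegral => t _; congr (_ * _).
by apply: eq_Rintegral => x _; rewrite mul1r mulrBl cosB.
Qed.

(** The kernel is now the sine transform of an even weight, which vanishes. *)
Lemma cross_parseval_weight e N a b : 0 <= e -> 0 < N ->
  mu.-integrable setT (EFin \o a) -> mu.-integrable setT (EFin \o b) ->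
  \int[mu]_x (expcut e N x *
    (ktransform sin a x * ktransform cos b x - ktransform cos a x * ktransform sin b x)) = 0.
Proof.
move=> e0 N0 ia ib.
transitivity (\int[mu]_x (expcut e N x *
    (ktransform sin a x * ktransform cos b x + (-1) * (ktransform cos a x * ktransform sin b x)))).
  by apply: eq_Rintegral => x _; rewrite mulN1r.
rewrite (ktransform_mul_weightD (-1) measurable_sin (@sin_max R) measurable_cos (@cos_max R)
  measurable_cos (@cos_max R) measurable_sin (@sin_max R) (integrable_expcut N e0) ia ib).
transitivity (\int[mu]_s (b s * 0)); last first.
  by under eq_Rintegral do rewrite mulr0; rewrite Rintegral_cst// mul0r.
apply: eq_Rintegral => s _; congr (_ * _).
transitivity (\int[mu]_t (a t * 0)); last first.
  by under eq_Rintegral do rewrite mulr0; rewrite Rintegral_cst// mul0r.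
apply: eq_Rintegral => t _; congr (_ * _).
rewrite -(sin_expcut e (t - s) N0).
by apply: eq_Rintegral => x _; rewrite mulN1r [(t - s) * x]mulrBl sinB.
Qed.

(** Decay rate [1 / (m + 1)] and radius [(m + 1)^2]: the weight tends to [1] pointwise, yet it is
    only [exp (- (m + 1))] where it is cut. *)
Definition cutoff (m : nat) : R -> R := expcut m.+1%:R^-1 (m.+1%:R ^+ 2).

Lemma cutoff_ge0 m x : 0 <= cutoff m x. Proof. exact: expcut_ge0. Qed.

Lemma cutoff_le1 m x : cutoff m x <= 1.
Proof. by apply: expcut_le1; rewrite invr_ge0. Qed.

Lemma integrable_cutoff m : mu.-integrable setT (EFin \o cutoff m).
Proof. by apply: integrable_expcut; rewrite invr_ge0. Qed.

Lemma measurable_cutoff m : measurable_fun setT (cutoff m).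
Proof. exact: measurable_expcut. Qed.

Lemma cvg_cutoff x : cutoff m x @[m --> \oo] --> (1 : R).
Proof.
have cE : expR (- (m.+1%:R^-1 * `|x|)) @[m --> \oo] --> (1 : R).
  have cN : - (m.+1%:R^-1 * `|x|) @[m --> \oo] --> (0 : R).
    rewrite -oppr0 -(mul0r `|x|); apply: cvgN; apply: cvgMr_tmp.
    exact: (@cvg_harmonic R).
  have := @continuous_cvg _ _ _ _ _ _ expR _ (@continuous_expR R 0) cN.
  by rewrite expR0; apply.
suff cI : \1_(`[- m.+1%:R ^+ 2, m.+1%:R ^+ 2]) x @[m --> \oo] --> (1 : R).
  by have := cvgM cE cI; rewrite mulr1; apply.
apply: cvg_near_cst.
exists (Num.trunc `|x|).+1 => // m /= xm.
rewrite indicE mem_set//= in_itv/= -ler_norml.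
have : `|x| <= m.+1%:R.
  apply: le_trans (ltW (truncnS_gt _)) _.
  by rewrite ler_nat (leq_trans xm).
move=> /le_trans; apply; rewrite expr2 ler_peMr// ler1n//.
Qed.

(** Dominated convergence with bound [|g|]; it removes the weight once the product of transforms is
    known to be integrable. *)
Lemma cvg_weighted_Rintegral (g : R -> R) : mu.-integrable setT (EFin \o g) ->
  \int[mu]_x (cutoff m x * g x) @[m --> \oo] --> \int[mu]_x g x.
Proof.
move=> ig.
have mg : measurable_fun setT g by apply/measurable_EFinP; exact: measurable_int ig.
have := @dominated_convergence _ _ _ mu setT measurableT
  (fun m x => (cutoff m x * g x)%:E) (EFin \o g) (fun x => `|g x|%:E).
case.
- by move=> m; apply/measurable_EFinP; apply: measurable_funM => //; exact: measurable_cutoff.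
- exact/measurable_EFinP.
- apply: aeW => x _; apply: cvg_EFin; first exact: nearW.
  by rewrite -[g x in X in _ --> X]mul1r; apply: cvgMr_tmp; exact: cvg_cutoff.
- exact: integrable_norm.
- apply: aeW => x m _; rewrite /= lee_fin normrM (ger0_norm (cutoff_ge0 _ _)).
  by rewrite ler_piMl// cutoff_le1.
move=> _ _ H; apply: fine_cvg; rewrite fineK//.
exact: (integrable_fin_num measurableT ig).
Qed.

End WeightedParseval.

(** * Bessel inequality and Parseval identity *)

Section PoissonYoung.
Context {R : realType}.
Local Notation mu := (@lebesgue_measure R).
Implicit Types (a b h : R -> R) (e N : R).

(** No integrability is required: [fine] sends an infinite integral to [0]. *)
Lemma normr_Rintegral_le (f : R -> R) : measurable_fun setT f ->
  (`|\int[mu]_x f x|%:E <= \int[mu]_x `|f x|%:E)%E.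
Proof.
move=> mf; apply: (@le_trans _ _ `|\int[mu]_x (f x)%:E|%E).
  by rewrite /Rintegral; case: (\int[mu]_x (f x)%:E)%E => //=; rewrite leey.
by apply: le_abse_integral => //; exact/measurable_EFinP.
Qed.

Lemma measurable_poisson2 e : 0 < e ->
  measurable_fun setT (fun z : R * R => poisson e (z.2 - z.1)).
Proof.
move=> e0.
have cp : continuous (poisson e).
  have := @continuous_poisson R e 0 e0.
  by under eq_fun do rewrite subr0.
apply: measurableT_comp; first exact: continuous_measurable_fun.
exact: measurable_funB.
Qed.

Definition supported N a := forall t, N < `|t| -> a t = 0.

(* Symmetrize [|a s a t| <= (a s ^ 2 + a t ^ 2) / 2], then integrate the kernel
   first: its mass is at most [2 pi]. *)
Lemma poisson_young e N a : 0 < e -> 0 < N -> measurable_fun setT a ->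
  supported N a ->
  (\int[mu]_s \int[mu]_t (`|a s| * `|a t| * poisson e (t - s))%:E <=
    (2 * pi)%:E * sqnorm a)%E.
Proof.
move=> e0 N0 ma sa.
pose D : set R := `[- N, N]%classic.
have pe0 u : 0 <= poisson e u by rewrite poisson_ge0// ltW.
(* One half of the symmetrized bound. The indicator equals [1] wherever [a z.2] is nonzero, and
   confines the integral of the kernel to a segment. *)
pose g (z : R * R) := a z.1 ^+ 2 * \1_D z.2 * poisson e (z.2 - z.1) / 2.
have g0 z : 0 <= g z.
  by rewrite divr_ge0// mulr_ge0// mulr_ge0// sqr_ge0.
have ma1 : measurable_fun setT (fun z : R * R => a z.1).
  exact: (measurableT_comp ma measurable_fst).
have ma2 : measurable_fun setT (fun z : R * R => a z.2).
  exact: (measurableT_comp ma measurable_snd).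
have mD : measurable_fun setT (\1_D : R -> R).
  by apply: measurable_indic; exact: measurable_itv.
have mp := measurable_poisson2 e0.
have mg : measurable_fun setT g.
  apply: measurable_funM => //; apply: measurable_funM => //.
  apply: measurable_funM; first exact: measurable_funX.
  exact: (measurableT_comp mD measurable_snd).
have mgE : measurable_fun setT (EFin \o g) by exact/measurable_EFinP.
have mgC : measurable_fun setT (fun z : R * R => g (z.2, z.1)).
  by apply: (measurableT_comp mg); exact: measurable_swap.
have gle : (\int[mu]_s \int[mu]_t (g (s, t))%:E <= pi%:E * sqnorm a)%E.
  rewrite /sqnorm -ge0_integralZl//; last 3 first.
  - exact: measurable_sqr.
  - by move=> x _; rewrite lee_fin sqr_ge0.
  - by rewrite lee_fin pi_ge0.
  apply: ge0_le_integral => //.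
  - by move=> s _; apply: integral_ge0 => t _; rewrite lee_fin.
  - by apply: (@measurable_fun_fubini_tonelli_F _ _ _ _ _ mu (EFin \o g)) => // z; rewrite lee_fin.
  - by apply: emeasurable_funM => //; exact: measurable_sqr.
  - move=> s _.
    have mps : measurable_fun setT (fun t : R => poisson e (t - s)).
      exact: continuous_measurable_fun (@continuous_poisson R e s e0).
    rewrite (_ : (\int[mu]_t (g (s, t))%:E)%E =
      ((a s ^+ 2 / 2)%:E * \int[mu]_t (poisson e (t - s) * \1_D t)%:E)%E); last first.
      rewrite -ge0_integralZl//.
      + by apply: eq_integral => t _; rewrite -EFinM /g/=; congr EFin; ring.
      + by apply/measurable_EFinP; exact: measurable_funM.
      + by move=> t _; rewrite lee_fin mulr_ge0.
      + by rewrite lee_fin divr_ge0// sqr_ge0.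
    have ip : mu.-integrable setT (EFin \o (fun t : R => poisson e (t - s) * \1_D t)).
      apply: (integrable_mul_indic (fun t : R => poisson e (t - s))
        (measurable_itv `[- N, N])).1.
      by apply: continuous_integrable_segment; exact: continuous_poisson.
    have -> : (\int[mu]_t (poisson e (t - s) * \1_D t)%:E)%E =
        (\int[mu]_(t in `[- N, N]) poisson e (t - s))%:E.
      by rewrite -Rintegral_indic// fineK//; exact: (integrable_fin_num measurableT ip).
    rewrite -!EFinM lee_fin.
    have NN : - N < N by lra.
    have := Rintegral_poisson_le s e0 NN; have := sqr_ge0 (a s).
    set A := a s ^+ 2; set P := \int[mu]_(t in _) _; nra.
apply: (@le_trans _ _
    (\int[mu]_s \int[mu]_t ((g (s, t))%:E + (g (t, s))%:E))%E).
  apply: ge0_le_integral => //.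
  - move=> s _; apply: integral_ge0 => t _.
    by rewrite lee_fin mulr_ge0 // mulr_ge0.
  - apply: (@measurable_fun_fubini_tonelli_F _ _ _ _ _ mu
      (fun z => (`|a z.1| * `|a z.2| * poisson e (z.2 - z.1))%:E)).
      2: by move=> z; rewrite lee_fin mulr_ge0 // mulr_ge0.
    apply/measurable_EFinP; apply: measurable_funM => //.
    by apply: measurable_funM; exact: measurableT_comp.
  - apply: (@measurable_fun_fubini_tonelli_F _ _ _ _ _ mu
      (fun z => (g z)%:E + (g (z.2, z.1))%:E)%E).
      2: by move=> z; rewrite adde_ge0// lee_fin.
    by apply: emeasurable_funD => //; exact/measurable_EFinP.
  - move=> s _; apply: ge0_le_integral => //.
    + by move=> t _; rewrite lee_fin mulr_ge0 // mulr_ge0.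
    + apply/measurable_EFinP; apply: measurable_funM.
        by apply: measurable_funM => //; exact: measurableT_comp.
      exact: continuous_measurable_fun (@continuous_poisson R e s e0).
    + apply: emeasurable_funD; apply/measurable_EFinP.
        exact: (measurableT_comp mg (measurable_pair1 s)).
      exact: (measurableT_comp mg (measurable_pair2 s)).
    + move=> t _; rewrite -EFinD lee_fin /g/=.
      have -> : poisson e (s - t) = poisson e (t - s).
        by rewrite /poisson -(sqrrN (s - t)) opprB.
      have inD (r : R) : a r != 0 -> \1_D r = 1 :> R.
        move=> ar; rewrite indicE mem_set// /D/= in_itv/= -ler_norml.
        by rewrite leNgt; apply: contra ar => /sa ->.
      have p0 : 0 <= poisson e (t - s) by rewrite poisson_ge0// ltW.
      have [as0|as0] := eqVneq (a s) 0.
        by rewrite as0 normr0 !mul0r expr0n/= !mul0r add0r divr_ge0// mulr_ge0// mulr_ge0// sqr_ge0.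
      have [at0|at0] := eqVneq (a t) 0.
        by rewrite at0 normr0 mulr0 !mul0r expr0n/= !mul0r addr0 divr_ge0// mulr_ge0// mulr_ge0// sqr_ge0.
      rewrite !inD// !mulr1 -[a s ^+ 2]real_normK ?num_real// -[a t ^+ 2]real_normK ?num_real//.
      have := sqr_ge0 (`|a s| - `|a t|); set x := `|a s|; set y := `|a t|; nra.
rewrite (_ : (\int[mu]_s \int[mu]_t ((g (s, t))%:E + (g (t, s))%:E))%E =
   (\int[mu]_s \int[mu]_t (g (s, t))%:E + \int[mu]_s \int[mu]_t (g (t, s))%:E)%E); last first.
  rewrite -ge0_integralD//.
  - apply: eq_integral => s _; rewrite ge0_integralD//.
    + by move=> t _; rewrite lee_fin.
    + by apply/measurable_EFinP; exact: (measurableT_comp mg (measurable_pair1 s)).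
    + by move=> t _; rewrite lee_fin.
    + by apply/measurable_EFinP; exact: (measurableT_comp mg (measurable_pair2 s)).
  - by move=> s _; apply: integral_ge0 => t _; rewrite lee_fin.
  - by apply: (@measurable_fun_fubini_tonelli_F _ _ _ _ _ mu (EFin \o g)) => // z; rewrite lee_fin.
  - by move=> s _; apply: integral_ge0 => t _; rewrite lee_fin.
  - apply: (@measurable_fun_fubini_tonelli_F _ _ _ _ _ mu (fun z => (g (z.2, z.1))%:E)) => //.
      exact/measurable_EFinP.
    by move=> z; rewrite lee_fin.
(* By Tonelli the two halves have the same double integral, each at most [pi] times the squared
   norm. *)
rewrite -[X in (_ + X)%E](fubini_tonelli (m1 := mu) (m2 := mu) (EFin \o g))//.
rewrite (_ : ((2 * pi)%:E * sqnorm a = pi%:E * sqnorm a + pi%:E * sqnorm a)%E).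
  by apply: leeD.
rewrite -ge0_muleDl ?lee_fin ?pi_ge0// -EFinD; congr (_%:E * _)%E; ring.
Qed.

End PoissonYoung.

(** * Bessel's inequality for functions of bounded support *)

Section BesselInequality.
Context {R : realType}.
Local Notation mu := (@lebesgue_measure R).
Implicit Types (a b h : R -> R) (e N : R).

Lemma integrable_measurable h : mu.-integrable setT (EFin \o h) -> measurable_fun setT h.
Proof. by move=> ih; apply/measurable_EFinP; exact: measurable_int ih. Qed.

Lemma sqintg_indic (c d : R) : sqintg (\1_(`[c, d]) : R -> R).
Proof.
split; first by apply: measurable_indic; exact: measurable_itv.
rewrite /sqnorm (_ : (fun x => _) = EFin \o (\1_(`[c, d]) : R -> R)); last first.
  by apply/funext => x /=; rewrite indicE; case: (_ \in _); rewrite ?expr1n ?expr0n.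
have ii := integrable_indic_itv c d true false.
exact: (integrable_lty measurableT ii).
Qed.

Lemma sqintg_segment_integrable h (c d : R) : sqintg h ->
  mu.-integrable setT (EFin \o (fun x => h x * \1_(`[c, d]) x)).
Proof. by move=> sh; apply: sqintg_mul => //; exact: sqintg_indic. Qed.

Lemma supported_integrable N a : sqintg a -> supported N a ->
  mu.-integrable setT (EFin \o a).
Proof.
move=> sa Na; have := @sqintg_segment_integrable a (- N) N sa.
rewrite (_ : (fun x => _) = a)//; apply/funext => x.
rewrite indicE; have [_|] := boolP (x \in _); first by rewrite mulr1.
rewrite mulr0 notin_setE/= in_itv/= -ler_norml => /negP.
by rewrite -ltNge => /Na.
Qed.

(** The kernel [J] is within [eta] of the Poisson kernel, uniformly. The Poisson part is controlled
    by [poisson_young], the rest by [eta] times the square of the [L^1] norm, finite because the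
    support is bounded. *)
Lemma bessel_cutoff N a (m : nat) : 0 < N -> sqintg a -> supported N a ->
  ((\int[mu]_x (cutoff m x * (ktransform cos a x * ktransform cos a x + ktransform sin a x * ktransform sin a x)))%:E
   <= (2 * pi)%:E * sqnorm a
     + (16 / m.+1%:R)%:E * ((\int[mu]_x `|a x|%:E) * (\int[mu]_x `|a x|%:E)))%E.
Proof.
move=> N0 sa Na.
have ia := supported_integrable sa Na; have ma := integrable_measurable ia.
have e0 : 0 < m.+1%:R^-1 :> R by rewrite invr_gt0.
set e : R := m.+1%:R^-1 in e0 *.
have pe0 u : 0 <= poisson e u by rewrite poisson_ge0// ltW.
rewrite parseval_weight//; last exact: integrable_cutoff.
pose J (u : R) := \int[mu]_x (cos (u * x) * cutoff m x).
have mJ : measurable_fun setT J.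
  by apply: measurable_ktransform; [exact: measurable_cos|exact: measurable_cutoff].
have mJ2 (s : R) : measurable_fun setT (fun t : R => J (t - s)).
  by apply: measurableT_comp => //; exact: measurable_funB.
have mJ3 : measurable_fun setT (fun z : R * R => J (z.2 - z.1)).
  by apply: measurableT_comp => //; exact: measurable_funB.
have maJ (s : R) : measurable_fun setT (fun t : R => a t * J (t - s)).
  exact: measurable_funM.
have ma1 : measurable_fun setT (fun z : R * R => a z.1).
  exact: (measurableT_comp ma measurable_fst).
have ma2 : measurable_fun setT (fun z : R * R => a z.2).
  exact: (measurableT_comp ma measurable_snd).
have mna : measurable_fun setT (fun x => `|a x|) by exact: measurableT_comp.
have mp2 := measurable_poisson2 e0.
have A0 : (0 <= \int[mu]_x `|a x|%:E)%E by exact: integral_ge0.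
set eta : R := 16 / _; have eta0 : 0 <= eta by rewrite divr_ge0.
have Jle u : `|J u| <= poisson e u + eta.
  have := cos_expcut_poisson m u; rewrite -/(cutoff m) -/(J u) -/e -/eta => H.
  rewrite -[J u](subrK (poisson e u)) addrC (le_trans (ler_normD _ _))// lerD//.
  by rewrite ger0_norm.
apply: (@le_trans _ _ (`|\int[mu]_s (a s * \int[mu]_t (a t * J (t - s)))|%:E)).
  by rewrite lee_fin ler_norm.
apply: le_trans (normr_Rintegral_le _) _.
  apply: measurable_funM => //.
  exact: (measurable_Rintegral2 (F := fun z => a z.2 * J (z.2 - z.1)) (measurable_funM ma2 mJ3)).
apply: (@le_trans _ _ (\int[mu]_s \int[mu]_t
  ((`|a s| * `|a t| * poisson e (t - s))%:E + (eta * (`|a s| * `|a t|))%:E)))%E.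
  apply: ge0_le_integral => //.
  - apply/measurable_EFinP; apply: measurableT_comp => //; apply: measurable_funM => //.
    exact: (measurable_Rintegral2 (F := fun z => a z.2 * J (z.2 - z.1)) (measurable_funM ma2 mJ3)).
  - apply: (@measurable_fun_fubini_tonelli_F _ _ _ _ _ mu
      (fun z => (`|a z.1| * `|a z.2| * poisson e (z.2 - z.1))%:E +
        (eta * (`|a z.1| * `|a z.2|))%:E)%E).
      apply: emeasurable_funD; apply/measurable_EFinP; apply: measurable_funM => //;
      by apply: measurable_funM; exact: measurableT_comp.
    by move=> z; apply: adde_ge0; rewrite lee_fin mulr_ge0// mulr_ge0.
  - move=> s _; rewrite normrM EFinM.
    apply: (@le_trans _ _ (`|a s|%:E * \int[mu]_t `|a t * J (t - s)|%:E)%E).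
      by apply: lee_wpmul2l => //; apply: normr_Rintegral_le; exact: measurable_funM.
    rewrite -ge0_integralZl//; last first.
      by apply/measurable_EFinP; apply: measurableT_comp => //; exact: maJ.
    apply: ge0_le_integral => //.
    + apply: emeasurable_funM => //; apply/measurable_EFinP.
      by apply: measurableT_comp => //; exact: maJ.
    + apply: emeasurable_funD; apply/measurable_EFinP; apply: measurable_funM => //.
      * exact: measurable_funM.
      * exact: (measurableT_comp mp2 (measurable_pair1 s)).
      * exact: measurable_funM.
    + move=> t _; rewrite -EFinM -EFinD lee_fin normrM mulrA.
      apply: le_trans (ler_wpM2l _ (Jle (t - s))) _; first exact: mulr_ge0.
      by rewrite mulrDr lerD2l mulrC.
rewrite (_ : (\int[mu]_s _)%E = (\int[mu]_s \int[mu]_t (`|a s| * `|a t| * poisson e (t - s))%:E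
   + \int[mu]_s \int[mu]_t (eta * (`|a s| * `|a t|))%:E)%E); last first.
  rewrite -ge0_integralD//.
  - apply: eq_integral => s _; rewrite ge0_integralD//.
    + by move=> t _; rewrite lee_fin mulr_ge0// mulr_ge0.
    + apply/measurable_EFinP; apply: measurable_funM; first exact: measurable_funM.
      exact: (measurableT_comp mp2 (measurable_pair1 s)).
    + by move=> t _; rewrite lee_fin mulr_ge0// mulr_ge0.
    + by apply/measurable_EFinP; apply: measurable_funM => //; exact: measurable_funM.
  - by move=> s _; apply: integral_ge0 => t _; rewrite lee_fin mulr_ge0// mulr_ge0.
  - apply: (@measurable_fun_fubini_tonelli_F _ _ _ _ _ mu
      (fun z => (`|a z.1| * `|a z.2| * poisson e (z.2 - z.1))%:E)).
      apply/measurable_EFinP; apply: measurable_funM => //.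
      by apply: measurable_funM; exact: measurableT_comp.
    by move=> z; rewrite lee_fin mulr_ge0// mulr_ge0.
  - by move=> s _; apply: integral_ge0 => t _; rewrite lee_fin mulr_ge0// mulr_ge0.
  - apply: (@measurable_fun_fubini_tonelli_F _ _ _ _ _ mu
      (fun z => (eta * (`|a z.1| * `|a z.2|))%:E)).
      apply/measurable_EFinP; apply: measurable_funM => //.
      by apply: measurable_funM; exact: measurableT_comp.
    by move=> z; rewrite lee_fin mulr_ge0// mulr_ge0.
apply: leeD; first exact: (poisson_young e0 N0 ma Na).
rewrite le_eqVlt; apply/orP; left; apply/eqP.
transitivity (\int[mu]_s (eta%:E * (\int[mu]_x `|a x|%:E) * `|a s|%:E))%E.
  apply: eq_integral => s _.
  transitivity (\int[mu]_t ((eta * `|a s|)%:E * `|a t|%:E))%E.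
    by apply: eq_integral => t _; rewrite -EFinM mulrA.
  rewrite ge0_integralZl//; [|exact/measurable_EFinP|by rewrite lee_fin mulr_ge0].
  by rewrite EFinM muleAC.
rewrite ge0_integralZl//; [|exact/measurable_EFinP|by rewrite mule_ge0].
by rewrite muleA.
Qed.

(** Both transforms are bounded by the [L^1] norm of [a], and the weight is integrable. Finiteness
    is what allows [bessel_cutoff] to be read as a bound on the extended integral. *)
Lemma weighted_energy_integrable N a (m : nat) : sqintg a -> supported N a ->
  mu.-integrable setT (EFin \o (fun x =>
    cutoff m x * (ktransform cos a x * ktransform cos a x + ktransform sin a x * ktransform sin a x))).
Proof.
move=> sa Na; have ia := supported_integrable sa Na; have ma := integrable_measurable ia.
have mc := measurable_ktransform measurable_cos ma; have ms := measurable_ktransform measurable_sin ma.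
pose B := \int[mu]_t `|a t|.
rewrite (_ : (fun x => _) = (fun x => (ktransform cos a x * ktransform cos a x +
  ktransform sin a x * ktransform sin a x) * cutoff m x)); last by apply/funext => x; rewrite mulrC.
apply: (integrable_bounded_mul (M := B * B + B * B) (integrable_cutoff m)).
  by apply: measurable_funD; exact: measurable_funM.
move=> x; rewrite (le_trans (ler_normD _ _))// lerD// normrM ler_pM//.
- exact: (ktransform_bounded measurable_cos (@cos_max R)).
- exact: (ktransform_bounded measurable_cos (@cos_max R)).
- exact: (ktransform_bounded measurable_sin (@sin_max R)).
- exact: (ktransform_bounded measurable_sin (@sin_max R)).
Qed.

(** Here [v] stands for either transform of [a]. Fatou is applied to [cutoff m * v], and the [L^1]
    error term is absorbed in an arbitrary [d]. *)
Lemma bessel_aux N a (v : R -> R) : 0 < N -> sqintg a -> supported N a ->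
  measurable_fun setT v ->
  (forall x, v x ^+ 2 <= ktransform cos a x * ktransform cos a x + ktransform sin a x * ktransform sin a x) ->
  (sqnorm v <= (2 * pi)%:E * sqnorm a)%E.
Proof.
move=> N0 sa Na mv vle.
have ia := supported_integrable sa Na; have ma := integrable_measurable ia.
apply/lee_addgt0Pr => d d0.
pose A := (\int[mu]_x `|a x|%:E)%E.
have fA : A \is a fin_num by exact: (integrable_fin_num measurableT (integrable_norm ia)).
apply: (@le_sqnorm_cvg _ (fun m x => cutoff m x * v x)) => //.
- by move=> m; apply: measurable_funM => //; exact: measurable_cutoff.
- apply: aeW => x; rewrite -[v x in X in _ --> X]mul1r; apply: cvgMr_tmp.
  exact: cvg_cutoff.
(* Beyond this index the error term of [bessel_cutoff] is at most [d]. *)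
have [k kP] : exists k : nat, 16 * (fine A * fine A) / d <= k%:R.
  exists (Num.trunc (16 * (fine A * fine A) / d)).+1.
  exact: ltW (truncnS_gt _).
exists k => // m /= km.
apply: (@le_trans _ _ (\int[mu]_x (cutoff m x *
    (ktransform cos a x * ktransform cos a x + ktransform sin a x * ktransform sin a x))%:E)%E).
  apply: ge0_le_integral => //.
  - by move=> x _; rewrite lee_fin sqr_ge0.
  - by apply: measurable_sqr; apply: measurable_funM => //; exact: measurable_cutoff.
  - exact: measurable_int (weighted_energy_integrable m sa Na).
  - move=> x _; rewrite lee_fin exprMn.
    have w0 := cutoff_ge0 m x.
    (* The weight is at most [1], so its square is at most itself. *)
    apply: ler_pM; rewrite ?sqr_ge0//.
    by rewrite expr2 ler_piMl// cutoff_le1.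
have iw := weighted_energy_integrable m sa Na.
have := bessel_cutoff m N0 sa Na.
rewrite /Rintegral fineK; last exact: (integrable_fin_num measurableT iw).
move=> /le_trans; apply; apply: leeD => //.
rewrite -/A -(fineK fA) -!EFinM lee_fin mulrAC ler_pdivrMr//.
move: kP; rewrite ler_pdivrMr// => kP; apply: le_trans kP _.
by rewrite mulrC ler_pM2l// ler_nat (leq_trans km).
Qed.

Lemma bessel_cos N a : 0 < N -> sqintg a -> supported N a ->
  (sqnorm (ktransform cos a) <= (2 * pi)%:E * sqnorm a)%E.
Proof.
move=> N0 sa Na; apply: (bessel_aux N0 sa Na).
  by apply: measurable_ktransform; [exact: measurable_cos|case: sa].
by move=> x; rewrite -expr2 lerDl -expr2 sqr_ge0.
Qed.

Lemma bessel_sin N a : 0 < N -> sqintg a -> supported N a ->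
  (sqnorm (ktransform sin a) <= (2 * pi)%:E * sqnorm a)%E.
Proof.
move=> N0 sa Na; apply: (bessel_aux N0 sa Na).
  by apply: measurable_ktransform; [exact: measurable_sin|case: sa].
by move=> x; rewrite -!expr2 lerDr sqr_ge0.
Qed.

End BesselInequality.

(** * Parseval's identity against the indicator of a segment *)

Section Parseval.
Context {R : realType}.
Local Notation mu := (@lebesgue_measure R).
Implicit Types (a b h : R -> R) (e N : R).

Lemma cvg_atan_mulS (u : R) : 0 < u ->
  atan (u / m.+1%:R^-1) @[m --> \oo] --> (pi / 2 : R).
Proof.
move=> u0.
have H : (fun m : nat => u / m.+1%:R^-1) @ \oo --> +oo.
  apply/cvgryPge => A; exists (Num.trunc (A / u)).+1 => // m /= Am.
  rewrite invrK mulrC -ler_pdivrMr// (le_trans (ltW (truncnS_gt _)))//.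
  by rewrite ler_nat (leq_trans Am).
exact: cvg_comp H (@cvgy_atan R).
Qed.

Lemma cvg_atan_mulSN (u : R) : u < 0 ->
  atan (u / m.+1%:R^-1) @[m --> \oo] --> (- (pi / 2) : R).
Proof.
move=> u0.
rewrite (_ : (fun m : nat => _) = (fun m : nat => - atan ((- u) / m.+1%:R^-1))).
  by apply: cvgN; apply: cvg_atan_mulS; rewrite oppr_gt0.
by apply/funext => m; rewrite mulNr atanN opprK.
Qed.

Lemma ae_neq (c : R) : {ae mu, forall s, s <> c}.
Proof.
exists [set c]; split => //; first exact: lebesgue_measure_set1.
by move=> x /= /contrapT.
Qed.

(** The two arctangents tend to [pi / 2] or [- pi / 2] according to the side on which [s] lies. The
    endpoints are excluded because the limit there is [pi], half of the mass. *)
Lemma cvg_poisson_segment (c d s : R) : c < d -> s <> c -> s <> d ->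
  \int[mu]_(t in `[c, d]) poisson m.+1%:R^-1 (t - s) @[m --> \oo]
    --> (2 * pi * \1_(`[c, d]) s : R).
Proof.
move=> cd /eqP sc /eqP sd.
under eq_fun do rewrite Rintegral_poisson ?invr_gt0//.
have cv (p q : R) : atan ((d - s) / m.+1%:R^-1) @[m --> \oo] --> p ->
   atan ((c - s) / m.+1%:R^-1) @[m --> \oo] --> q ->
   2 * (atan ((d - s) / m.+1%:R^-1) - atan ((c - s) / m.+1%:R^-1)) @[m --> \oo] --> 2 * (p - q).
  by move=> hp hq; apply: cvgM; [exact: cvg_cst|exact: cvgB].
have pi2 : pi / 2 - - (pi / 2) = pi :> R by field.
have [sltc|cles] := ltP s c.
  rewrite indicE memNset ?mulr0 /=; last by rewrite in_itv/= leNgt sltc.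
  rewrite -(mulr0 2) -(subrr (pi / 2)).
  by apply: cv; apply: cvg_atan_mulS; rewrite subr_gt0// (lt_trans sltc).
have clts : c < s by rewrite lt_neqAle eq_sym sc.
have [dlts|sled] := ltP d s.
  rewrite indicE memNset ?mulr0 /=; last by rewrite in_itv/= cles leNgt dlts.
  rewrite -(mulr0 2) -(subrr (- (pi / 2))).
  by apply: cv; apply: cvg_atan_mulSN; rewrite subr_lt0.
have sltd : s < d by rewrite lt_neqAle sd.
rewrite indicE mem_set ?mulr1 /=; last by rewrite in_itv/= cles.
rewrite -[X in 2 * X]pi2.
by apply: cv; [apply: cvg_atan_mulS; rewrite subr_gt0|apply: cvg_atan_mulSN; rewrite subr_lt0].
Qed.

Let J (m : nat) (u : R) := \int[mu]_x (cos (u * x) * cutoff m x).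

(** The uniform approximation of the Poisson kernel, integrated over the segment. Uniformity in [s]
    later provides a dominating function. *)
Lemma cos_cutoff_segment (c d s : R) m : c < d ->
  `|\int[mu]_t (\1_(`[c, d]) t * \int[mu]_x (cos ((t - s) * x) * cutoff m x))
     - \int[mu]_(t in `[c, d]) poisson m.+1%:R^-1 (t - s)|
    <= 16 / m.+1%:R * (d - c).
Proof.
move=> cd.
have e0 : 0 < m.+1%:R^-1 :> R by rewrite invr_gt0.
rewrite -/(J m _); under eq_Rintegral do rewrite -/(J m _) mulrC.
rewrite Rintegral_indic//.
have mJ : measurable_fun setT (J m).
  by apply: measurable_ktransform; [exact: measurable_cos|exact: measurable_cutoff].
have mJ2 : measurable_fun setT (fun t : R => J m (t - s)).
  by apply: measurableT_comp => //; exact: measurable_funB.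
have iJ : mu.-integrable `[c, d] (EFin \o (fun t : R => J m (t - s))).
  apply: measurable_bounded_integrable => //.
  - by rewrite /= lebesgue_measure_itv/= lte_fin cd -EFinD ltry.
  - exact: measurable_funTS.
  - exists (\int[mu]_x `|cutoff m x|); split; first exact: num_real.
    move=> y yM t _ /=; apply/ltW; apply: le_lt_trans yM.
    exact: (ktransform_bounded measurable_cos (@cos_max R) (t - s) (integrable_cutoff m)).
have iP : mu.-integrable `[c, d] (EFin \o (fun t : R => poisson m.+1%:R^-1 (t - s))).
  by apply: continuous_integrable_segment; exact: continuous_poisson.
rewrite -RintegralB//.
have iJP : mu.-integrable `[c, d]
    (EFin \o (fun t : R => J m (t - s) - poisson m.+1%:R^-1 (t - s))).
  exact: (integrableB _ iJ iP).
apply: le_trans (le_normr_Rintegral _ _) _ => //.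
apply: (@le_trans _ _ (\int[mu]_(t in `[c, d]) (16 / m.+1%:R))).
  apply: le_Rintegral => //.
  - exact: integrable_norm.
  - exact: (continuous_integrable_segment _ _ (@cst_continuous _ _ _)).
  - by move=> t _; exact: cos_expcut_poisson.
rewrite Rintegral_cst//= lebesgue_measure_itv/= lte_fin cd -EFinD//.
Qed.

(** Dominated convergence: the inner integrals stay bounded and converge, except at the two
    endpoints, to [2 pi] times the indicator. *)
Lemma parseval_segment_rhs a (c d : R) : c < d -> mu.-integrable setT (EFin \o a) ->
  \int[mu]_s (a s *
    \int[mu]_t (\1_(`[c, d]) t * \int[mu]_x (cos ((t - s) * x) * cutoff m x)))
  @[m --> \oo] --> 2 * pi * \int[mu]_(s in `[c, d]) a s.
Proof.
move=> cd ia; have ma := integrable_measurable ia.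
pose Y m s := \int[mu]_t (\1_(`[c, d]) t * J m (t - s)).
have mY m : measurable_fun setT (Y m).
  apply: (measurable_Rintegral2 (F := fun z => \1_(`[c, d]) z.2 * J m (z.2 - z.1))).
  apply: measurable_funM.
    by apply: (measurableT_comp _ measurable_snd); apply: measurable_indic; exact: measurable_itv.
  apply: measurableT_comp; last exact: measurable_funB.
  by apply: measurable_ktransform; [exact: measurable_cos|exact: measurable_cutoff].
(* The mass of the Poisson kernel plus the approximation error at [m = 0], its largest value. *)
pose B : R := 2 * pi + 16 * (d - c).
have eta0 m : 0 < 16 / m.+1%:R :> R by rewrite divr_gt0.
have dc0 : 0 < d - c by rewrite subr_gt0.
have YB m s : `|Y m s| <= B.
  rewrite -[Y m s](subrK (\int[mu]_(t in `[c, d]) poisson m.+1%:R^-1 (t - s))) addrC.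
  apply: le_trans (ler_normD _ _) _; apply: lerD.
    rewrite ger0_norm; first by apply: Rintegral_poisson_le => //; rewrite invr_gt0.
    by apply: Rintegral_ge0 => t _; apply: poisson_ge0; rewrite invr_ge0.
  apply: le_trans (cos_cutoff_segment s m cd) _; rewrite ler_pM2r//.
  by rewrite ler_pdivrMr// ler_peMr// ler1n.
have Yc s : s <> c -> s <> d -> Y m s @[m --> \oo] --> (2 * pi * \1_(`[c, d]) s : R).
  move=> sc sd.
  have H := cvg_poisson_segment cd sc sd.
  have H2 : (fun m => Y m s - \int[mu]_(t in `[c, d]) poisson m.+1%:R^-1 (t - s))
      @ \oo --> (0 : R).
    apply/norm_cvg0P.
    apply: (@squeeze_cvgr _ _ _ _ (fun=> 0) (fun m => 16 / m.+1%:R * (d - c))).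
    - by apply: nearW => m; rewrite normr_ge0/= cos_cutoff_segment.
    - exact: cvg_cst.
    - rewrite -(mul0r (d - c)) -(mulr0 16); apply: cvgMr_tmp; apply: cvgMl_tmp.
      exact: (@cvg_harmonic R).
  rewrite (_ : (fun m => Y m s) = (fun m =>
    (Y m s - \int[mu]_(t in `[c, d]) poisson m.+1%:R^-1 (t - s)) +
    \int[mu]_(t in `[c, d]) poisson m.+1%:R^-1 (t - s))); last first.
    by apply/funext => m; rewrite subrK.
  by have := cvgD H2 H; rewrite add0r; apply.
have := @dominated_convergence _ _ _ mu setT measurableT
  (fun m s => (a s * Y m s)%:E) (EFin \o (fun s => a s * (2 * pi * \1_(`[c, d]) s)))
  (fun s => (B * `|a s|)%:E).
have B0 : 0 <= B by rewrite addr_ge0 ?mulr_ge0 ?pi_ge0// ltW.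
case.
- move=> m; apply/measurable_EFinP.
  by apply: measurable_funM => //; exact: mY.
- apply/measurable_EFinP; apply: measurable_funM => //.
  apply: measurable_funM; first exact: measurable_cst.
  by apply: measurable_indic; exact: measurable_itv.
- apply: ae_imply2 (ae_neq c) (ae_neq d) => s sc sd _.
  apply: cvg_EFin; first exact: nearW.
  by apply: cvgMl_tmp; exact: Yc.
- exact: (integrableZl measurableT B (integrable_norm ia)).
- apply: aeW => s m _; rewrite /= lee_fin normrM mulrC ler_wpM2r//.
move=> i2 _ H.
rewrite (_ : 2 * pi * _ = \int[mu]_s (a s * (2 * pi * \1_(`[c, d]) s))).
  apply: fine_cvg; rewrite fineK//; exact: (integrable_fin_num measurableT i2).
rewrite -Rintegral_indic// -RintegralZl//.
  by apply: eq_Rintegral => s _; rewrite mulrCA mulrA.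
apply: (integrable_mul_indic a (measurable_itv `[c, d])).1.
exact: integrableS ia.
Qed.

(** The extra [1] keeps the radius positive, as Bessel's inequality demands. *)
Lemma supported_indic (c d : R) : supported (`|c| + `|d| + 1) (\1_(`[c, d]) : R -> R).
Proof.
move=> t /= Ht; rewrite indicE memNset//= in_itv/= => /andP[ct td].
move: Ht; apply/negP; rewrite -leNgt ler_norml.
by have := ler_norm c; have := ler_norm d; have := ler_norm (- c);
  rewrite normrN; have := normr_ge0 d; have := normr_ge0 c; lra.
Qed.

Lemma sqintg_ktransform_cos N a : 0 < N -> sqintg a -> supported N a -> sqintg (ktransform cos a).
Proof.
move=> N0 sa Na; split.
  by apply: measurable_ktransform; [exact: measurable_cos|case: sa].
by apply: le_lt_trans (bessel_cos N0 sa Na) _; case: sa => _ qa;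
  rewrite lte_mul_pinfty// lee_fin mulr_ge0// pi_ge0.
Qed.

Lemma sqintg_ktransform_sin N a : 0 < N -> sqintg a -> supported N a -> sqintg (ktransform sin a).
Proof.
move=> N0 sa Na; split.
  by apply: measurable_ktransform; [exact: measurable_sin|case: sa].
by apply: le_lt_trans (bessel_sin N0 sa Na) _; case: sa => _ qa;
  rewrite lte_mul_pinfty// lee_fin mulr_ge0// pi_ge0.
Qed.

(** Both sides are limits of the same weighted integrals: Bessel's inequality makes the products
    integrable, which removes the weight on the left. *)
Lemma parseval_segment N a (c d : R) : 0 < N -> sqintg a -> supported N a -> c < d ->
  \int[mu]_x (ktransform cos a x * ktransform cos (\1_(`[c, d])) x +
              ktransform sin a x * ktransform sin (\1_(`[c, d])) x) =
  2 * pi * \int[mu]_(s in `[c, d]) a s.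
Proof.
move=> N0 sa Na cd.
have sb := sqintg_indic c d; have Nb := @supported_indic c d.
have M0 : 0 < `|c| + `|d| + 1 by rewrite ltr_wpDl ?addr_ge0.
have ia := supported_integrable sa Na; have ib := supported_integrable sb Nb.
have i1 := sqintg_mul (sqintg_ktransform_cos N0 sa Na) (sqintg_ktransform_cos M0 sb Nb).
have i2 := sqintg_mul (sqintg_ktransform_sin N0 sa Na) (sqintg_ktransform_sin M0 sb Nb).
have H1 : \int[mu]_x (cutoff m x * (ktransform cos a x * ktransform cos (\1_(`[c, d])) x +
    ktransform sin a x * ktransform sin (\1_(`[c, d])) x)) @[m --> \oo] --> _ :=
  cvg_weighted_Rintegral (integrableD measurableT i1 i2).
have E m : \int[mu]_x (cutoff m x * (ktransform cos a x * ktransform cos (\1_(`[c, d])) x +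
    ktransform sin a x * ktransform sin (\1_(`[c, d])) x)) = \int[mu]_s (a s *
    \int[mu]_t (\1_(`[c, d]) t * \int[mu]_x (cos ((t - s) * x) * cutoff m x))).
  rewrite -(parseval_weight (integrable_cutoff _) ib ia).
  by apply: eq_Rintegral => x _; congr (_ * _); congr (_ + _); rewrite mulrC.
rewrite (funext E) in H1.
exact: (cvg_unique _ H1 (parseval_segment_rhs cd ia)).
Qed.

Lemma cross_parseval N M a b : 0 < N -> 0 < M -> sqintg a -> supported N a ->
  sqintg b -> supported M b ->
  \int[mu]_x (ktransform sin a x * ktransform cos b x - ktransform cos a x * ktransform sin b x) = 0.
Proof.
move=> N0 M0 sa Na sb Mb.
have ia := supported_integrable sa Na; have ib := supported_integrable sb Mb.
have i1 := sqintg_mul (sqintg_ktransform_sin N0 sa Na) (sqintg_ktransform_cos M0 sb Mb).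
have i2 := sqintg_mul (sqintg_ktransform_cos N0 sa Na) (sqintg_ktransform_sin M0 sb Mb).
have H1 := cvg_weighted_Rintegral (integrableB measurableT i1 i2).
apply: (cvg_unique _ H1) => //.
rewrite (_ : (fun m => _) = (fun=> 0)); first exact: cvg_cst.
by apply/funext => m; apply: cross_parseval_weight.
Qed.

End Parseval.

(** * Cosine and sine transforms in L^2 *)

Section L2Transform.
Context {R : realType}.
Local Notation mu := (@lebesgue_measure R).
Implicit Types (a b h G K k : R -> R) (e N : R).

Definition trunc (n : nat) h : R -> R := fun x => h x * \1_(`[- n%:R, n%:R]) x.

Lemma supported_trunc n h : supported n%:R (trunc n h).
Proof.
move=> t nt; rewrite /trunc indicE memNset ?mulr0//= in_itv/= -ler_norml.
by apply/negP; rewrite -ltNge.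
Qed.

Lemma trunc_sqr_le n h x : trunc n h x ^+ 2 <= h x ^+ 2.
Proof.
rewrite /trunc indicE; case: (_ \in _); first by rewrite mulr1.
by rewrite mulr0 expr0n sqr_ge0.
Qed.

Lemma sqintg_trunc n h : sqintg h -> sqintg (trunc n h).
Proof.
move=> sh; apply: (le_sqintg _ sh (trunc_sqr_le n h)).
apply: measurable_funM; first by case: sh.
by apply: measurable_indic; exact: measurable_itv.
Qed.

Lemma integrable_trunc n h : sqintg h -> mu.-integrable setT (EFin \o trunc n h).
Proof.
by move=> sh; apply: supported_integrable; [exact: sqintg_trunc|exact: supported_trunc].
Qed.

Lemma cvg_trunc h : sqintg h -> (fun n => sqnorm (fun x => trunc n h x - h x)) @ \oo --> 0%E.
Proof.
move=> sh; have [mh qh] := sh.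
have mt n : measurable_fun setT (trunc n h) by case: (sqintg_trunc n sh).
have tE n x : (trunc n h x - h x) ^+ 2 <= h x ^+ 2.
  rewrite /trunc indicE; case: (_ \in _).
    by rewrite mulr1 subrr expr0n sqr_ge0.
  by rewrite mulr0 sub0r sqrrN.
have := @dominated_convergence _ _ _ mu setT measurableT
  (fun n x => ((trunc n h x - h x) ^+ 2)%:E) (cst 0%E) (fun x => (h x ^+ 2)%:E).
case.
- by move=> n; apply: measurable_sqr; exact: measurable_funB.
- exact: measurable_cst.
- apply: aeW => x _; apply: cvg_near_cst.
  exists (Num.trunc `|x|).+1 => // n /= xn.
  rewrite /trunc indicE mem_set ?mulr1 ?subrr ?expr0n//= in_itv/= -ler_norml.
  by rewrite (le_trans (ltW (truncnS_gt _)))// ler_nat.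
- by have := sqintg_mul sh sh; under eq_fun do rewrite -expr2.
- by apply: aeW => x n _; rewrite /= lee_fin ger0_norm ?sqr_ge0// tE.
by move=> _ _; rewrite integral0; exact.
Qed.

(* Shared by [cos] and [sin], the only two kernels of interest. *)
Definition bessel_kernel k : Prop :=
  [/\ measurable_fun setT k, forall x, `|k x| <= 1 &
    forall N a, 0 < N -> sqintg a -> supported N a ->
      (sqnorm (ktransform k a) <= (2 * pi)%:E * sqnorm a)%E].

Lemma bessel_kernel_cos : bessel_kernel (@cos R).
Proof. by split; [exact: measurable_cos|exact: cos_max|exact: bessel_cos]. Qed.

Lemma bessel_kernel_sin : bessel_kernel (@sin R).
Proof. by split; [exact: measurable_sin|exact: sin_max|exact: bessel_sin]. Qed.

(** The real, unnormalized counterpart of [is_L2_transform]. *)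
Definition is_ktransform k h G : Prop :=
  sqintg G /\ (fun n => sqnorm (fun x => ktransform k (trunc n h) x - G x)) @ \oo --> 0%E.

Section kernel.
Variable k : R -> R.
Hypothesis bk : bessel_kernel k.
Let mk : measurable_fun setT k. Proof. by case: bk. Qed.
Let k1 x : `|k x| <= 1. Proof. by case: bk. Qed.


(** Enlarging the radius by [1] admits [N = 0], the radius of the first truncation. *)
Lemma bessel_supported N a : 0 <= N -> sqintg a -> supported N a ->
  (sqnorm (ktransform k a) <= (2 * pi)%:E * sqnorm a)%E.
Proof.
move=> N0 sa Na; case: bk => _ _ /(_ (N + 1)); apply => //; first by rewrite ltr_wpDl.
by move=> t Ht; apply: Na; apply: le_lt_trans Ht; rewrite lerDl.
Qed.

Lemma sqintg_ktransform N a : 0 <= N -> sqintg a -> supported N a -> sqintg (ktransform k a).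
Proof.
move=> N0 sa Na; split; first by apply: measurable_ktransform => //; case: sa.
apply: le_lt_trans (bessel_supported N0 sa Na) _; case: sa => _ qa.
by rewrite lte_mul_pinfty// lee_fin mulr_ge0// pi_ge0.
Qed.

Lemma sqintg_ktransform_trunc n h : sqintg h -> sqintg (ktransform k (trunc n h)).
Proof.
by move=> sh; apply: (@sqintg_ktransform n%:R) => //; [exact: sqintg_trunc|exact: supported_trunc].
Qed.

Lemma sqnorm_ktransform_trunc_le n h : sqintg h ->
  (sqnorm (ktransform k (trunc n h)) <= (2 * pi)%:E * sqnorm h)%E.
Proof.
move=> sh; apply: le_trans (bessel_supported (ler0n _ n) (sqintg_trunc n sh)
  (@supported_trunc n h)) _.
apply: lee_wpmul2l; first by rewrite lee_fin mulr_ge0// pi_ge0.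
by apply: le_sqnorm; [case: (sqintg_trunc n sh)|case: sh|exact: trunc_sqr_le].
Qed.

(** By linearity this is Bessel's inequality for the difference of two truncations; it makes the
    truncated transforms a Cauchy sequence. *)
Lemma ktransform_truncB n m h : sqintg h ->
  (sqnorm (fun x => ktransform k (trunc n h) x - ktransform k (trunc m h) x)%R
   <= (2 * pi)%:E * sqnorm (fun x => trunc n h x - trunc m h x)%R)%E.
Proof.
move=> sh.
rewrite (_ : (fun x => _ - _) = ktransform k (fun x => trunc n h x - trunc m h x)); last first.
  by apply/funext => x; rewrite ktransformB//; exact: integrable_trunc.
apply: (@bessel_supported (maxn n m)%:R) => //.
  by apply: sqintgB; exact: sqintg_trunc.
move=> t Ht; rewrite (supported_trunc h (n := n)) ?(supported_trunc h (n := m)) ?subrr//.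
- by apply: le_lt_trans Ht; rewrite ler_nat leq_maxr.
- by apply: le_lt_trans Ht; rewrite ler_nat leq_maxl.
Qed.

Lemma is_ktransform_exists h : sqintg h -> exists G, is_ktransform k h G.
Proof.
move=> sh; apply: L2_complete => [n|e e0]; first exact: sqintg_ktransform_trunc.
(* The share [e / (8 pi)] compensates [2 pi] from Bessel and [2 + 2] from the triangle
   inequality. *)
have [N NP] := (cvge0_leP (fun n => sqnorm_ge0 _)).1 (cvg_trunc sh) (e / (8 * pi))
  (divr_gt0 e0 (mulr_gt0 (ltr0Sn _ _) (pi_gt0 R))).
exists N => n m Nn Nm; apply: le_trans (ktransform_truncB n m sh) _.
have mt j : measurable_fun setT (trunc j h) by case: (sqintg_trunc j sh).
have mh : measurable_fun setT h by case: sh.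
apply: (@le_trans _ _ ((2 * pi)%:E * (2%:E * (e / (8 * pi))%:E + 2%:E * (e / (8 * pi))%:E))%E).
  apply: lee_wpmul2l; first by rewrite lee_fin mulr_ge0// pi_ge0.
  apply: le_trans (sqnorm_triangle (mt n) mh (mt m)) _.
  rewrite [X in (_ + _ * X)%E]sqnormBC.
  by apply: leeD; apply: lee_wpmul2l => //; exact: NP.
rewrite -!EFinM lee_fin le_eqVlt; apply/orP; left; apply/eqP.
by move: (pi_gt0 R); move: (pi : R) => q q0; field; exact: lt0r_neq0.
Qed.

(** Duality: the kernel is symmetric in its two variables, so Fubini moves the transform of a
    truncation onto the indicator; both sides then pass to the limit. *)
Lemma is_ktransform_segment G K (c d : R) : sqintg G -> is_ktransform k G K ->
  \int[mu]_x (K x * \1_(`[c, d]) x) = \int[mu]_t (G t * ktransform k (\1_(`[c, d])) t).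
Proof.
move=> sG [sK cK].
have sb := sqintg_indic c d; have Nb := @supported_indic R c d.
have M0 : 0 <= `|c| + `|d| + 1 by rewrite addr_ge0// addr_ge0.
have ib := supported_integrable sb Nb.
have H1 := cvg_inner (fun n => sqintg_ktransform_trunc n sG) sK sb cK.
have H2 := cvg_inner (fun n => sqintg_trunc n sG) sG (sqintg_ktransform M0 sb Nb) (cvg_trunc sG).
have E n : \int[mu]_x (ktransform k (trunc n G) x * \1_(`[c, d]) x) =
    \int[mu]_t (trunc n G t * ktransform k (\1_(`[c, d])) t).
  transitivity (\int[mu]_x (\1_(`[c, d]) x * ktransform k (trunc n G) x)).
    by apply: eq_Rintegral => x _; rewrite mulrC.
  rewrite (Fubini_kernel ib (integrable_trunc n sG) (measurable_mulkernel mk) (fun z => k1 _)).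
  apply: eq_Rintegral => t _; congr (_ * _).
  by apply: eq_Rintegral => x _; rewrite [x * t]mulrC.
rewrite (funext E) in H1.
exact: (cvg_unique _ H1 H2).
Qed.

Lemma is_ktransform_inner h G b : sqintg h -> is_ktransform k h G -> sqintg b ->
  \int[mu]_x (ktransform k (trunc n h) x * b x) @[n --> \oo] --> \int[mu]_x (G x * b x).
Proof.
move=> sh [sG cG] sb.
exact: (cvg_inner (fun n => sqintg_ktransform_trunc n sh) sG sb cG).
Qed.

End kernel.

(* The primitive of [f - g] vanishes, hence so does its a.e. derivative. *)
Lemma ae_eq_segment f g : sqintg f -> sqintg g ->
  (forall c d : R, c < d ->
    \int[mu]_x (f x * \1_(`[c, d]) x) = \int[mu]_x (g x * \1_(`[c, d]) x)) ->
  {ae mu, forall x, f x = g x}.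
Proof.
move=> sf sg fg.
have [mf _] := sf; have [mg _] := sg.
pose u x := f x - g x.
have su : sqintg u by exact: sqintgB.
have iu c d : mu.-integrable `[c, d] (EFin \o u).
  apply: (integrable_mul_indic u (measurable_itv `[c, d])).2.
  exact: sqintg_segment_integrable.
have u0 c d : c < d -> \int[mu]_(x in `[c, d]) u x = 0.
  move=> cd; rewrite -Rintegral_indic// /u.
  under eq_Rintegral do rewrite mulrBl.
  rewrite RintegralB//; try exact: sqintg_segment_integrable.
  by rewrite fg// subrr.
have lu : locally_integrable [set: R] u.
  split; [exact: measurable_funB|exact: openT|].
  move=> K _ cK.
  have [M [_ /(_ (M + 1)) MP]] := compact_bounded cK.
  have KM : K `<=` `[- (M + 1), M + 1].
    by move=> x Kx /=; rewrite in_itv/= -ler_norml; apply: MP => //; rewrite ltrDl.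
  have iK : mu.-integrable K (EFin \o u).
    have iM := iu (- (M + 1)) (M + 1).
    by apply: integrableS iM => //; exact: compact_measurable.
  by have /integrableP[] := iK.
(* Differentiation of the primitive based at [- n] gives the claim to the right of [- n]; countably
   many base points cover the line. *)
have H (n : nat) : {ae mu, forall x, - n%:R < x -> u x = 0}.
  have := @FTC1 _ u (BLeft (- n%:R)) (fun y => iu _ y) lu.
  apply: ae_imply => x xP nx.
  have [_ <-] := xP nx.
  rewrite [X in derive1 X](_ : _ = cst 0) ?derive1_cst//.
  apply/funext => y /=; have [ny|] := ltP (- n%:R) y; first exact: u0.
  rewrite le_eqVlt => /predU1P[->|yn]; first by rewrite set_itv1 Rintegral_set1.
  by rewrite set_itv_ge ?Rintegral_set0// bnd_simp -ltNge.
have := ae_foralln H; apply: ae_imply => x xP.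
apply/eqP; rewrite -subr_eq0; apply/eqP.
apply: (xP (Num.trunc `|x|).+1).
by have := truncnS_gt `|x|; rewrite ltr_norml => /andP[].
Qed.

(** * Inversion for the cosine and sine transforms *)

Section Inversion.
Variables h C S CC SS SC CS : R -> R.
Hypotheses (sh : sqintg h) (hC : is_ktransform cos h C) (hS : is_ktransform sin h S)
  (hCC : is_ktransform cos C CC) (hSS : is_ktransform sin S SS)
  (hSC : is_ktransform sin C SC) (hCS : is_ktransform cos S CS).

(** Tested against the indicator of a segment, the outer transforms move onto the indicator by
    duality; what remains is the limit of [parseval_segment] along the truncations of [h]. *)
Lemma cos_sin_inversion : {ae mu, forall x, CC x + SS x = 2 * pi * h x}.
Proof.
apply: ae_eq_segment.
- by apply: sqintgD; [case: hCC|case: hSS].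
- exact: sqintgZ.
move=> c d cd.
have sC : sqintg C by case: hC. have sS : sqintg S by case: hS.
have sCC : sqintg CC by case: hCC. have sSS : sqintg SS by case: hSS.
have sb := sqintg_indic c d; have Nb := @supported_indic R c d.
have M0 : 0 <= `|c| + `|d| + 1 by rewrite addr_ge0// addr_ge0.
have scb := sqintg_ktransform bessel_kernel_cos M0 sb Nb.
have ssb := sqintg_ktransform bessel_kernel_sin M0 sb Nb.
transitivity (\int[mu]_x (CC x * \1_(`[c, d]) x) + \int[mu]_x (SS x * \1_(`[c, d]) x)).
  rewrite -RintegralD//; try exact: sqintg_mul.
  by apply: eq_Rintegral => x _; rewrite mulrDl.
rewrite (is_ktransform_segment bessel_kernel_cos c d sC hCC).
rewrite (is_ktransform_segment bessel_kernel_sin c d sS hSS).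
have H1 : (fun n => \int[mu]_x (ktransform cos (trunc n h) x * ktransform cos (\1_(`[c, d])) x) +
    \int[mu]_x (ktransform sin (trunc n h) x * ktransform sin (\1_(`[c, d])) x)) @ \oo -->
    \int[mu]_x (C x * ktransform cos (\1_(`[c, d])) x) +
    \int[mu]_x (S x * ktransform sin (\1_(`[c, d])) x).
  by apply: cvgD; [exact: (is_ktransform_inner bessel_kernel_cos)|
    exact: (is_ktransform_inner bessel_kernel_sin)].
have H2 : (fun n => 2 * pi * \int[mu]_x (trunc n h x * \1_(`[c, d]) x)) @ \oo -->
    2 * pi * \int[mu]_x (h x * \1_(`[c, d]) x).
  apply: cvgMl_tmp.
  exact: (cvg_inner (fun n => sqintg_trunc n sh) sh sb (cvg_trunc sh)).
rewrite (_ : \int[mu]_x (2 * pi * h x * \1_(`[c, d]) x) =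
    2 * pi * \int[mu]_x (h x * \1_(`[c, d]) x)); last first.
  rewrite -RintegralZl//; last exact: sqintg_mul.
  by apply: eq_Rintegral => x _; rewrite mulrA.
apply: (cvg_unique _ H1) => //.
apply: cvg_trans H2; apply: near_eq_cvg.
(* The radius [n] of the truncation must be positive. *)
exists 1%N => // n /= n1.
have n0 : 0 < n%:R :> R by rewrite ltr0n.
rewrite Rintegral_indic// -(parseval_segment n0 (sqintg_trunc n sh) (@supported_trunc n h) cd).
have i1 := sqintg_mul (sqintg_ktransform_trunc bessel_kernel_cos n sh) scb.
have i2 := sqintg_mul (sqintg_ktransform_trunc bessel_kernel_sin n sh) ssb.
by rewrite (RintegralD measurableT i1 i2).
Qed.

(** The same duality argument, with [cross_parseval]. It cancels the mixed terms when the complex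
    transform is inverted. *)
Lemma cos_sin_commute : {ae mu, forall x, SC x = CS x}.
Proof.
apply: ae_eq_segment; [by case: hSC|by case: hCS|].
move=> c d cd.
have sC : sqintg C by case: hC. have sS : sqintg S by case: hS.
have sb := sqintg_indic c d; have Nb := @supported_indic R c d.
have M0 : 0 < `|c| + `|d| + 1 by rewrite ltr_wpDl// addr_ge0.
have scb := sqintg_ktransform bessel_kernel_cos (ltW M0) sb Nb.
have ssb := sqintg_ktransform bessel_kernel_sin (ltW M0) sb Nb.
rewrite (is_ktransform_segment bessel_kernel_sin c d sC hSC).
rewrite (is_ktransform_segment bessel_kernel_cos c d sS hCS).
apply/eqP; rewrite eq_sym -subr_eq0; apply/eqP.
have H1 : (fun n => \int[mu]_x (ktransform sin (trunc n h) x * ktransform cos (\1_(`[c, d])) x) -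
    \int[mu]_x (ktransform cos (trunc n h) x * ktransform sin (\1_(`[c, d])) x)) @ \oo -->
    \int[mu]_x (S x * ktransform cos (\1_(`[c, d])) x) -
    \int[mu]_x (C x * ktransform sin (\1_(`[c, d])) x).
  by apply: cvgB; [exact: (is_ktransform_inner bessel_kernel_sin)|
    exact: (is_ktransform_inner bessel_kernel_cos)].
apply: (cvg_unique _ H1) => //.
apply: cvg_near_cst; exists 1%N => // n /= n1.
have n0 : 0 < n%:R :> R by rewrite ltr0n.
rewrite -(cross_parseval n0 M0 (sqintg_trunc n sh) (@supported_trunc n h) sb Nb).
have i1 := sqintg_mul (sqintg_ktransform_trunc bessel_kernel_sin n sh) scb.
have i2 := sqintg_mul (sqintg_ktransform_trunc bessel_kernel_cos n sh) ssb.
by rewrite (RintegralB measurableT i1 i2).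
Qed.

End Inversion.
End L2Transform.

(** * The complex Fourier transform *)

Section ComplexTransform.
Context {R : realType}.
Local Notation mu := (@lebesgue_measure R).
Local Notation cRe := (@complex.Re R).
Local Notation cIm := (@complex.Im R).
Implicit Types (a b h k : R -> R) (F G H g r : R -> R[i]) (s : R).

Lemma cvge0Z (c : R) (u : nat -> \bar R) : u @ \oo --> 0%E ->
  (fun n => (c%:E * u n)%E) @ \oo --> 0%E.
Proof. by move=> u0; rewrite -(mule0 c%:E); exact: cvgeZl. Qed.

Lemma cvge0D (u v : nat -> \bar R) : u @ \oo --> 0%E -> v @ \oo --> 0%E ->
  (fun n => (u n + v n)%E) @ \oo --> 0%E.
Proof. by move=> u0 v0; rewrite -(adde0 0%E); exact: cvgeD. Qed.

Lemma cvge0_squeeze (u v : nat -> \bar R) : (forall n, (0 <= u n)%E) ->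
  (forall n, (u n <= v n)%E) -> v @ \oo --> 0%E -> u @ \oo --> 0%E.
Proof.
move=> u0 uv v0; apply: (@squeeze_cvge _ _ _ _ (fun=> 0%E) u v) => //.
  by apply: nearW => n; rewrite u0 uv.
exact: cvg_cst.
Qed.

Lemma cvg_sqnorm_lin (u v : nat -> R -> R) a b (p q : R) :
  (forall n, sqintg (u n)) -> (forall n, sqintg (v n)) -> sqintg a -> sqintg b ->
  (fun n => sqnorm (fun x => u n x - a x)) @ \oo --> 0%E ->
  (fun n => sqnorm (fun x => v n x - b x)) @ \oo --> 0%E ->
  (fun n => sqnorm (fun x => (p * u n x + q * v n x) - (p * a x + q * b x)))
    @ \oo --> 0%E.
Proof.
move=> su sv sa sb ua vb.
have m1 n : measurable_fun setT (fun x => u n x - a x).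
  by apply: measurable_funB; [case: (su n)|case: sa].
have m2 n : measurable_fun setT (fun x => v n x - b x).
  by apply: measurable_funB; [case: (sv n)|case: sb].
have qE n : (sqnorm (fun x => (p * u n x + q * v n x) - (p * a x + q * b x))%R <=
    2%:E * ((p ^+ 2)%:E * sqnorm (fun x => u n x - a x)%R) +
    2%:E * ((q ^+ 2)%:E * sqnorm (fun x => v n x - b x)%R))%E.
  rewrite -(sqnormZ p (m1 n)) -(sqnormZ q (m2 n)).
  apply: le_trans (sqnormD (measurable_funM (@measurable_cst _ _ _ _ _ p) (m1 n))
    (measurable_funM (@measurable_cst _ _ _ _ _ q) (m2 n))).
  rewrite le_eqVlt; apply/orP; left; apply/eqP; congr sqnorm.
  by apply/funext => x /=; ring.
apply: cvge0_squeeze qE (cvge0D (cvge0Z 2 (cvge0Z (p ^+ 2) ua)) (cvge0Z 2 (cvge0Z (q ^+ 2) vb))) => n.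
exact: sqnorm_ge0.
Qed.

(** Needed for the second transform, whose input is a combination of cosine and sine transforms. *)
Lemma is_ktransform_lin k h1 (G1 : R -> R) h2 (G2 : R -> R) (p q : R) : bessel_kernel k ->
  sqintg h1 -> sqintg h2 -> is_ktransform k h1 G1 -> is_ktransform k h2 G2 ->
  is_ktransform k (fun x => p * h1 x + q * h2 x) (fun x => p * G1 x + q * G2 x).
Proof.
move=> bk s1 s2 [sG1 c1] [sG2 c2]; have [mk k1 _] := bk.
split; first by apply: sqintgD; exact: sqintgZ.
have i1 n := integrable_trunc n s1; have i2 n := integrable_trunc n s2.
have E n x : ktransform k (trunc n (fun x => p * h1 x + q * h2 x)) x =
    p * ktransform k (trunc n h1) x + q * ktransform k (trunc n h2) x.
  rewrite -(ktransformZ mk k1 p x (i1 n)) -(ktransformZ mk k1 q x (i2 n)).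
  rewrite -(ktransformD mk k1 x (integrableZl measurableT p (i1 n))
    (integrableZl measurableT q (i2 n))).
  by congr ktransform; apply/funext => t; rewrite /trunc mulrDl !mulrA.
have := cvg_sqnorm_lin p q (fun n => sqintg_ktransform_trunc bk n s1)
  (fun n => sqintg_ktransform_trunc bk n s2) sG1 sG2 c1 c2.
apply: cvg_trans; apply: near_eq_cvg; apply: nearW => n /=.
by congr sqnorm; apply/funext => x; rewrite E.
Qed.

Definition csqnorm F : \bar R := (sqnorm (cRe \o F) + sqnorm (cIm \o F))%E.

Definition csqintg F : Prop := sqintg (cRe \o F) /\ sqintg (cIm \o F).

Lemma in_L2P F : in_L2 F <-> csqintg F.
Proof. by split=> -[/sqintgP ? /sqintgP]. Qed.

Lemma csqnorm_ge0 F : (0 <= csqnorm F)%E.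
Proof. by rewrite adde_ge0// sqnorm_ge0. Qed.

Lemma ReB (z w : R[i]) : cRe (z - w) = cRe z - cRe w.
Proof. by case: z w => [? ?] [? ?]. Qed.

Lemma ImB (z w : R[i]) : cIm (z - w) = cIm z - cIm w.
Proof. by case: z w => [? ?] [? ?]. Qed.

Lemma csqintgB F G : csqintg F -> csqintg G -> csqintg (fun x => F x - G x).
Proof.
move=> [f1 f2] [g1 g2]; split.
  by rewrite (_ : _ \o _ = (fun x => (cRe \o F) x - (cRe \o G) x)); [exact: sqintgB|
    apply/funext => x; exact: ReB].
by rewrite (_ : _ \o _ = (fun x => (cIm \o F) x - (cIm \o G) x)); [exact: sqintgB|
    apply/funext => x; exact: ImB].
Qed.

Lemma csqnormBE F G : csqnorm (fun x => F x - G x) =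
  (sqnorm (fun x => cRe (F x) - cRe (G x))%R + sqnorm (fun x => cIm (F x) - cIm (G x))%R)%E.
Proof.
by rewrite /csqnorm; congr (_ + _)%E; congr sqnorm; apply/funext => x; rewrite /= (ReB, ImB).
Qed.

Lemma csqnormBC F G : csqnorm (fun x => F x - G x) = csqnorm (fun x => G x - F x).
Proof. by rewrite !csqnormBE; congr (_ + _)%E; exact: sqnormBC. Qed.

Lemma csqnorm_triangle F G H : csqintg F -> csqintg G -> csqintg H ->
  (csqnorm (fun x => F x - H x)%R <=
    2%:E * csqnorm (fun x => F x - G x)%R + 2%:E * csqnorm (fun x => G x - H x)%R)%E.
Proof.
move=> [[f1 _] [f2 _]] [[g1 _] [g2 _]] [[h1 _] [h2 _]].
have E (a b c d : \bar R) : (0 <= a)%E -> (0 <= b)%E -> (0 <= c)%E -> (0 <= d)%E ->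
    (2%:E * a + 2%:E * b + (2%:E * c + 2%:E * d) = 2%:E * (a + c) + 2%:E * (b + d))%E.
  by move=> a0 b0 c0 d0; rewrite !ge0_muleDr// addeACA.
rewrite !csqnormBE -E ?sqnorm_ge0//.
exact: leeD (sqnorm_triangle f1 g1 h1) (sqnorm_triangle f2 g2 h2).
Qed.

Lemma csqnorm_eq_ae F G : csqintg F -> csqintg G -> {ae mu, forall x, F x = G x} ->
  csqnorm (fun x => F x - G x) = 0%E.
Proof.
move=> [[f1 _] [f2 _]] [[g1 _] [g2 _]] FG; rewrite csqnormBE.
have q0 a b : measurable_fun setT a -> measurable_fun setT b ->
    {ae mu, forall x, a x = b x} -> sqnorm (fun x => a x - b x) = 0%E.
  move=> ma mb ab; rewrite /sqnorm -(integral0 mu setT).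
  apply: ge0_ae_eq_integral => //.
  - by apply: measurable_sqr; exact: measurable_funB.
  - by move=> x _; rewrite lee_fin sqr_ge0.
  - by apply: ae_imply ab => x -> _; rewrite subrr expr0n.
rewrite (q0 _ _ f1 g1) ?(q0 _ _ f2 g2) ?adde0//.
- by apply: ae_imply FG => x /= ->.
- by apply: ae_imply FG => x /= ->.
Qed.

Lemma L2normE F : measurable_fun setT (cRe \o F) -> measurable_fun setT (cIm \o F) ->
  L2norm F = (csqnorm F `^ 2^-1)%E.
Proof.
move=> mr mi; rewrite /L2norm Lnorm2E; congr (_ `^ _)%E.
rewrite /csqnorm /sqnorm -ge0_integralD//.
- apply: eq_integral => x _; rewrite -EFinD; congr EFin.
  rewrite /cabs /=; case: (F x) => u v /=.
  by rewrite sqr_sqrtr// addr_ge0 ?sqr_ge0.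
- by move=> x _; rewrite lee_fin sqr_ge0.
- exact: measurable_sqr.
- by move=> x _; rewrite lee_fin sqr_ge0.
- exact: measurable_sqr.
Qed.

Lemma poweR_half_le (x : \bar R) (e : R) : (0 <= x)%E -> 0 <= e ->
  (x `^ 2^-1 <= e%:E)%E = (x <= (e ^+ 2)%:E)%E.
Proof.
move=> x0 e0; case: x x0 => [x||]//= x0.
  rewrite !lee_fin powR12_sqrt//.
  by rewrite -{2}(sqr_sqrtr x0) ler_pXn2r ?nnegrE ?sqrtr_ge0.
by rewrite ifF//; apply/negbTE; rewrite invr_eq0 pnatr_eq0.
Qed.

Lemma L2norm_le F (e : R) : csqintg F -> 0 <= e ->
  (L2norm F <= e%:E)%E = (csqnorm F <= (e ^+ 2)%:E)%E.
Proof.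
by move=> [[m1 _] [m2 _]] e0; rewrite L2normE// poweR_half_le// csqnorm_ge0.
Qed.

Lemma L2norm_cvg0 (u : nat -> R -> R[i]) : (forall n, csqintg (u n)) ->
  (fun n => L2norm (u n)) @ \oo --> 0%E <-> (fun n => csqnorm (u n)) @ \oo --> 0%E.
Proof.
move=> cu; have P1 := cvge0_leP (fun n => csqnorm_ge0 (u n)).
have P2 := cvge0_leP (fun n => @Lnorm_ge0 _ _ R mu 2%:E (EFin \o (@cabs R \o u n))).
split=> [/P2 H|/P1 H]; [apply/P1|apply/P2] => e e0.
  have [N NP] := H (Num.sqrt e) ltac:(by rewrite sqrtr_gt0).
  exists N => n /NP; rewrite L2norm_le ?sqrtr_ge0// sqr_sqrtr//; exact: ltW.
have [N NP] := H (e ^+ 2) (exprn_gt0 _ e0).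
by exists N => n /NP; rewrite L2norm_le// ltW.
Qed.

Local Notation c0 := ((Num.sqrt (2 * pi))^-1 : R).

Lemma c0_sqr : c0 ^+ 2 = (2 * pi)^-1.
Proof. by rewrite exprVn sqr_sqrtr// mulr_ge0// pi_ge0. Qed.

(** Treats the direct transform ([-1]) and the inverse one ([1]) together: by parity the sign leaves
    the argument of [cos] and [sin]. *)
Definition sgn_one s := s = 1 \/ s = -1.

Lemma sgn_sin s (x : R) : sgn_one s -> sin (s * x) = s * sin x.
Proof. by move=> [->|->]; rewrite ?mul1r// !mulN1r sinN. Qed.

Lemma sgn_cos s (x : R) : sgn_one s -> cos (s * x) = cos x.
Proof. by move=> [->|->]; rewrite ?mul1r// !mulN1r cosN. Qed.

(** Expansion of [(cos + i s sin) (Re g + i Im g)] under the integral. *)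
Lemma truncated_transformE s n g x : sgn_one s -> csqintg g ->
  truncated_transform s n g x =
  (c0 * (ktransform cos (trunc n (cRe \o g)) x - s * ktransform sin (trunc n (cIm \o g)) x)) +i*
  (c0 * (s * ktransform sin (trunc n (cRe \o g)) x + ktransform cos (trunc n (cIm \o g)) x)).
Proof.
move=> hs [sa sb].
have ic (h : R -> R) : sqintg h -> mu.-integrable setT (EFin \o (fun t => cos (x * t) * trunc n h t)).
  by move=> sh; apply: (integrable_ktransform measurable_cos (@cos_max R)); exact: integrable_trunc.
have is' (h : R -> R) : sqintg h -> mu.-integrable setT (EFin \o (fun t => sin (x * t) * trunc n h t)).
  by move=> sh; apply: (integrable_ktransform measurable_sin (@sin_max R)); exact: integrable_trunc.
have isz (h : R -> R) : sqintg h ->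
    mu.-integrable setT (EFin \o (fun t => s * (sin (x * t) * trunc n h t))).
  by move=> sh; exact: (integrableZl measurableT s (is' _ sh)).
rewrite /truncated_transform /cintegral.
have -> : \int[mu]_(t in `[- n%:R, n%:R]) cRe (cexp (0 +i* (s * x * t)) * g t) =
    ktransform cos (trunc n (cRe \o g)) x - s * ktransform sin (trunc n (cIm \o g)) x.
  rewrite /ktransform -(RintegralZl s measurableT (is' _ sb)).
  rewrite -(RintegralB measurableT (ic _ sa) (isz _ sb)).
  rewrite -Rintegral_indic//; apply: eq_Rintegral => t _.
  rewrite /cexp/= expR0 !mul1r -mulrA sgn_cos// sgn_sin// /trunc/=.
  case: (g t) => u v /=; ring.
have -> : \int[mu]_(t in `[- n%:R, n%:R]) cIm (cexp (0 +i* (s * x * t)) * g t) =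
    s * ktransform sin (trunc n (cRe \o g)) x + ktransform cos (trunc n (cIm \o g)) x.
  rewrite /ktransform -(RintegralZl s measurableT (is' _ sa)).
  rewrite -(RintegralD measurableT (isz _ sa) (ic _ sb)).
  rewrite -Rintegral_indic//; apply: eq_Rintegral => t _.
  rewrite /cexp/= expR0 !mul1r -mulrA sgn_cos// sgn_sin// /trunc/=.
  case: (g t) => u v /=; ring.
by apply/eqP; rewrite eq_complex/= !mul0r subr0 addr0 !eqxx.
Qed.

End ComplexTransform.

(** * Stability of the complex transform and of its inverse *)

Section InversionBound.
Context {R : realType}.
Local Notation mu := (@lebesgue_measure R).
Local Notation cRe := (@complex.Re R).
Local Notation cIm := (@complex.Im R).
Implicit Types (a b h k : R -> R) (F G H g r : R -> R[i]) (s : R).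
Local Notation c0 := ((Num.sqrt (2 * pi))^-1 : R).

Lemma csqintg_truncated_transform s n g : sgn_one s -> csqintg g ->
  csqintg (truncated_transform s n g).
Proof.
move=> hs cg; have [sa sb] := cg.
have sc h : sqintg h -> sqintg (ktransform cos (trunc n h)) by exact: (sqintg_ktransform_trunc bessel_kernel_cos).
have ss h : sqintg h -> sqintg (ktransform sin (trunc n h)) by exact: (sqintg_ktransform_trunc bessel_kernel_sin).
rewrite (funext (fun x => truncated_transformE n x hs cg)).
split.
  by apply: sqintgZ; apply: sqintgB; [exact: sc|apply: sqintgZ; exact: ss].
by apply: sqintgZ; apply: sqintgD; [apply: sqintgZ; exact: ss|exact: sc].
Qed.

(** The limit of [truncated_transformE]. The coefficients are laid out as linear combinations so
    that [is_ktransform_lin] can be applied to the result. *)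
Lemma explicit_transform s g Ca Sa Cb Sb : sgn_one s -> csqintg g ->
  is_ktransform cos (cRe \o g) Ca -> is_ktransform sin (cRe \o g) Sa ->
  is_ktransform cos (cIm \o g) Cb -> is_ktransform sin (cIm \o g) Sb ->
  is_L2_transform s g (fun x => (c0 * Ca x + (- c0 * s) * Sb x) +i*
     (c0 * s * Sa x + c0 * Cb x)).
Proof.
move=> hs cg hCa hSa hCb hSb; have [sa sb] := cg.
set G := fun x => _.
have cG : csqintg G.
  split; apply: sqintgD; apply: sqintgZ.
  by case: hCa. by case: hSb. by case: hSa. by case: hCb.
split; first exact/in_L2P.
apply/L2norm_cvg0 => [n|]; first by apply: csqintgB => //; exact: csqintg_truncated_transform.
have [sCa cCa] := hCa; have [sSa cSa] := hSa.
have [sCb cCb] := hCb; have [sSb cSb] := hSb.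
have tc h (sh : sqintg h) n := sqintg_ktransform_trunc bessel_kernel_cos n sh.
have ts h (sh : sqintg h) n := sqintg_ktransform_trunc bessel_kernel_sin n sh.
have := cvge0D
  (cvg_sqnorm_lin c0 (- c0 * s) (tc _ sa) (ts _ sb) sCa sSb cCa cSb)
  (cvg_sqnorm_lin (c0 * s) c0 (ts _ sa) (tc _ sb) sSa sCb cSa cCb).
apply: cvg_trans; apply: near_eq_cvg; apply: nearW => n /=.
rewrite csqnormBE; congr (_ + _)%E; congr sqnorm; apply/funext => x;
  by rewrite truncated_transformE// /G/=; ring.
Qed.

Lemma transform_exists s g : sgn_one s -> csqintg g -> exists G, is_L2_transform s g G.
Proof.
move=> hs cg; have [sa sb] := cg.
have [Ca hCa] := is_ktransform_exists bessel_kernel_cos sa.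
have [Sa hSa] := is_ktransform_exists bessel_kernel_sin sa.
have [Cb hCb] := is_ktransform_exists bessel_kernel_cos sb.
have [Sb hSb] := is_ktransform_exists bessel_kernel_sin sb.
by eexists; exact: (explicit_transform hs cg hCa hSa hCb hSb).
Qed.

Lemma truncated_transformB s n g (g' : R -> R[i]) x : sgn_one s -> csqintg g -> csqintg g' ->
  truncated_transform s n (fun x => g x - g' x) x =
  truncated_transform s n g x - truncated_transform s n g' x.
Proof.
move=> hs cg ch; rewrite !truncated_transformE//; last exact: csqintgB.
have [g1 g2] := cg; have [h1 h2] := ch.
have kB k u v : bessel_kernel k -> sqintg u -> sqintg v ->
    ktransform k (trunc n (fun x => u x - v x)) x = ktransform k (trunc n u) x - ktransform k (trunc n v) x.
  move=> [mk k1 _] su sv.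
  rewrite -(ktransformB mk k1 x (integrable_trunc n su) (integrable_trunc n sv)).
  by congr ktransform; apply/funext => t; rewrite /trunc mulrBl.
rewrite (_ : cRe \o _ = (fun x => (cRe \o g) x - (cRe \o g') x)); last first.
  by apply/funext => t; exact: ReB.
rewrite (_ : cIm \o _ = (fun x => (cIm \o g) x - (cIm \o g') x)); last first.
  by apply/funext => t; exact: ImB.
rewrite !(kB cos)// ?(kB sin)//; try exact: bessel_kernel_cos; try exact: bessel_kernel_sin.
by apply/eqP; rewrite eq_complex/=; apply/andP; split; apply/eqP; ring.
Qed.

(** In each component [c0 ^+ 2 = 1 / (2 pi)] cancels the Bessel constant and the sum of two terms
    costs [2]; the two components together give [4]. *)
Lemma csqnorm_truncated_transform s n g : sgn_one s -> csqintg g ->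
  (csqnorm (truncated_transform s n g) <= 4%:E * csqnorm g)%E.
Proof.
move=> hs cg; have [sa sb] := cg.
have s2 : s ^+ 2 = 1 by case: hs => ->; rewrite ?sqrrN expr1n.
have tc h (sh : sqintg h) := sqintg_ktransform_trunc bessel_kernel_cos n sh.
have ts h (sh : sqintg h) := sqintg_ktransform_trunc bessel_kernel_sin n sh.
have qc h (sh : sqintg h) := sqnorm_ktransform_trunc_le bessel_kernel_cos n sh.
have qs h (sh : sqintg h) := sqnorm_ktransform_trunc_le bessel_kernel_sin n sh.
have key (u v : R -> R) (A B : \bar R) : sqintg u -> sqintg v -> (0 <= A)%E -> (0 <= B)%E ->
    (sqnorm u <= (2 * pi)%:E * A)%E -> (sqnorm v <= (2 * pi)%:E * B)%E ->
    (sqnorm (fun x => c0 * (u x + v x))%R <= 2%:E * (A + B))%E.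
  move=> su sv A0 B0 uA vB.
  have [mu' _] := su; have [mv _] := sv.
  rewrite sqnormZ; last exact: measurable_funD.
  rewrite c0_sqr.
  apply: (@le_trans _ _ (((2 * pi)^-1)%:E * (2%:E * ((2 * pi)%:E * (A + B))))%E).
    apply: lee_wpmul2l; first by rewrite lee_fin invr_ge0 mulr_ge0// pi_ge0.
    apply: le_trans (sqnormD mu' mv) _.
    rewrite -ge0_muleDr ?sqnorm_ge0//; apply: lee_wpmul2l => //.
    by rewrite ge0_muleDr//; exact: leeD.
  rewrite !muleA -!EFinM.
  rewrite (_ : (2 * pi)^-1 * 2 * (2 * pi) = 2)//.
  by rewrite mulrAC mulVf ?mul1r// mulf_neq0// gt_eqF// pi_gt0.
have -> : (4%:E * csqnorm g = 2%:E * (sqnorm (cRe \o g) + sqnorm (cIm \o g)) +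
    2%:E * (sqnorm (cRe \o g) + sqnorm (cIm \o g)))%E.
  by rewrite -ge0_muleDl// -EFinD; congr (_%:E * _)%E; ring.
have sS (u : R -> R) : sqintg u -> sqnorm (fun x => s * u x) = sqnorm u.
  by move=> [mu' _]; rewrite sqnormZ// s2 mul1e.
rewrite /csqnorm; apply: leeD.
  rewrite (_ : cRe \o _ = (fun x => c0 * (ktransform cos (trunc n (cRe \o g)) x +
    (- (s * ktransform sin (trunc n (cIm \o g)) x))))); last first.
    by apply/funext => x; rewrite /comp truncated_transformE.
  apply: key; rewrite ?sqnorm_ge0//.
  - exact: tc.
  - by apply: sqintgN; apply: sqintgZ; exact: ts.
  - exact: qc.
  - by rewrite sqnormN sS; [exact: qs|exact: ts].
rewrite (_ : cIm \o _ = (fun x => c0 * (s * ktransform sin (trunc n (cRe \o g)) x +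
    ktransform cos (trunc n (cIm \o g)) x))); last first.
  by apply/funext => x; rewrite /comp truncated_transformE.
apply: key; rewrite ?sqnorm_ge0//.
- by apply: sqintgZ; exact: ts.
- exact: tc.
- by rewrite sS; [exact: qs|exact: ts].
- exact: qc.
Qed.

(** Compare [G] and [G'] through the truncated transforms of [g] and [g'] at a common index; [16] is
    [2 * 2 * 4]. With [g = g'] this says that the transform is unique almost everywhere. *)
Lemma transform_close s g G g' G' : sgn_one s -> csqintg g -> csqintg g' ->
  is_L2_transform s g G -> is_L2_transform s g' G' ->
  (csqnorm (fun x => G x - G' x)%R <= 16%:E * csqnorm (fun x => g x - g' x)%R)%E.
Proof.
move=> hs cg cg' [/in_L2P cG GG] [/in_L2P cG' GG'].
have ct n := csqintg_truncated_transform n hs cg.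
have ct' n := csqintg_truncated_transform n hs cg'.
have H1 := (L2norm_cvg0 (fun n => csqintgB (ct n) cG)).1 GG.
have H2 := (L2norm_cvg0 (fun n => csqintgB (ct' n) cG')).1 GG'.
apply/lee_addgt0Pr => e e0.
(* The nested triangle inequalities count the two limit errors [2] and [4] times. *)
have e6 : 0 < e / 6 by rewrite divr_gt0.
have [N1 N1P] := (cvge0_leP (fun n => csqnorm_ge0 _)).1 H1 (e / 6) e6.
have [N2 N2P] := (cvge0_leP (fun n => csqnorm_ge0 _)).1 H2 (e / 6) e6.
pose n := maxn N1 N2.
have A1 := N1P n (leq_maxl _ _); have A2 := N2P n (leq_maxr _ _).
apply: le_trans (csqnorm_triangle cG (ct n) cG') _.
rewrite [X in (_ * X + _)%E]csqnormBC.
apply: (@le_trans _ _ (2%:E * (e / 6)%:E + 2%:E * (2%:E * (4%:E * csqnorm (fun x => g x - g' x)%R) + 2%:E * (e / 6)%:E))%E).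
  apply: leeD; first exact: lee_wpmul2l.
  apply: lee_wpmul2l => //; apply: le_trans (csqnorm_triangle (ct n) (ct' n) cG') _.
  apply: leeD; apply: lee_wpmul2l => //.
  rewrite (_ : (fun x => _ - _) = truncated_transform s n (fun x => g x - g' x)).
    exact: csqnorm_truncated_transform (csqintgB cg cg').
  by apply/funext => x; rewrite truncated_transformB.
rewrite ge0_muleDr ?mule_ge0 ?csqnorm_ge0//; last by rewrite lee_fin ltW.
rewrite addeCA !muleA -!EFinM; apply: leeD.
  by rewrite le_eqVlt; apply/orP; left; apply/eqP; congr (_%:E * _)%E; ring.
by rewrite -EFinD lee_fin le_eqVlt; apply/orP; left; apply/eqP; field.
Qed.

Lemma sgn_one1 : sgn_one (1 : R). Proof. by left. Qed.
Lemma sgn_oneN1 : sgn_one (-1 : R). Proof. by right. Qed.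

(** An explicit transform [G0] of [f] has an explicit inverse transform [g0], and inversion gives
    [g0 = f] almost everywhere; [transform_close] then compares [g0] with [r]. The factor is
    [2 * 16 * 2]. *)
Lemma inverse_close f G Phi r : csqintg f -> is_fourier f G -> csqintg Phi ->
  is_inverse_fourier Phi r ->
  (csqnorm (fun x => f x - r x)%R <= 64%:E * csqnorm (fun x => G x - Phi x)%R)%E.
Proof.
move=> cf fG cP Pr; have [sa sb] := cf.
have [/in_L2P cG _] := fG; have [/in_L2P cr _] := Pr.
have bc := bessel_kernel_cos (R := R); have bs := bessel_kernel_sin (R := R).
have [Ca hCa] := is_ktransform_exists bc sa; have [Sa hSa] := is_ktransform_exists bs sa.
have [Cb hCb] := is_ktransform_exists bc sb; have [Sb hSb] := is_ktransform_exists bs sb.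
have [sCa _] := hCa; have [sSa _] := hSa; have [sCb _] := hCb; have [sSb _] := hSb.
have [CCa hCCa] := is_ktransform_exists bc sCa; have [SCa hSCa] := is_ktransform_exists bs sCa.
have [CSa hCSa] := is_ktransform_exists bc sSa; have [SSa hSSa] := is_ktransform_exists bs sSa.
have [CCb hCCb] := is_ktransform_exists bc sCb; have [SCb hSCb] := is_ktransform_exists bs sCb.
have [CSb hCSb] := is_ktransform_exists bc sSb; have [SSb hSSb] := is_ktransform_exists bs sSb.
have FG0 := explicit_transform sgn_oneN1 cf hCa hSa hCb hSb.
set G0 := (fun x => _) in FG0.
have [/in_L2P cG0 _] := FG0.
have IG0 := explicit_transform sgn_one1 cG0
  (is_ktransform_lin c0 (- c0 * -1) bc sCa sSb hCCa hCSb)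
  (is_ktransform_lin c0 (- c0 * -1) bs sCa sSb hSCa hSSb)
  (is_ktransform_lin (c0 * -1) c0 bc sSa sCb hCSa hCCb)
  (is_ktransform_lin (c0 * -1) c0 bs sSa sCb hSSa hSCb).
set g0 := (fun x => _) in IG0.
have [/in_L2P cg0 _] := IG0.
have cc : c0 * c0 * (2 * pi) = 1.
  by rewrite -expr2 c0_sqr mulVf// mulf_neq0// gt_eqF// pi_gt0.
(* In the real part the mixed terms of [cIm \o f] cancel by commutation, in the imaginary part those
   of [cRe \o f]; [cc] normalizes what remains. *)
have fg0 : {ae mu, forall x, f x = g0 x}.
  apply: ae_imply2 (ae_imply2 _ (cos_sin_inversion sa hCa hSa hCCa hSSa) (cos_sin_commute sa hCa hSa hSCa hCSa))
    (ae_imply2 _ (cos_sin_inversion sb hCb hSb hCCb hSSb) (cos_sin_commute sb hCb hSb hSCb hCSb)).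
  2: by move=> x H1 H2; exact: (conj H1 H2).
  2: by move=> x H1 H2; exact: (conj H1 H2).
  move=> x /= [a1 a2] [b1 b2]; rewrite /g0/=.
  apply/eqP; rewrite eq_complex/=; apply/andP; split; apply/eqP.
    transitivity (c0 * c0 * (2 * pi) * cRe (f x)); first by rewrite cc mul1r.
    by rewrite -mulrA -a1 b2; ring.
  transitivity (c0 * c0 * (2 * pi) * cIm (f x)); first by rewrite cc mul1r.
  by rewrite -mulrA -b1 a2; ring.
have cff : csqnorm (fun x => f x - f x) = 0%E.
  by apply: csqnorm_eq_ae => //; apply: aeW.
have GG0 : csqnorm (fun x => G x - G0 x) = 0%E.
  apply/eqP; rewrite eq_le csqnorm_ge0 andbT.
  by have := transform_close sgn_oneN1 cf cf fG FG0; rewrite cff mule0.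
have A := transform_close sgn_one1 cG0 cP IG0 Pr.
have B := csqnorm_triangle cG0 cG cP.
rewrite (csqnormBC G0 G) GG0 mule0 add0e in B.
have := csqnorm_triangle cf cg0 cr; rewrite (csqnorm_eq_ae cf cg0 fg0) mule0 add0e => /le_trans; apply.
apply: (@le_trans _ _ (2%:E * (16%:E * (2%:E * csqnorm (fun x => G x - Phi x)%R)))%E).
  apply: lee_wpmul2l => //; apply: le_trans A _; exact: lee_wpmul2l.
rewrite !muleA -!EFinM le_eqVlt; apply/orP; left; apply/eqP; congr (_%:E * _)%E; ring.
Qed.

End InversionBound.

(** * The ordinary differential equation in x *)

Section FrequencyODE.
Context {R : realType}.
Local Notation cRe := (@complex.Re R).
Local Notation cIm := (@complex.Im R).
Implicit Types (z c : R[i]) (v w : R -> R[i]).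

Definition is_cderive v w : Prop := forall x : R,
  is_derive x 1 (cRe \o v) (cRe (w x)) /\ is_derive x 1 (cIm \o v) (cIm (w x)).

Lemma is_cderive_cderive v : cderivable v -> is_cderive v (cderive v).
Proof.
move=> dv x; have [d1 d2] := dv x.
by split; apply: DeriveDef => //; rewrite -derive1E.
Qed.

Lemma is_cderiveD v w v' w' : is_cderive v v' -> is_cderive w w' ->
  is_cderive (fun x => v x + w x) (fun x => v' x + w' x).
Proof.
move=> dv dw x; have [v1 v2] := dv x; have [w1 w2] := dw x.
have E1 (t u : R[i]) : cRe (t + u) = cRe t + cRe u by case: t u => [? ?] [? ?].
have E2 (t u : R[i]) : cIm (t + u) = cIm t + cIm u by case: t u => [? ?] [? ?].
split.
  rewrite E1 (_ : _ \o _ = (cRe \o v) + (cRe \o w)); first exact: is_deriveD.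
  by apply/funext => t; exact: E1.
rewrite E2 (_ : _ \o _ = (cIm \o v) + (cIm \o w)); first exact: is_deriveD.
by apply/funext => t; exact: E2.
Qed.

Lemma is_cderive_cst c : is_cderive (fun=> c) (fun=> 0).
Proof. by move=> x; split; exact: is_derive_cst. Qed.

Lemma is_cderiveM v w v' w' : is_cderive v v' -> is_cderive w w' ->
  is_cderive (fun x => v x * w x) (fun x => v' x * w x + v x * w' x).
Proof.
move=> dv dw x; have [v1 v2] := dv x; have [w1 w2] := dw x.
have M1 (t u : R[i]) : cRe (t * u) = cRe t * cRe u - cIm t * cIm u.
  by case: t u => [? ?] [? ?].
have M2 (t u : R[i]) : cIm (t * u) = cRe t * cIm u + cIm t * cRe u.
  by case: t u => [? ?] [? ?].
have D1 (t u : R[i]) : cRe (t + u) = cRe t + cRe u by case: t u => [? ?] [? ?].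
have D2 (t u : R[i]) : cIm (t + u) = cIm t + cIm u by case: t u => [? ?] [? ?].
split.
  rewrite (_ : _ \o _ = (cRe \o v) * (cRe \o w) - (cIm \o v) * (cIm \o w)); last first.
    by apply/funext => t; exact: M1.
  apply: (is_derive_eq (is_deriveB (is_deriveM v1 w1) (is_deriveM v2 w2))).
  by rewrite D1 !M1 /GRing.scale/=; ring.
rewrite (_ : _ \o _ = (cRe \o v) * (cIm \o w) + (cIm \o v) * (cRe \o w)); last first.
  by apply/funext => t; exact: M2.
apply: (is_derive_eq (is_deriveD (is_deriveM v1 w2) (is_deriveM v2 w1))).
by rewrite D2 !M2 /GRing.scale/=; ring.
Qed.

Lemma is_cderiveZ c w w' : is_cderive w w' ->
  is_cderive (fun x => c * w x) (fun x => c * w' x).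
Proof.
move=> dw; have := is_cderiveM (is_cderive_cst c) dw.
by under [X in is_cderive _ X]eq_fun do rewrite mul0r add0r.
Qed.

Lemma is_cderive_cexp (a : R[i]) :
  is_cderive (fun x => cexp (a * x%:C)) (fun x => a * cexp (a * x%:C)).
Proof.
case: a => p q x.
have dE : is_derive x 1 (fun x : R => expR (p * x)) (expR (p * x) * p).
  by apply: is_derive1_comp; exact: is_derive_mull.
have dS : is_derive x 1 (fun x : R => sin (q * x)) (cos (q * x) * q).
  by apply: is_derive1_comp; exact: is_derive_mull.
have dC : is_derive x 1 (fun x : R => cos (q * x)) (- sin (q * x) * q).
  by apply: is_derive1_comp; exact: is_derive_mull.
have Re_ (t : R) : cRe ((p +i* q) * t%:C) = p * t by rewrite /=; ring.
have Im_ (t : R) : cIm ((p +i* q) * t%:C) = q * t by rewrite /=; ring.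
split.
  rewrite (_ : _ \o _ = (fun x : R => expR (p * x)) * (fun x : R => cos (q * x))); last first.
    by apply/funext => t; rewrite /comp /cexp Re_ Im_.
  apply: (is_derive_eq (is_deriveM dE dC)).
  by rewrite /cexp Re_ Im_ /GRing.scale/=; ring.
rewrite (_ : _ \o _ = (fun x : R => expR (p * x)) * (fun x : R => sin (q * x))); last first.
  by apply/funext => t; rewrite /comp /cexp Re_ Im_.
apply: (is_derive_eq (is_deriveM dE dS)).
by rewrite /cexp Re_ Im_ /GRing.scale/=; ring.
Qed.

Lemma is_cderive0_cst v x : is_cderive v (fun=> 0) -> v x = v 0.
Proof.
move=> dv; apply/eqP; rewrite eq_complex; apply/andP; split; apply/eqP.
  by apply: (@is_derive_0_is_cst _ (cRe \o v)) => t; case: (dv t).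
by apply: (@is_derive_0_is_cst _ (cIm \o v)) => t; case: (dv t).
Qed.

Lemma cexpD z c : cexp (z + c) = cexp z * cexp c.
Proof.
case: z c => [a b] [p q]; rewrite /cexp/= expRD cosD sinD.
by apply/eqP; rewrite eq_complex/=; apply/andP; split; apply/eqP; ring.
Qed.

Lemma cexp0 : cexp (0 : R[i]) = 1.
Proof. by rewrite /cexp/= expR0 cos0 sin0 mul1r mulr0. Qed.

Lemma cabs_cexp z : cabs (cexp z) = expR (cRe z).
Proof.
rewrite /cabs /cexp/= !exprMn -mulrDr cos2Dsin2 mulr1 sqrtr_sqr.
by rewrite ger0_norm// expR_ge0.
Qed.

Lemma cabsM z c : cabs (z * c) = cabs z * cabs c.
Proof. exact: ComplexField.Normc.normcM. Qed.

Lemma cabsD z c : cabs (z + c) <= cabs z + cabs c.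
Proof. exact: le_normcD. Qed.

Lemma cabs_ge0 z : 0 <= cabs z.
Proof. by case: z => a b; exact: sqrtr_ge0. Qed.

(** Multiplying by the integrating factor [exp (- a x)] gives a function of zero derivative. *)
Lemma first_order_ode (a : R[i]) v : is_cderive v (fun x => a * v x) ->
  forall x, v x = v 0 * cexp (a * x%:C).
Proof.
move=> dv x.
have d0 : is_cderive (fun x => v x * cexp (- a * x%:C)) (fun=> 0).
  rewrite (_ : (fun=> 0) = (fun x => a * v x * cexp (- a * x%:C) +
      v x * (- a * cexp (- a * x%:C)))).
    exact: is_cderiveM dv (is_cderive_cexp (- a)).
  by apply/funext => t; ring.
have := is_cderive0_cst x d0; rewrite mulr0 cexp0 mulr1 => <-.
by rewrite -mulrA -cexpD mulNr addNr cexp0 mulr1.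
Qed.

End FrequencyODE.

(** * Characteristic roots and the bounded solution at a fixed frequency *)

Section FrequencySolution.
Context {R : realType}.
Local Notation cRe := (@complex.Re R).
Local Notation cIm := (@complex.Im R).
Implicit Types (z c : R[i]) (v w : R -> R[i]).
Variables (alpha beta nu x0 : R).
Hypotheses (halpha : 0 < alpha ^+ 2) (hnu : 0 < nu) (hbeta : 0 <= beta) (hx0 : 0 < x0).

Definition disc_root (xi : R) : R[i] :=
  sqrtc ((beta ^+ 2)%:C + (4 * alpha ^+ 2)%:C * (nu +i* xi)).

(** Minus the decaying root at frequency [0], which is the slowest decay over all frequencies. *)
Definition decay_rate : R :=
  (Num.sqrt (beta ^+ 2 + 4 * alpha ^+ 2 * nu) - beta) / (2 * alpha ^+ 2).

Definition neg_root (xi : R) : R[i] :=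
  (beta%:C - disc_root xi) / (2 * alpha ^+ 2)%:C.

Definition pos_root (xi : R) : R[i] :=
  (beta%:C + disc_root xi) / (2 * alpha ^+ 2)%:C.

Lemma Re_divr (a : R[i]) (t : R) : cRe (a / t%:C) = cRe a / t.
Proof.
rewrite -fmorphV; case: a => p q /=.
by rewrite mulr0 subr0.
Qed.

(** The real part of the principal root of [P + i Q] is the square root of [(|P + i Q| + P) / 2], at
    least that of [P]; and [P] does not depend on [xi]. *)
Lemma Re_disc_root_ge xi :
  Num.sqrt (beta ^+ 2 + 4 * alpha ^+ 2 * nu) <= cRe (disc_root xi).
Proof.
rewrite /disc_root /sqrtc /=; set P := _ + (_ - _ * _); set Q := 0 + _.
have -> : beta ^+ 2 + 4 * alpha ^+ 2 * nu = P by rewrite /P; ring.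
have P0 : 0 <= P.
  by rewrite /P mul0r subr0 addr_ge0 ?sqr_ge0// ltW// mulr_gt0// mulr_gt0.
apply: ler_wsqrtr; rewrite ler_pdivlMr// mulr_natr mulr2n lerD2r.
by rewrite -{1}(ger0_norm P0) -sqrtr_sqr ler_wsqrtr// lerDl sqr_ge0.
Qed.

Lemma sqrt_disc_gt : beta < Num.sqrt (beta ^+ 2 + 4 * alpha ^+ 2 * nu).
Proof.
rewrite -{1}(ger0_norm hbeta) -sqrtr_sqr ltr_sqrt.
  by rewrite ltrDl mulr_gt0// mulr_gt0.
by rewrite ltr_wpDl ?sqr_ge0// mulr_gt0// mulr_gt0.
Qed.

Lemma decay_rate_gt0 : 0 < decay_rate.
Proof. by rewrite divr_gt0 ?subr_gt0 ?sqrt_disc_gt// mulr_gt0. Qed.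

Lemma Re_neg_root_le xi : cRe (neg_root xi) <= - decay_rate.
Proof.
rewrite Re_divr /decay_rate -mulNr opprB ler_pM2r; last by rewrite invr_gt0 mulr_gt0.
have := Re_disc_root_ge xi; case: (disc_root xi) => a b /=; lra.
Qed.

Lemma Re_pos_root_gt0 xi : 0 < cRe (pos_root xi).
Proof.
rewrite Re_divr divr_gt0//; last by rewrite mulr_gt0.
have := Re_disc_root_ge xi; have := sqrt_disc_gt; have := hbeta.
case: (disc_root xi) => a b /=; lra.
Qed.

Definition denom (xi : R) : R[i] := 1 - cexp (neg_root xi * x0%:C).

Lemma Re_mulr (a : R[i]) (t : R) : cRe (a * t%:C) = cRe a * t.
Proof. by case: a => p q /=; rewrite mulr0 subr0. Qed.

(** Reverse triangle inequality: the subtracted exponential has modulus at most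
    [expR (- (decay_rate * x0))], at every frequency. *)
Lemma denom_ge xi : 1 - expR (- (decay_rate * x0)) <= cabs (denom xi).
Proof.
have E1 : cabs (cexp (neg_root xi * x0%:C)) <= expR (- (decay_rate * x0)).
  rewrite cabs_cexp ler_expR Re_mulr -mulNr ler_pM2r//; exact: Re_neg_root_le.
have := cabsD (denom xi) (cexp (neg_root xi * x0%:C)).
rewrite /denom subrK [cabs 1]ComplexField.Normc.normc1; lra.
Qed.

Definition denom_bound : R := 1 - expR (- (decay_rate * x0)).

Lemma denom_bound_gt0 : 0 < denom_bound.
Proof. by rewrite subr_gt0 -expR0 ltr_expR oppr_lt0 mulr_gt0// decay_rate_gt0. Qed.

Lemma denom_neq0 xi : denom xi != 0.
Proof.
apply/eqP => d0; have := denom_ge xi; rewrite d0 [cabs 0]ComplexField.Normc.normc0.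
by rewrite leNgt denom_bound_gt0.
Qed.

Lemma LambdaE xi : Lambda alpha beta nu x0 xi = (nu +i* xi) / denom xi.
Proof. by []. Qed.

Lemma exp_growth_bounded0 (A D rho M : R) : 0 <= A -> 0 < rho ->
  (forall x, M < x -> A * expR (rho * x) <= D) -> A = 0.
Proof.
move=> A0 r0 H; apply/eqP; rewrite eq_le A0 andbT leNgt; apply/negP => Ap.
(* Already the linear lower bound [1 + rho * x] of the exponential, multiplied by [A], exceeds [|D|]
   at this point. *)
pose x := `|M| + 1 + `|D| / (A * rho).
have q0 : 0 <= `|D| / (A * rho) by rewrite divr_ge0// mulr_ge0// ltW.
have Mx : M < x by have := ler_norm M; rewrite /x; lra.
have := H x Mx; apply/negP; rewrite -ltNge.
apply: (@lt_le_trans _ _ (A * (1 + rho * x))); last by rewrite ler_pM2l// expR_ge1Dx.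
apply: (@le_lt_trans _ _ `|D|); first exact: ler_norm.
have -> : A * (1 + rho * x) = A * (1 + rho * (`|M| + 1)) + `|D|.
  by rewrite /x; field; rewrite !gt_eqF.
have p0 : 0 <= rho * (`|M| + 1) by rewrite mulr_ge0 ?addr_ge0// ltW.
by rewrite ltrDr mulr_gt0// ltr_wpDr.
Qed.

(* With [r+] and [r-] the roots of [alpha^2 r^2 = beta r + z], the function
   [h = w - F / z] satisfies [h' - r- h = A exp (r+ x)] and
   [h' - r+ h = B exp (r- x)]; boundedness of [w] forces [A = 0]. *)
Lemma frequency_solution (xi : R) (F Y : R[i]) w :
  cderivable w -> cderivable (cderive w) ->
  (forall x : R, - (alpha ^+ 2)%:C * cderive (cderive w) x + beta%:C * cderive w x
     + (nu +i* xi) * w x = F) ->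
  w 0 = 0 -> w x0 = Y ->
  (exists M l : R, cabs (w x) @[x --> +oo] --> l /\ l < M) ->
  F = Lambda alpha beta nu x0 xi * Y.
Proof.
move=> dw dw' ode w0 wx0 [M [l [wl _]]].
set z := nu +i* xi in ode *.
have z0 : z != 0 by rewrite /z eq_complex/= negb_and gt_eqF.
have a0 : (alpha ^+ 2)%:C != 0 :> R[i] by rewrite fmorph_eq0 gt_eqF.
set S := disc_root xi; set rm := neg_root xi; set rp := pos_root xi.
have S2 : S ^+ 2 = (beta ^+ 2)%:C + (4 * alpha ^+ 2)%:C * z by exact: sqr_sqrtc.
have S0 : S != 0.
  apply/eqP => S0; have := Re_disc_root_ge xi; rewrite -/S S0 /=.
  by have := sqrt_disc_gt; have := hbeta; lra.
have n2 : (2 * alpha ^+ 2)%:C != 0 :> R[i] by rewrite fmorph_eq0 mulf_neq0// gt_eqF.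
have two0 : (2 : R[i]) != 0 by rewrite pnatr_eq0.
have cb2 : (beta ^+ 2)%:C = beta%:C ^+ 2 by rewrite rmorphXn.
have c4 : (4 * alpha ^+ 2)%:C = 4 * (alpha ^+ 2)%:C by rewrite rmorphM/= rmorph_nat.
have c2 : (2 * alpha ^+ 2)%:C = 2 * (alpha ^+ 2)%:C by rewrite rmorphM/= rmorph_nat.
rewrite cb2 c4 in S2.
(* Opaque names for the embedded reals give [ring] and [field] plain atoms. *)
have [a2 a2E] : {a2 : R[i] | (alpha ^+ 2)%:C = a2} by exists (alpha ^+ 2)%:C.
have [b bE] : {b : R[i] | beta%:C = b} by exists beta%:C.
rewrite a2E bE in S2 ode; rewrite a2E in a0 c2.
pose h x := w x - F / z.
have dh : is_cderive h (cderive w).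
  have := is_cderiveD (is_cderive_cderive dw) (is_cderive_cst (- (F / z))).
  by rewrite (_ : (fun x => _ + 0) = cderive w)//; apply/funext => x; rewrite addr0.
have dh' := is_cderive_cderive dw'.
(* Vieta: the roots have sum [beta / alpha^2] and product [- z / alpha^2]. *)
have hode x : cderive (cderive w) x = (rp + rm) * cderive w x - rp * rm * h x.
  have E : a2 * cderive (cderive w) x = b * cderive w x + z * h x.
    rewrite /h mulrBr mulrCA divff// mulr1 -(ode x); ring.
  apply: (mulfI a0); rewrite E /rp /rm /pos_root /neg_root -/S c2 bE.
  have -> : z = (S ^+ 2 - b ^+ 2) / (4 * a2).
    by rewrite S2; field; rewrite a0.
  by field; rewrite a0.
(* The second-order operator factors; each order of the factors leaves a first-order equation for
   [h' - r h]. *)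
have sub r r' : rp + rm = r + r' -> rp * rm = r * r' ->
    forall x, cderive w x - r * h x = (cderive w 0 - r * h 0) * cexp (r' * x%:C).
  move=> rs rr; apply: (first_order_ode (v := fun x => cderive w x - r * h x)).
  have := is_cderiveD dh' (is_cderiveZ (- r) dh).
  rewrite (_ : (fun x => cderive w x + _) = (fun x => cderive w x - r * h x)); last first.
    by apply/funext => x; rewrite mulNr.
  rewrite (_ : (fun x => cderive (cderive w) x + _) =
    (fun x => r' * (cderive w x - r * h x)))//.
  by apply/funext => x; rewrite hode rs rr; ring.
have G := sub rm rp (addrC _ _) (mulrC _ _).
have Q := sub rp rm erefl erefl.
pose A := cderive w 0 - rm * h 0; pose B := cderive w 0 - rp * h 0.
have rd0 : rp - rm != 0.
  rewrite (_ : rp - rm = S / a2).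
    by rewrite mulf_neq0// invr_eq0.
  by rewrite /rp /rm /pos_root /neg_root -/S c2 bE; field; rewrite a0.
have hE x : (rp - rm) * h x = A * cexp (rp * x%:C) - B * cexp (rm * x%:C).
  by rewrite /A /B -G -Q; ring.
have [M1 [_ M1P']] := (cvgrPdist_le _ _).1 wl 1 ltr01.
have M1P x : M1 < x -> cabs (w x) <= `|l| + 1.
  move=> /M1P'; have := ler_norm (- l); have := ler_norm l; rewrite normrN.
  by rewrite ler_norml => ? ? /andP[]; lra.
have cA : cabs A = 0.
  (* The threshold includes [0] because the decaying exponential is at most [1] only for nonnegative
     [x]. *)
  apply: (@exp_growth_bounded0 _ (cabs (rp - rm) * (`|l| + 1 + cabs (- (F / z))) + cabs B)
    (cRe rp) (Num.max M1 0)).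
  - exact: cabs_ge0.
  - exact: Re_pos_root_gt0.
  - move=> x; rewrite gt_max => /andP[M1x x00].
    have -> : cabs A * expR (cRe rp * x) = cabs (A * cexp (rp * x%:C)).
      by rewrite cabsM cabs_cexp Re_mulr.
    have -> : A * cexp (rp * x%:C) = (rp - rm) * h x + B * cexp (rm * x%:C).
      by rewrite hE subrK.
    apply: le_trans (cabsD _ _) _; apply: lerD.
      rewrite cabsM ler_wpM2l ?cabs_ge0//.
      by apply: le_trans (cabsD _ _) _; rewrite lerD2r; exact: M1P.
    rewrite cabsM cabs_cexp Re_mulr ler_piMr ?cabs_ge0//.
    rewrite -expR0 ler_expR; have := Re_neg_root_le xi; have := decay_rate_gt0.
    rewrite -/rm; nra.
have A0 : A = 0 by exact: ComplexField.Normc.eq0_normc cA.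
have hB x : (rp - rm) * h x = - B * cexp (rm * x%:C).
  by rewrite hE A0 mul0r add0r mulNr.
have hx x : h x = h 0 * cexp (rm * x%:C).
  apply: (mulfI rd0); rewrite hB mulrA hB mulr0 cexp0 mulr1.
  by [].
have h0 : h 0 = - (F / z) by rewrite /h w0 sub0r.
have : Y = F / z * denom xi.
  rewrite -wx0 -[w x0](subrK (F / z)) -/(h x0) hx h0 /denom -/rm; ring.
move=> ->; rewrite LambdaE -/z.
by field; rewrite denom_neq0 z0.
Qed.

End FrequencySolution.

(** * Stability estimate *)

Section Stability.
Context {R : realType}.
Local Notation mu := (@lebesgue_measure R).
Local Notation cRe := (@complex.Re R).
Local Notation cIm := (@complex.Im R).
Implicit Types (F G H : R -> R[i]).

Definition cmeasurable F : Prop :=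
  measurable_fun setT (cRe \o F) /\ measurable_fun setT (cIm \o F).

Lemma csqintg_cmeasurable F : csqintg F -> cmeasurable F.
Proof. by move=> [[m1 _] [m2 _]]. Qed.

Lemma cmeasurable_cst (c : R[i]) : cmeasurable (fun=> c).
Proof. by split; exact: measurable_cst. Qed.

Lemma cmeasurableD F G : cmeasurable F -> cmeasurable G ->
  cmeasurable (fun x => F x + G x).
Proof.
move=> [f1 f2] [g1 g2]; split.
  rewrite (_ : _ \o _ = (cRe \o F) \+ (cRe \o G)); first exact: measurable_funD.
  by apply/funext => x /=; case: (F x) (G x) => [? ?] [? ?].
rewrite (_ : _ \o _ = (cIm \o F) \+ (cIm \o G)); first exact: measurable_funD.
by apply/funext => x /=; case: (F x) (G x) => [? ?] [? ?].
Qed.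

Lemma cmeasurableN F : cmeasurable F -> cmeasurable (fun x => - F x).
Proof.
move=> [f1 f2]; split.
  rewrite (_ : _ \o _ = -%R \o (cRe \o F)); first exact: measurableT_comp.
  by apply/funext => x /=; case: (F x).
rewrite (_ : _ \o _ = -%R \o (cIm \o F)); first exact: measurableT_comp.
by apply/funext => x /=; case: (F x).
Qed.

Lemma cmeasurableM F G : cmeasurable F -> cmeasurable G ->
  cmeasurable (fun x => F x * G x).
Proof.
move=> [f1 f2] [g1 g2]; split.
  rewrite (_ : _ \o _ = ((cRe \o F) \* (cRe \o G)) \- ((cIm \o F) \* (cIm \o G))).
    by apply: measurable_funB; exact: measurable_funM.
  by apply/funext => x /=; case: (F x) (G x) => [? ?] [? ?].
rewrite (_ : _ \o _ = ((cRe \o F) \* (cIm \o G)) \+ ((cIm \o F) \* (cRe \o G))).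
  by apply: measurable_funD; exact: measurable_funM.
by apply/funext => x /=; case: (F x) (G x) => [? ?] [? ?].
Qed.

(** Inversion is written as the power [-1], which agrees with it on nonnegative reals, [0]
    included. *)
Lemma measurable_inv (h : R -> R) : measurable_fun setT h -> (forall x, 0 <= h x) ->
  measurable_fun setT (fun x => (h x)^-1).
Proof.
move=> mh h0; under eq_fun do rewrite -powR_inv1//.
exact: (measurableT_comp (measurable_powR _) mh).
Qed.

Lemma cmeasurableV F : cmeasurable F -> cmeasurable (fun x => (F x)^-1).
Proof.
move=> [f1 f2].
have mn : measurable_fun setT (fun x => ((cRe \o F) x ^+ 2 + (cIm \o F) x ^+ 2)^-1).
  apply: measurable_inv => [|x]; last by rewrite addr_ge0 ?sqr_ge0.
  by apply: measurable_funD; exact: measurable_funX.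
split.
  rewrite (_ : _ \o _ = (cRe \o F) \* (fun x => ((cRe \o F) x ^+ 2 + (cIm \o F) x ^+ 2)^-1)).
    exact: measurable_funM.
  by apply/funext => x /=; case: (F x).
rewrite (_ : _ \o _ = -%R \o ((cIm \o F) \* (fun x => ((cRe \o F) x ^+ 2 + (cIm \o F) x ^+ 2)^-1))).
  by apply: measurableT_comp => //; exact: measurable_funM.
by apply/funext => x /=; case: (F x) => ? ? /=.
Qed.

Lemma cmeasurable_real (h : R -> R) : measurable_fun setT h ->
  cmeasurable (fun x => (h x)%:C).
Proof. by move=> mh; split => //; exact: measurable_cst. Qed.

Lemma cmeasurable_cexp F : cmeasurable F -> cmeasurable (fun x => cexp (F x)).
Proof.
move=> [f1 f2]; split.
  apply: (measurable_funM (f := fun x => expR (cRe (F x))) (g := fun x => cos (cIm (F x)))).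
    exact: measurableT_comp.
  exact: (measurableT_comp measurable_cos).
apply: (measurable_funM (f := fun x => expR (cRe (F x))) (g := fun x => sin (cIm (F x)))).
  exact: measurableT_comp.
exact: (measurableT_comp measurable_sin).
Qed.

Lemma measurable_sqrt (h : R -> R) : measurable_fun setT h ->
  measurable_fun setT (fun x => Num.sqrt (h x)).
Proof.
move=> mh; apply: measurableT_comp => //.
exact: continuous_measurable_fun (@sqrt_continuous R).
Qed.

Lemma cmeasurable_sqrtc F : cmeasurable F -> cmeasurable (fun x => sqrtc (F x)).
Proof.
move=> [f1 f2].
pose a := cRe \o F; pose b := cIm \o F.
have mr : measurable_fun setT (fun x => Num.sqrt (a x ^+ 2 + b x ^+ 2)).
  by apply: measurable_sqrt; apply: measurable_funD; exact: measurable_funX.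
split.
  rewrite (_ : _ \o _ = (fun x => Num.sqrt ((Num.sqrt (a x ^+ 2 + b x ^+ 2) + a x) / 2))).
    apply: measurable_sqrt; apply: measurable_funM => //; exact: measurable_funD.
  by apply/funext => x; rewrite /a /b /=; case: (F x).
(* The sign of the imaginary part, taken to be [1] at [0], is expressed by an indicator to make it
   visibly measurable. *)
rewrite (_ : _ \o _ = (fun x => (1 - 2 * \1_(`]-oo, 0[) (b x)) *
  Num.sqrt ((Num.sqrt (a x ^+ 2 + b x ^+ 2) - a x) / 2))).
  apply: measurable_funM.
    apply: measurable_funB => //; apply: measurable_funM => //.
    apply: (measurableT_comp _ f2); apply: measurable_indic; exact: measurable_itv.
  by apply: measurable_sqrt; apply: measurable_funM => //; exact: measurable_funB.
apply/funext => x; rewrite /a /b /=; case: (F x) => p q /=; congr (_ * _).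
rewrite indicE; have [q0|q0|->] := ltgtP q 0.
- rewrite ltr0_sg// mem_set; last by rewrite /= in_itv.
  by rewrite mulr1; ring.
- rewrite gtr0_sg// memNset ?mulr0 ?subr0//= in_itv/=.
  by apply/negP; rewrite -leNgt ltW.
- rewrite memNset ?mulr0 ?subr0//= in_itv/=.
  by rewrite ltxx.
Qed.

Lemma cmeasurable_Lambda (alpha beta nu x0 : R) : cmeasurable (Lambda alpha beta nu x0).
Proof.
have mz : cmeasurable (fun xi : R => nu +i* xi).
  by split; [exact: measurable_cst|exact: measurable_id].
apply: cmeasurableM => //; apply: cmeasurableV; apply: cmeasurableD.
  exact: cmeasurable_cst.
apply: cmeasurableN; apply: cmeasurable_cexp; apply: cmeasurableM; last exact: cmeasurable_cst.
apply: cmeasurableM; last exact: cmeasurable_cst.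
apply: cmeasurableD; first exact: cmeasurable_cst.
apply: cmeasurableN; apply: cmeasurable_sqrtc; apply: cmeasurableD; first exact: cmeasurable_cst.
by apply: cmeasurableM => //; exact: cmeasurable_cst.
Qed.

Lemma sqr_cabs (z : R[i]) : cabs z ^+ 2 = cRe z ^+ 2 + cIm z ^+ 2.
Proof. by rewrite /cabs; case: z => p q /=; rewrite sqr_sqrtr// addr_ge0 ?sqr_ge0. Qed.

Lemma sqr_cabs_real (t : R) : cabs t%:C ^+ 2 = t ^+ 2.
Proof. by rewrite sqr_cabs /= expr0n addr0. Qed.

Lemma measurable_sqr_cabs F : cmeasurable F ->
  measurable_fun setT (fun x => cabs (F x) ^+ 2).
Proof.
move=> [f1 f2]; under eq_fun do rewrite sqr_cabs.
by apply: measurable_funD; exact: measurable_funX.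
Qed.

Lemma csqnormE F : cmeasurable F -> csqnorm F = (\int[mu]_x (cabs (F x) ^+ 2)%:E)%E.
Proof.
move=> [f1 f2]; rewrite /csqnorm /sqnorm -ge0_integralD//.
- by apply: eq_integral => x _; rewrite -EFinD sqr_cabs.
- by move=> x _; rewrite lee_fin sqr_ge0.
- exact: measurable_sqr.
- by move=> x _; rewrite lee_fin sqr_ge0.
- exact: measurable_sqr.
Qed.

Lemma csqnorm_le F (g : R -> R) (K : R) : cmeasurable F -> measurable_fun setT g ->
  (forall x, 0 <= g x) -> 0 <= K ->
  {ae mu, forall x, cabs (F x) ^+ 2 <= K * g x} ->
  (csqnorm F <= K%:E * \int[mu]_x (g x)%:E)%E.
Proof.
move=> mF mg g0 K0 FG; rewrite csqnormE//.
rewrite -ge0_integralZl//; [|exact/measurable_EFinP|by move=> x _; rewrite lee_fin].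
apply: ae_ge0_le_integral => //.
- by move=> x _; rewrite lee_fin sqr_ge0.
- by apply/measurable_EFinP; exact: measurable_sqr_cabs.
- by move=> x _; rewrite mule_ge0// lee_fin.
- by apply: emeasurable_funM => //; exact/measurable_EFinP.
- by apply: ae_imply FG => x H _; rewrite -EFinM lee_fin.
Qed.

Lemma csqintg_csqnorm F : cmeasurable F -> (csqnorm F < +oo)%E -> csqintg F.
Proof.
move=> [f1 f2] qF; split; split => //; apply: le_lt_trans qF.
  by rewrite leeDl// sqnorm_ge0.
by rewrite leeDr// sqnorm_ge0.
Qed.

Lemma csqnorm_fin F : csqintg F -> (csqnorm F < +oo)%E.
Proof. by move=> [[_ q1] [_ q2]]; exact: lte_add_pinfty. Qed.

(** Existence in [L^2] rules out the default value of [xget]. *)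
Lemma fourierP (g : R -> R[i]) : in_L2 g -> is_fourier g (fourier g).
Proof.
by move=> /in_L2P cg; apply: xgetPex; exact: (transform_exists sgn_oneN1 cg).
Qed.

Lemma inverse_fourierP G : csqintg G -> is_inverse_fourier G (inverse_fourier G).
Proof. by move=> cG; apply: xgetPex; exact: (transform_exists sgn_one1 cG). Qed.

(* [s] stands for [xi ^ 2] and [m] for [mu ^ 2]. *)
Lemma lowpass_defect_le (m s p A B : R) : 0 < m -> m <= 1 -> 0 <= s -> 0 < p ->
  A ^+ 2 = m `^ p -> B = m -> 0 <= A ->
  (m * s / (1 + m * s)) ^+ 2 <= Num.max A B ^+ 2 * (1 + s) `^ p.
Proof.
move=> m0 m1 s0 p0 AE BE A0.
have ms0 : 0 <= m * s by rewrite mulr_ge0// ltW.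
have d0 : 0 < 1 + m * s by rewrite ltr_wpDr.
set q := m * s / (1 + m * s).
have q0 : 0 <= q by rewrite divr_ge0// ltW.
have q1 : q <= 1 by rewrite ler_pdivrMr// mul1r lerDr.
have qms : q <= m * s by rewrite ler_pdivrMr// mulrDr mulr1 lerDl mulr_ge0.
have s1 : 1 <= 1 + s by rewrite lerDl.
have s10 : 0 <= 1 + s by rewrite addr_ge0.
(* For [p <= 2], [q <= 1] gives [q^2 <= q^p <= (m s)^p], and [m^p] is [A^2]. For [p > 2] the filter
   saturates: only [q^2 <= m^2 s^2] is available, and [s^2 <= (1 + s)^p] absorbs the rest. *)
have [p2|p2] := leP p 2.
  apply: (@le_trans _ _ (A ^+ 2 * (1 + s) `^ p)); last first.
    apply: ler_wpM2r; first exact: powR_ge0.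
    by rewrite ler_pXn2r ?nnegrE ?le_max ?A0// lexx.
  rewrite AE -powRM// ?(ltW m0)//.
  apply: (@le_trans _ _ (q `^ p)).
    rewrite -powR_mulrn//; have [->|qn0] := eqVneq q 0.
      by rewrite !powR0// gt_eqF.
    by apply: ger_powR => //; rewrite lt_neqAle eq_sym qn0 q0.
  apply: ge0_ler_powR; rewrite ?nnegrE ?(ltW p0)//.
    by rewrite mulr_ge0// ltW.
  by apply: le_trans qms _; rewrite ler_pM2l// lerDr.
apply: (@le_trans _ _ (B ^+ 2 * (1 + s) `^ p)); last first.
  apply: ler_wpM2r; first exact: powR_ge0.
  by rewrite ler_pXn2r ?nnegrE ?le_max ?BE ?(ltW m0) ?lexx ?orbT.
rewrite BE; apply: (@le_trans _ _ ((m * s) ^+ 2)); first by rewrite ler_pXn2r ?nnegrE.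
rewrite exprMn ler_pM2l ?exprn_gt0//.
apply: (@le_trans _ _ ((1 + s) ^+ 2)); first by rewrite ler_pXn2r ?nnegrE// lerDr.
by rewrite -powR_mulrn//; apply: ler_powR => //; exact: ltW.
Qed.

End Stability.

Theorem theorem4p5 (R : realType) (alpha nu beta x0 p C : R)
    (halpha : 0 < alpha ^+ 2) (hnu : 0 < nu) (hbeta : 0 <= beta)
    (hx0 : 0 < x0) (hp : 0 < p) (hC : 0 < C)
    (f y : R -> R[i]) (u uhat : R -> R -> R[i])
    (hf : in_L2 f) (hy : in_L2 y)
    (hu : forall x : R, in_L2 (u x))
    (huhat : forall x : R, is_fourier (u x) (uhat x))
    (hsys : frequency_system alpha beta nu x0 f y uhat)
    (hfC : (sobolev_norm p f <= C%:E)%E) :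
  exists K : R, forall delta : R, 0 < delta < 1 ->
    forall ydelta : R -> R[i], in_L2 ydelta ->
      (L2norm (fun t => y t - ydelta t)%R <= delta%:E)%E ->
      forall mu : R, 0 < mu -> mu ^+ 2 = delta `^ (2 / (p + 2)) ->
        (L2norm (fun t =>
           f t - regularized_solution alpha beta nu x0 mu ydelta t)%R
         <= (K * Num.max (delta `^ (p / (p + 2)))
                         (delta `^ (2 / (p + 2))))%:E)%E.
Proof.
have cf := (in_L2P f).1 hf; have cy := (in_L2P y).1 hy.
have Ff := fourierP hf; have Fy := fourierP hy.
have [/in_L2P cFf _] := Ff; have [/in_L2P cFy _] := Fy.
pose L xi := Lambda alpha beta nu x0 xi.
have mL : cmeasurable L by exact: cmeasurable_Lambda.
have fLy : {ae @lebesgue_measure R, forall xi, fourier f xi = L xi * fourier y xi}.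
  apply: ae_imply hsys => xi [[dw dw'] ode w0 wx wl].
  exact: (frequency_solution halpha hnu hbeta hx0 dw dw' ode w0 wx wl).
pose db := denom_bound alpha beta nu x0.
have db0 : 0 < db by exact: denom_bound_gt0.
(* From [nu^2 + xi^2 <= (nu^2 + 1) (1 + xi^2)] and the lower bound [db] of the denominator. *)
pose B := (nu ^+ 2 + 1) / db ^+ 2.
have B0 : 0 <= B by rewrite divr_ge0 ?addr_ge0 ?sqr_ge0.
have LB xi : cabs (L xi) ^+ 2 <= B * (1 + xi ^+ 2).
  have dle := denom_ge beta halpha hnu hx0 xi.
  rewrite /L LambdaE cabsM [cabs _^-1]ComplexField.Normc.normcV exprMn exprVn.
  rewrite (sqr_cabs (nu +i* xi)) [complex.Re _]/= [complex.Im _]/= /B mulrAC; apply: ler_pM.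
  - by rewrite addr_ge0 ?sqr_ge0.
  - by rewrite invr_ge0 sqr_ge0.
  - rewrite mulrDl mul1r mulrDr mulr1 -addrA lerD2l.
    by have := mulr_ge0 (sqr_ge0 nu) (sqr_ge0 xi); lra.
  - have dc : 0 < cabs (denom alpha beta nu x0 xi) by apply: lt_le_trans dle.
    by rewrite lef_pV2 ?posrE ?exprn_gt0// ler_pXn2r ?nnegrE ?(ltW db0) ?(ltW dc).
(* [64] is the cost of inversion, [2 C^2] the doubled bias and [32 B] twice the noise bound [16 B],
   all for squared norms. *)
exists (Num.sqrt (64 * (2 * C ^+ 2 + 32 * B))).
move=> delta /andP[delta0 delta1] yd hyd hdelta mu mu0 mu2.
have cyd := (in_L2P yd).1 hyd.
have Fyd := fourierP hyd; have [/in_L2P cFyd _] := Fyd.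
set A1 := delta `^ (p / (p + 2)); set A2 := delta `^ (2 / (p + 2)).
set M := Num.max A1 A2.
set m := mu ^+ 2 in mu2 *.
have p2 : 0 < p + 2 by rewrite addr_gt0.
have m0 : 0 < m by rewrite mu2 powR_gt0.
have m1 : m <= 1.
  have d01 : 0 < delta <= 1 by rewrite delta0 ltW.
  have q0 : 0 <= 2 / (p + 2) by apply: divr_ge0 => //; exact: ltW.
  by have := ger_powR d01 q0; rewrite powRr0 -mu2.
(* The noise [delta / m], amplified by the filter, is exactly [A1]. *)
have A1m : A1 * m = delta.
  rewrite mu2 /A1 -powRD; last by rewrite (gt_eqF delta0) implybT.
  by rewrite -mulrDl divff ?gt_eqF// powRr1// ltW.
(* The bias has the same size for [p <= 2]: this is the balance behind the choice of [mu]. *)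
have A1p : A1 ^+ 2 = m `^ p.
  rewrite mu2 -[A1 ^+ 2](powR_mulrn 2 (powR_ge0 _ _)) -!powRrM; congr (_ `^ _).
  by field; rewrite gt_eqF.
have A10 : 0 <= A1 by exact: powR_ge0.
pose filt xi : R := 1 + mu ^+ 2 * xi ^+ 2.
have filt0 xi : 0 < filt xi by rewrite ltr_wpDr// mulr_ge0 ?sqr_ge0.
pose Phi xi := L xi / (filt xi)%:C * fourier yd xi.
(* The filter applied to exact data: [fourier f - Psi] is the bias, [Psi - Phi] the noise. *)
pose Psi xi := L xi / (filt xi)%:C * fourier y xi.
have mfilt : cmeasurable (fun xi => (filt xi)%:C).
  apply: cmeasurable_real; apply: measurable_funD; first exact: measurable_cst.
  apply: measurable_funM; first exact: measurable_cst.
  exact: measurable_funX.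
have mLf : cmeasurable (fun xi => L xi / (filt xi)%:C).
  by apply: cmeasurableM => //; exact: cmeasurableV.
have mPhi : cmeasurable Phi.
  by apply: cmeasurableM => //; exact: csqintg_cmeasurable.
have mPsi : cmeasurable Psi.
  by apply: cmeasurableM => //; exact: csqintg_cmeasurable.
(* With [s = xi^2], [m <= 1] gives both [(1 + s) m <= 1 + m s] and [m <= 1 + m s]; their product
   bounds [(1 + s) / (1 + m s)^2] by [1 / m^2]. *)
have LfB xi : cabs (L xi / (filt xi)%:C) ^+ 2 <= B / m ^+ 2.
  rewrite -fmorphV cabsM exprMn sqr_cabs_real exprVn.
  rewrite ler_pdivrMr ?exprn_gt0//; apply: le_trans (LB xi) _.
  rewrite -[leRHS]mulrA; apply: (ler_wpM2l B0).
  rewrite mulrC ler_pdivlMr ?exprn_gt0// /filt -/m.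
  have := sqr_ge0 xi; set s := xi ^+ 2 => s0.
  have h1 : (1 + s) * m <= 1 + m * s by rewrite mulrDl mul1r lerD// mulrC.
  have h2 : m <= 1 + m * s by rewrite (le_trans m1)// lerDl mulr_ge0// ltW.
  rewrite expr2 mulrA [leRHS]expr2; apply: ler_pM => //; last exact: ltW.
  by rewrite mulr_ge0// ?addr_ge0// ltW.
have csqnormL (G : R -> R[i]) : csqintg G ->
    (csqnorm (fun xi => L xi / (filt xi)%:C * G xi)%R <= (B / m ^+ 2)%:E * csqnorm G)%E.
  move=> cG; have mG := csqintg_cmeasurable cG; rewrite (csqnormE mG); apply: csqnorm_le => //.
  - exact: cmeasurableM.
  - exact: measurable_sqr_cabs.
  - by move=> x; exact: sqr_ge0.
  - by rewrite divr_ge0// sqr_ge0.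
  - by apply: aeW => x; rewrite cabsM exprMn ler_wpM2r ?sqr_ge0.
have cL (G : R -> R[i]) : csqintg G -> csqintg (fun xi => L xi / (filt xi)%:C * G xi).
  move=> cG; apply: csqintg_csqnorm.
    by apply: cmeasurableM => //; exact: csqintg_cmeasurable.
  apply: le_lt_trans (csqnormL _ cG) _; apply: lte_mul_pinfty => //.
    by rewrite lee_fin divr_ge0// sqr_ge0.
  exact: csqnorm_fin.
have cPhi : csqintg Phi by exact: cL.
have cPsi : csqintg Psi by exact: cL.
have Fr := inverse_fourierP cPhi.
have [/in_L2P cr _] := Fr.
rewrite L2norm_le; [|exact: csqintgB|]; last first.
  by rewrite mulr_ge0 ?sqrtr_ge0// le_max A10.
apply: le_trans (inverse_close cf Ff cPhi Fr) _.
have E1 : (csqnorm (fun xi => fourier f xi - Psi xi)%R <= (M ^+ 2 * C ^+ 2)%:E)%E.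
  pose g xi := cabs (fourier f xi) ^+ 2 * (1 + xi ^+ 2) `^ p.
  have g0 xi : 0 <= g xi by rewrite mulr_ge0 ?sqr_ge0 ?powR_ge0.
  have gC : (\int[@lebesgue_measure R]_xi (g xi)%:E <= (C ^+ 2)%:E)%E.
    rewrite -poweR_half_le ?(ltW hC)//.
    by apply: integral_ge0 => xi _; rewrite lee_fin.
  apply: (@le_trans _ _ ((M ^+ 2)%:E * \int[@lebesgue_measure R]_xi (g xi)%:E)%E); last first.
    by rewrite (EFinM (M ^+ 2)); apply: lee_wpmul2l => //; rewrite lee_fin sqr_ge0.
  apply: csqnorm_le => //.
  - exact: csqintg_cmeasurable (csqintgB cFf cPsi).
  - apply: measurable_funM.
      by apply: measurable_sqr_cabs; exact: csqintg_cmeasurable.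
    apply: (measurableT_comp (measurable_powR _)).
    by apply: measurable_funD => //; exact: measurable_funX.
  - exact: sqr_ge0.
  - apply: ae_imply fLy => xi fL.
    (* Since [L] times the transform of [y] is that of [f], the bias is [1 - 1 / filt] times the
       transform of [f]. *)
    have -> : fourier f xi - Psi xi = fourier f xi * (m * xi ^+ 2 / filt xi)%:C.
      rewrite /Psi mulrAC -fL.
      have -> : m * xi ^+ 2 / filt xi = 1 - (filt xi)^-1.
        have fn := lt0r_neq0 (filt0 xi).
        by apply: (mulIf fn); rewrite mulfVK// mulrBl mul1r mulVf// addrC addKr.
      by rewrite rmorphB/= rmorph1 fmorphV/= mulrBr mulr1.
    rewrite cabsM exprMn sqr_cabs_real /g [leRHS]mulrCA.
    apply: ler_wpM2l; first exact: sqr_ge0.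
    by apply: lowpass_defect_le => //; rewrite sqr_ge0.
have E2 : (csqnorm (fun xi => Psi xi - Phi xi)%R <= (16 * B * M ^+ 2)%:E)%E.
  rewrite (_ : (fun xi => _) =
    (fun xi => L xi / (filt xi)%:C * (fourier y xi - fourier yd xi))); last first.
    by apply/funext => xi; rewrite mulrBr.
  apply: le_trans (csqnormL _ (csqintgB cFy cFyd)) _.
  have := transform_close sgn_oneN1 cy cyd Fy Fyd.
  move: hdelta; rewrite L2norm_le ?(ltW delta0)//; last exact: csqintgB.
  move=> hd /le_trans H.
  have {H} := H _ (lee_wpmul2l _ hd) => H.
  apply: (@le_trans _ _ ((B / m ^+ 2)%:E * (16%:E * (delta ^+ 2)%:E))%E).
    by apply: lee_wpmul2l; [rewrite lee_fin divr_ge0// sqr_ge0|exact: H].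
  (* Substituting [delta = A1 * m] cancels the factor [1 / m^2] of the filter. *)
  have E (b a t : R) : t != 0 -> b / t ^+ 2 * (16 * (a * t) ^+ 2) = 16 * b * a ^+ 2.
    by move=> t0; field.
  rewrite -!EFinM lee_fin -A1m E ?gt_eqF//.
  apply: ler_wpM2l; first by rewrite mulr_ge0.
  by rewrite ler_pXn2r ?nnegrE ?le_max ?A10 ?lexx.
apply: (@le_trans _ _ (64%:E * (2%:E * (M ^+ 2 * C ^+ 2)%:E + 2%:E * (16 * B * M ^+ 2)%:E))%E).
  apply: lee_wpmul2l => //; apply: le_trans (csqnorm_triangle cFf cPsi cPhi) _.
  by apply: leeD; exact: lee_wpmul2l.
rewrite -!EFinM lee_fin exprMn sqr_sqrtr; last first.
  by rewrite mulr_ge0// addr_ge0// mulr_ge0// sqr_ge0.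
by rewrite le_eqVlt; apply/orP; left; apply/eqP; ring.
Qed.
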